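(* Let $(H,\|\cdot\|_H,\langle\cdot,\cdot\rangle_H)$ be a separable real Hilbert space, let $T\in(0,\infty)$, $\eta,\delta\in\mathbb R$, let $(\Omega,\mathcal F,\mathbb P,(\mathcal F_t)_{t\in[0,T]})$ be a stochastic basis, let $A\colon D(A)\subseteq H\to H$ be a diagonal linear operator with $\mathrm{spectrum}(A)\subseteq(-\infty,\eta)$, and let $(H_r,\|\cdot\|_{H_r},\langle\cdot,\cdot\rangle_{H_r})$, $r\in\mathbb R$, be a family of interpolation spaces associated to $\eta-A$. Let $k\in\mathbb N=\{1,2,\dots\}$, let $\xi\colon\Omega\to H_\delta$ be $\mathcal F_0/\mathcal B(H_\delta)$-measurable, let $L_1,\dots,L_k\in L(H)$ and $B\in L(H,HS(\mathbb R^k,H))$ satisfy for all $i,j\in\{1,\dots,k\}$, $v\in H$, $u\in D(A)$, $\mathbf y=(y_1,\dots,y_k)\in\mathbb R^k$ that $L_i(D(A))\subseteq D(A)$, $L_iL_ju-L_jL_iu=L_iAu-AL_iu=0$, and $B(v)\mathbf y=\sum_{l=1}^ky_lL_lv$. Let $W=(W^{(1)},\dots,W^{(k)})\colon[0,T]\times\Omega\to\mathbb R^k$ be a $k$-dimensional standard $(\mathcal F_t)_{t\in[0,T]}$-Brownian motion with continuous sample paths, and let $X\colon[0,T]\times\Omega\to H_\delta$ satisfy for all $t\in[0,T]$ that $$X_t=\exp\Big(tA+\sum_{i=1}^k\big[W^{(i)}_tL_i-\tfrac12t(L_i)^2\big]\Big)\,\xi.$$ Then $X$ has continuous sample paths and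 for all $r\in\mathbb R$, $t\in[0,T]$ it holds $\mathbb P$-a.s. that $\int_0^t\|e^{(t-s)A}B(X_s)\|^2_{HS(\mathbb R^k,H_r)}\,ds<\infty$ and $$X_t=e^{tA}\xi+\int_0^te^{(t-s)A}B(X_s)\,dW_s.$$
   Context: A stochastic basis is a probability space with a normal filtration (right-continuous, with $\mathcal F_0$ containing all $\mathbb P$-null sets). $A$ diagonal means: there are an orthonormal basis $\mathbb B\subseteq H$ of $H$ and a function $\lambda\colon\mathbb B\to\mathbb R$ with $D(A)=\{v\in H\colon\sum_{b\in\mathbb B}|\lambda_b\langle b,v\rangle_H|^2<\infty\}$ and $Av=-\sum_{b\in\mathbb B}\lambda_b\langle b,v\rangle_Hb$ for $v\in D(A)$. Interpolation spaces associated to $\eta-A$: for $r\ge0$, $H_r=D((\eta-A)^r)$ with $\|v\|_{H_r}=\|(\eta-A)^rv\|_H$; for $r<0$, $H_r$ is the completion of $H$ with respect to $\|v\|_{H_r}=\|(\eta-A)^rv\|_H$; the semigroup operators $e^{tA}$ and the operators $L_i$ (which commute with $A$) act on the spaces $H_r$ by restriction or continuous extension. The exponential $\exp(tA+\sum_i[W^{(i)}_tL_i-\frac12t(L_i)^2])$ is understood as $\exp(\sum_i[W^{(i)}_tL_i-\frac12t(L_i)^2])\,e^{tA}$, where the first factor is the exponential of a bounded operator. For $t>0$ one has $X_t\in H$, so $B(X_t)$ makes sense; in time integrals the value of the integrand at time $0$ is irrelevant. $L(V,W)$ denotes bounded linear operators ($L(V)=L(V,V)$) and $HS(V,W)$ Hilbert–Schmidt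 operators from $V$ to $W$. *)

(* Defs.v *)
From HB Require Import structures.
From mathcomp Require Import all_boot all_order all_algebra.
From mathcomp Require Import all_classical all_reals all_analysis measurable_realfun.
From mathcomp.analysis.showcase Require summability.

Set Implicit Arguments.
Unset Strict Implicit.
Unset Printing Implicit Defensive.

Import Order.TTheory GRing.Theory Num.Theory.
Import numFieldNormedType.Exports.

Local Open Scope classical_set_scope.
Local Open Scope ring_scope.

(* A real Hilbert space is a completeNormedModType H together with an inner
   product ip whose associated norm is the norm of H. *)
Definition induces_norm (R : realType) (H : completeNormedModType R)
    (ip : {dot H for @idfun R}) : Prop :=
  forall v : H, ip v v = `|v| ^+ 2.

Definition separable_space (T : topologicalType) : Prop :=
  exists S : set T, countable S /\ dense S.

Section DiagonalOperators.
Context {R : realType} {H : completeNormedModType R}.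
Variables (ip : {dot H for @idfun R}) (BB : set H).

(* Sums over BB are unordered: limits along the directed set of finite sets. *)
Definition orthonormal_basis : Prop :=
  (forall b c, BB b -> BB c -> ip b c = (b == c)%:R) /\
  (forall v : H,
     summability.partial_sum (fun b => if b \in BB then ip b v *: b else 0)
       @ summability.totally --> v).

(* v |-> \sum_(b in BB) f b <b, v> b, and its maximal domain *)
Definition multiplier_dom (f : H -> R) : set H :=
  [set v | (\esum_(b in BB) (((f b * ip b v) ^+ 2)%:E) < +oo)%E].

Definition multiplier (f : H -> R) (v : H) : H :=
  summability.sum (fun b => if b \in BB then (f b * ip b v) *: b else 0).

Definition diagonal_operator (lam : H -> R) (DA : set H) (A : H -> H) : Prop :=
  DA = multiplier_dom lam /\ forall v, DA v -> A v = - multiplier lam v.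

(* (eta - A)^r has the eigenvalues (eta + lam b)^r *)
Definition frac_power_dom (eta : R) (lam : H -> R) (r : R) : set H :=
  multiplier_dom (fun b => (eta + lam b) `^ r).

Definition frac_power (eta : R) (lam : H -> R) (r : R) : H -> H :=
  multiplier (fun b => (eta + lam b) `^ r).

(* e^{tA} *)
Definition semigroup (lam : H -> R) (t : R) : H -> H :=
  multiplier (fun b => expR (- (t * lam b))).

End DiagonalOperators.

Section Spectrum.
Context {R : realType} {H : completeNormedModType R}.

Definition resolvent_set (DA : set H) (A : H -> H) : set R :=
  [set mu | exists S : {linear H -> H},
    [/\ continuous S,
        (forall v, DA (S v) /\ mu *: S v - A (S v) = v)
      & (forall u, DA u -> S (mu *: u - A u) = u)]].

Definition spectrum (DA : set H) (A : H -> H) : set R :=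
  ~` resolvent_set DA A.

End Spectrum.

(* Elements of different H_r are compared inside a common vector space
   [ambient], in which H and every H_r embed. For r < 0 the completion of H is
   given by its defining properties: a complete space containing H densely and
   isometrically for the norm v |-> |(eta - A)^r v|. *)
Record interpolation_spaces (R : realType) (H : completeNormedModType R)
    (ip : {dot H for @idfun R}) (BB : set H) (lam : H -> R) (eta : R) :=
  InterpolationSpaces {
    ambient : lmodType R;
    base_inj : {linear H -> ambient};
    space :> R -> completeNormedModType R;
    space_inj : forall r : R, {linear space r -> ambient};
    base_injP : injective base_inj;
    space_injP : forall r : R, injective (space_inj r);
    space_norm : forall (r : R) (x : space r) (v : H),
      space_inj r x = base_inj v -> `|x| = `|frac_power ip BB eta lam r v|;
    space_ge0 : forall r : R, 0 <= r ->
      range (space_inj r) = base_inj @` frac_power_dom ip BB eta lam r;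
    space_lt0 : forall r : R, r < 0 ->
      range base_inj `<=` range (space_inj r) /\
      dense [set x : space r | range base_inj (space_inj r x)]
  }.

Section OperatorsOnScale.
Context {R : realType} {H : completeNormedModType R}
  {ip : {dot H for @idfun R}} {BB : set H} {lam : H -> R} {eta : R}.
Variable Hs : interpolation_spaces ip BB lam eta.

(* S' is the restriction (r >= 0) or continuous extension (r < 0) of S to H_r *)
Definition induced_op_spec (r : R) (S : H -> H) (S' : Hs r -> Hs r) : Prop :=
  [/\ linear S', continuous S'
    & forall (x : Hs r) (v : H), space_inj Hs r x = base_inj Hs v ->
        space_inj Hs r (S' x) = base_inj Hs (S v)].

Definition induced_op (r : R) (S : H -> H) : Hs r -> Hs r :=
  @xget (Hs r -> Hs r) idfun [set S' | induced_op_spec S S'].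

End OperatorsOnScale.

Section OperatorExponential.
Context {R : realType} {V : completeNormedModType R}.

Definition exp_op (S : V -> V) (v : V) : V :=
  lim (series (fun n => (n`!%:R)^-1 *: iter n S v) @ \oo).

(* \sum_i [w_i L_i - t/2 (L_i)^2] *)
Definition exponent (k : nat) (L : 'I_k -> V -> V) (t : R) (w : 'rV[R]_k)
    (v : V) : V :=
  \sum_(i < k) (w 0 i *: L i v - (t / 2) *: L i (L i v)).

End OperatorExponential.

Section HilbertSchmidt.
Context {R : realType}.

(* Every linear map on R^k is Hilbert-Schmidt; the norm is computed on the
   standard basis. 'rV[R]_k is used as a vector space only: its library norm is
   not the Euclidean one and plays no role. *)
Definition HSnorm2 (E : normedModType R) (k : nat) (S : 'rV[R]_k -> E) : R :=
  \sum_(i < k) `|S (delta_mx 0 i)| ^+ 2.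

(* membership in L(H, HS(R^k, E)) *)
Definition bounded_HS (H E : normedModType R) (k : nat)
    (B : H -> {linear 'rV[R]_k -> E}) : Prop :=
  (forall a u v y, B (a *: u + v) y = a *: B u y + B v y) /\
  exists C : R, forall v, Num.sqrt (HSnorm2 (B v)) <= C * `|v|.

End HilbertSchmidt.

Section StochasticBasis.
Context {R : realType} {d : measure_display} {Omega : measurableType d}.
Variables (P : probability Omega R) (T : R) (F : R -> set (set Omega)).

Definition normal_filtration : Prop :=
  [/\ (forall t, 0 <= t <= T ->
         sigma_algebra [set: Omega] (F t) /\ F t `<=` measurable),
      (forall s t, 0 <= s -> s <= t -> t <= T -> F s `<=` F t),
      (forall t, 0 <= t < T -> F t = \bigcap_(s in `]t, T]) F s)
    & (forall N, measurable N -> P N = 0%E -> F 0 N)].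

Definition borel_measurable_wrt (G : set (set Omega)) (E : topologicalType)
    (f : Omega -> E) : Prop :=
  forall U : set E, <<s [set V : set E | open V] >> U -> G (f @^-1` U).

(* The last clause says at once that W_t - W_s is independent of F_s and that
   its law is the product of k centered normal laws of variance t - s; the
   second argument of normal_prob is the standard deviation. *)
Definition standard_brownian_motion (k : nat) (W : R -> Omega -> 'rV[R]_k)
    : Prop :=
  [/\ {ae P, forall omega, W 0 omega = 0},
      (forall t (i : 'I_k), 0 <= t <= T ->
         borel_measurable_wrt (F t) (fun omega => W t omega 0 i : R))
    & (forall s t, 0 <= s -> s < t -> t <= T ->
       forall (G : set Omega) (D : 'I_k -> set R),
         F s G -> (forall i, measurable (D i)) ->
         P (G `&` [set omega | forall i, D i (W t omega 0 i - W s omega 0 i)])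
         = (P G * \prod_(i < k) normal_prob 0 (Num.sqrt (t - s)) (D i))%E)].

End StochasticBasis.

(* Stochastic integral of an HS(R^k, E)-valued process over ]0, t], as the limit
   in probability of integrals of elementary processes that approximate the
   integrand in L^2(]0, t]) in probability. This is a relation: the integral is
   a class of almost surely equal random variables. *)
Section StochasticIntegral.
Context {R : realType} {d : measure_display} {Omega : measurableType d}.
Variables (P : probability Omega R) (F : R -> set (set Omega)).
Variables (k : nat) (W : R -> Omega -> 'rV[R]_k) (E : normedModType R).

Local Notation HS := {linear 'rV[R]_k -> E}.

(* \sum_(m < n) Z_m 1_(]tau_m, tau_(m+1)]) with 0 = tau_0 <= .. <= tau_n = t and
   finitely valued F_(tau_m)-measurable Z_m *)
Definition elementary (t : R) (n : nat) (tau : nat -> R)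
    (Z : nat -> Omega -> HS) : Prop :=
  [/\ tau 0%N = 0, tau n = t, (forall m, (m < n)%N -> tau m <= tau m.+1)
    & forall m, (m < n)%N ->
        finite_set (range (Z m)) /\
        (forall S : HS, F (tau m) (Z m @^-1` [set S]))].

Definition elementary_process (n : nat) (tau : nat -> R)
    (Z : nat -> Omega -> HS) (s : R) (omega : Omega) (y : 'rV[R]_k) : E :=
  \sum_(m < n) (if tau m < s <= tau m.+1 then Z m omega y else 0).

Definition elementary_integral (n : nat) (tau : nat -> R)
    (Z : nat -> Omega -> HS) (omega : Omega) : E :=
  \sum_(m < n) Z m omega (W (tau m.+1) omega - W (tau m) omega).

Definition progressive (t : R) (Phi : R -> Omega -> HS) : Prop :=
  forall u (y : 'rV[R]_k) (U : set E), 0 <= u <= t -> open U ->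
    measurable ((`]0%R, u] `*` setT) `&` [set p | U (Phi p.1 p.2 y)]
      : set (measurableTypeR R * g_sigma_algebraType (F u))).

Definition cvg_in_probability0 (f : nat -> Omega -> \bar R) : Prop :=
  (forall n, measurable_fun [set: Omega] (f n)) /\
  forall e : R, 0 < e ->
    P [set omega | (e%:E <= f n omega)%E] @[n --> \oo] --> 0%E.

Definition sq_integral (t : R) (Phi : R -> Omega -> 'rV[R]_k -> E)
    (omega : Omega) : \bar R :=
  (\int[lebesgue_measure]_(s in `]0%R, t]) (HSnorm2 (Phi s omega))%:E)%E.

Definition is_stochastic_integral (t : R) (Phi : R -> Omega -> HS)
    (I : Omega -> E) : Prop :=
  [/\ progressive t Phi,
      {ae P, forall omega, (sq_integral t (fun s w => Phi s w) omega < +oo)%E},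
      borel_measurable_wrt measurable I
    & exists (n : nat -> nat) (tau : nat -> nat -> R)
             (Z : nat -> nat -> Omega -> HS),
        [/\ (forall j, elementary t (n j) (tau j) (Z j)),
            cvg_in_probability0 (fun j => sq_integral t
              (fun s w y => Phi s w y
                 - elementary_process (n j) (tau j) (Z j) s w y))
          & cvg_in_probability0 (fun j w =>
              (`|I w - elementary_integral (n j) (tau j) (Z j) w|)%:E)]].

End StochasticIntegral.

Section MildIntegrand.
Context {R : realType} {H : completeNormedModType R}
  {ip : {dot H for @idfun R}} {BB : set H} {lam : H -> R} {eta : R}.
Variable Hs : interpolation_spaces ip BB lam eta.

(* Phi s = e^{(t-s)A} B(X_s) in HS(R^k, H_r) for 0 < s <= t. This determines Phi
   on ]0, t]; it includes that X_s lies in H and that the values of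
   e^{(t-s)A} B(X_s) lie in H_r. *)
Definition mild_integrand (Omega : Type) (k : nat)
    (B : H -> {linear 'rV[R]_k -> H}) (delta r t : R)
    (X : R -> Omega -> Hs delta)
    (Phi : R -> Omega -> {linear 'rV[R]_k -> Hs r}) : Prop :=
  forall s omega, 0 < s <= t ->
    exists h : H, base_inj Hs h = space_inj Hs delta (X s omega) /\
      forall y, space_inj Hs r (Phi s omega y)
                = base_inj Hs (semigroup ip BB lam (t - s) (B h y)).

End MildIntegrand.

(* Main.v *)
(* In the coordinates of the basis, (eta - A)^r is the multiplier (eta + lam)^r
   with eta + lam bounded below by a positive constant (the spectral gap), and
   each H_r is a copy of H on which e^{tA} and the L_i act as on H. Since the L_i
   commute with one another and with every spectral multiplier, with the flow
   U_s := exp(sum_i [W^i_s L_i - s/2 (L_i)^2]) the mild integrand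
   e^{(t-s)A} B(X_s), read in H for the norm of H_r, becomes the map
   y |-> sum_l y_l L_l U_s z with the fixed initial value
   z := (eta - A)^(r-delta) e^{tA} xi, which lies in H because e^{tA} smooths.
   Everything thus reduces to the linear equation with bounded commuting
   coefficients U_t z - z = int_0^t sum_l L_l U_s z dW^l_s. On a uniform grid,
   the second-order expansion of U over a step leaves, besides the Riemann-Ito
   sum, a remainder of third order, which is small by the second and fourth
   moments of the increments, and the terms (dW^i dW^j - [i = j] ds) L_i L_j U z,
   which are orthogonal martingale differences once z and W are localized to a
   bounded set. The elementary approximations are the values of U z at the grid
   points, rounded to a finite subset of a dense sequence. *)

Require Import Defs.
From HB Require Import structures.
From mathcomp Require Import all_boot all_order all_algebra.
From mathcomp Require Import all_classical all_reals all_analysis measurable_realfun.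
From mathcomp Require Import ring lra finmap.
From mathcomp.analysis.showcase Require summability.

Set Implicit Arguments.
Unset Strict Implicit.
Unset Printing Implicit Defensive.

Import Order.TTheory GRing.Theory Num.Theory.
Import numFieldNormedType.Exports.

Local Open Scope classical_set_scope.
Local Open Scope ring_scope.

(** * Inner products, orthonormal bases and multipliers *)

(** Nothing is assumed about moments of xi, and X is given in closed form. The candidate for the
    stochastic integral, the isometric image of U_t z - z, is therefore explicit, and no existence
    theory for the integral is used: it suffices to exhibit elementary processes that converge to
    the integrand and whose integrals converge to the candidate. All limits are in probability;
    expectations are taken only of Brownian increments and of truncated terms. The truncation is an
    indicator, at each grid point, that z and the current value of W are bounded. It keeps the
    summands adapted, so that no stopping time occurs, and on an event of probability close to 1 it
    equals 1 on all grids at once. Since z depends on t, the Ito argument runs with t fixed. By the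
    group law of commuting exponentials each grid step is again a flow, driven by the increment of W
    and started at the value at the left end point, so one deterministic expansion serves all steps.
    The mean and variance of an increment are read off from the moment generating function of the
    normal law, by comparing Taylor coefficients at 0. *)

Section inner_product.
Context {R : realType} {H : completeNormedModType R} (ip : {dot H for @idfun R}).

Lemma ipDl u v w : ip (u + v) w = ip u w + ip v w.
Proof. exact: linearDl. Qed.

Lemma ipDr u v w : ip u (v + w) = ip u v + ip u w.
Proof. exact: linearDr. Qed.

Lemma ipZl a u w : ip (a *: u) w = a * ip u w.
Proof. exact: linearZl_LR. Qed.

Lemma ipC u v : ip u v = ip v u.
Proof. by rewrite hermC expr0 mul1r. Qed.

Lemma ipZr a u w : ip u (a *: w) = a * ip u w.
Proof. by rewrite ipC ipZl ipC. Qed.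

Lemma ip0r u : ip u 0 = 0.
Proof. exact: linear0r. Qed.

Lemma ipBr u v w : ip u (v - w) = ip u v - ip u w.
Proof. exact: linearBr. Qed.

Lemma ip_sumr u (I : Type) (s : seq I) (P : pred I) (F : I -> H) :
  ip u (\sum_(i <- s | P i) F i) = \sum_(i <- s | P i) ip u (F i).
Proof. exact: linear_sumr. Qed.

Hypothesis hip : induces_norm ip.

Lemma normD2 u v : `|u + v| ^+ 2 = `|u| ^+ 2 + 2 * ip u v + `|v| ^+ 2.
Proof. rewrite -!hip ipDl !ipDr (ipC v u); ring. Qed.

Lemma normB2 u v : `|u - v| ^+ 2 = `|u| ^+ 2 - 2 * ip u v + `|v| ^+ 2.
Proof. by rewrite normD2 normrN -scaleN1r ipZr mulrCA mulN1r. Qed.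

Lemma ip_CS u v : `|ip u v| <= `|u| * `|v|.
Proof.
have [->|v0] := eqVneq v 0; first by rewrite ip0r !normr0 mulr0.
have v2 : 0 < `|v| ^+ 2 by rewrite exprn_gt0// normr_gt0.
have := sqr_ge0 `|(`|v| ^+ 2) *: u - ip u v *: v|.
rewrite normB2 !normrZ ipZl ipZr !exprMn !real_normK ?num_real//.
have -> : (`|v| ^+ 2) ^+ 2 * `|u| ^+ 2 - 2 * (`|v| ^+ 2 * (ip u v * ip u v)) +
  ip u v ^+ 2 * `|v| ^+ 2 = `|v| ^+ 2 * ((`|u| * `|v|) ^+ 2 - ip u v ^+ 2) by ring.
rewrite pmulr_rge0// subr_ge0 -[X in X <= _]real_normK ?num_real//.
by rewrite ler_pXn2r// nnegrE// mulr_ge0.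
Qed.

Lemma ip_continuous u : continuous (ip u).
Proof.
move=> v; apply/cvgrPdist_lt => e e0.
have u1 : 0 < `|u| + 1 by rewrite ltr_wpDl.
near=> w.
rewrite -ipBr (le_lt_trans (ip_CS _ _))// (@le_lt_trans _ _ ((`|u| + 1) * `|v - w|))//.
  by rewrite ler_wpM2r// lerDl.
rewrite mulrC -ltr_pdivlMr//.
near: w; apply: cvgr_dist_lt; [exact: cvg_id|exact: divr_gt0].
Unshelve. all: by end_near.
Qed.

End inner_product.

Section coordinates.
Context {R : realType} {H : completeNormedModType R} (ip : {dot H for @idfun R})
  (BB : set H).
Hypothesis (hip : induces_norm ip) (hBB : orthonormal_basis ip BB).
Local Open Scope fset_scope.
Implicit Types (c f g : H -> R) (u v : H) (A : {fset H}).

Definition basis_sum c A : H := \sum_(b <- A) (if b \in BB then c b *: b else 0).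
Definition sqr_sum c A : R := \sum_(b <- A) (if b \in BB then c b ^+ 2 else 0).

Lemma partial_sumE c :
  summability.partial_sum (fun b => if b \in BB then c b *: b else 0) = basis_sum c.
Proof.
by apply/funext => A; rewrite /summability.partial_sum /basis_sum big_seq_fsetE.
Qed.

Lemma ip_basis_sum c A b : BB b -> ip b (basis_sum c A) = if b \in A then c b else 0.
Proof.
move=> Bb; rewrite ip_sumr.
rewrite (eq_bigr (fun a => if a == b then c b else 0)); last first.
  move=> a _; case: ifPn => [/set_mem Ba|/negP Ba].
    rewrite ipZr (hBB.1 _ _ Bb Ba) eq_sym.
    by case: eqP => [->|_]; rewrite ?mulr1 ?mulr0.
  rewrite ip0r; case: eqP => // ab; subst a; case: Ba; exact/mem_set.
case: ifPn => bA.
  rewrite (big_fsetD1 b)//= eqxx big1_fset ?addr0// => i.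
  by rewrite in_fsetD1 => /andP[/negPf ->].
by rewrite big1_fset// => i iA _; case: eqP => // ib; rewrite -ib iA in bA.
Qed.

Lemma norm_basis_sum c A : `|basis_sum c A| ^+ 2 = sqr_sum c A.
Proof.
rewrite -hip [X in ip X _]/basis_sum ipC// ip_sumr.
rewrite /sqr_sum big_seq_cond [RHS]big_seq_cond.
apply: eq_bigr => b /andP[bA _]; case: ifPn => [/set_mem Bb|_]; last exact: ip0r.
by rewrite ipZr ipC ip_basis_sum// bA.
Qed.

Lemma basis_sumB c A D : A `<=` D -> basis_sum c D - basis_sum c A = basis_sum c (D `\` A).
Proof.
move=> AD; rewrite /basis_sum (big_fsetID _ (mem A) D)/=.
have -> : [fset x in D | x \in A] = A.
  apply/fsetP => x; rewrite !inE andbC; case: (boolP (x \in A)) => //= xA.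
  exact: (fsubsetP AD).
rewrite addrAC subrr add0r; apply: eq_fbigl => x.
by rewrite !inE andbC.
Qed.

Lemma sqr_sumB c A D : A `<=` D -> sqr_sum c D - sqr_sum c A = sqr_sum c (D `\` A).
Proof.
move=> AD; rewrite /sqr_sum (big_fsetID _ (mem A) D)/=.
have -> : [fset x in D | x \in A] = A.
  apply/fsetP => x; rewrite !inE andbC; case: (boolP (x \in A)) => //= xA.
  exact: (fsubsetP AD).
rewrite addrAC subrr add0r; apply: eq_fbigl => x.
by rewrite !inE andbC.
Qed.

(** Square summability as a real bound on all finite sums; [multiplier_domP] translates it from the
    extended real sum. *)
Definition l2_bound c (M : R) := forall A, sqr_sum c A <= M.

Lemma bessel v : l2_bound (fun b => ip b v) (`|v| ^+ 2).
Proof.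
move=> A; have := sqr_ge0 `|v - basis_sum (fun b => ip b v) A|.
rewrite (normB2 hip) norm_basis_sum ip_sumr.
suff -> : \sum_(i <- A) ip v (if i \in BB then ip i v *: i else 0) =
  sqr_sum (fun b => ip b v) A by lra.
by apply: eq_bigr => b _; case: ifP => _; rewrite ?ip0r// ipZr [ip v b]ipC.
Qed.

Lemma multiplier_domP f v :
  multiplier_dom ip BB f v <-> exists M, l2_bound (fun b => f b * ip b v) M.
Proof.
rewrite /multiplier_dom /= esum_mkcond.
pose a (b : H) : \bar R := (if b \in BB then ((f b * ip b v) ^+ 2)%:E else 0)%E.
rewrite -/(esum [set: H] a).
have aE b : a b = (if b \in BB then (f b * ip b v) ^+ 2 else 0)%:E.
  by rewrite /a; case: ifP.
have a0 b : (0 <= a b)%E by rewrite aE lee_fin; case: ifP => // _; exact: sqr_ge0.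
have sumE A : (\sum_(b <- A) a b)%E = (sqr_sum (fun b => f b * ip b v) A)%:E.
  by rewrite /sqr_sum -sumEFin; apply: eq_bigr => b _; exact: aE.
split=> [h|[M hM]]; last first.
  rewrite (@le_lt_trans _ _ M%:E)// ?ltry// ; apply: ub_ereal_sup => _ [A [fA _] <-].
  by rewrite fsbig_finite// sumE lee_fin; exact: hM.
exists (fine (\esum_(b in [set: H]) a b)) => A.
have fin : (\esum_(b in [set: H]) a b)%E \is a fin_num.
  by rewrite ge0_fin_numE//; apply: esum_ge0.
rewrite -lee_fin fineK//; apply: esum_ge; exists [set` A].
  by split; [exact: finite_fset|].
by rewrite fsbig_finite ?set_fsetK ?sumE//; exact: finite_fset.
Qed.

(** Riesz-Fischer: past a finite set on which [sqr_sum c] is within e^2 of its supremum,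
    orthogonality makes every further finite piece shorter than e. *)
Lemma l2_cvg c M : l2_bound c M -> exists s,
  [/\ basis_sum c @ summability.totally --> s, forall b, BB b -> ip b s = c b
    & `|s| ^+ 2 <= M].
Proof.
move=> cM.
have FF := @summability.totally_filter H.
pose S := range (sqr_sum c).
have hS : has_sup S.
  split; first by exists (sqr_sum c fset0); exists fset0.
  by exists M => _ [A _ <-].
have : cvg (basis_sum c @ summability.totally).
  apply/cauchy_cvgP/cauchy_exP => e e0.
  have e2 : 0 < e ^+ 2 by rewrite exprn_gt0.
  have [_ [A _ <-] hA] := sup_adherent e2 hS.
  exists (basis_sum c A); exists A => // D /= AD.
  rewrite -ball_normE/= distrC basis_sumB//.
  rewrite -(@ltr_pXn2r _ 2)// ?nnegrE// ?ltW// norm_basis_sum -sqr_sumB//.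
  have : sqr_sum c D <= sup S by apply: (ub_le_sup hS.2); exists D.
  lra.
move=> /cvg_ex[s hs]; exists s; split=> //.
  move=> b Bb.
  have : ip b \o basis_sum c @ summability.totally --> ip b s.
    by apply: cvg_comp hs _; exact: ip_continuous.
  move=> /norm_cvg_lim <-; apply: lim_near_cst; first exact: norm_hausdorff.
  exists [fset b] => // A /=; rewrite fsub1set => bA.
  by rewrite /= ip_basis_sum// bA.
have : (fun A => `|basis_sum c A| ^+ 2) @ summability.totally --> `|s| ^+ 2.
  apply: (@cvg_comp _ _ _ _ (fun x : R => x ^+ 2)); first exact: (cvg_norm hs).
  exact: sqr_continuous.
move=> h; rewrite -(norm_cvg_lim h); apply: limr_le; first exact: cvgP h.
by near=> A; rewrite norm_basis_sum; exact: cM.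
Unshelve. all: by end_near.
Qed.

Lemma coord_inj u v : (forall b, BB b -> ip b u = ip b v) -> u = v.
Proof.
have FF := @summability.totally_filter H.
move=> uv; have := hBB.2 u; have := hBB.2 v.
rewrite (_ : (fun b => if b \in BB then ip b v *: b else 0) =
  (fun b => if b \in BB then ip b u *: b else 0)).
  by move=> /norm_cvg_lim vE /norm_cvg_lim uE; exact: etrans (esym uE) vE.
by apply/funext => b; case: ifPn => // /set_mem Bb; rewrite uv.
Qed.

Lemma multiplierP f v : multiplier_dom ip BB f v ->
  forall b, BB b -> ip b (multiplier ip BB f v) = f b * ip b v.
Proof.
have FF := @summability.totally_filter H.
move=> /multiplier_domP[M /l2_cvg[s [+ sf _]]] b Bb.
rewrite -partial_sumE => /norm_cvg_lim.
by rewrite -/(summability.sum _) -/(multiplier ip BB f v) => ->; exact: sf.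
Qed.

Lemma multiplier_eq f v w : multiplier_dom ip BB f v ->
  (forall b, BB b -> ip b w = f b * ip b v) -> multiplier ip BB f v = w.
Proof.
by move=> fv h; apply: coord_inj => b Bb; rewrite multiplierP// h.
Qed.

(** By Bessel's inequality for w. Membership in a domain is thus shown by exhibiting the image
    vector through its coordinates, which is how the calculus below proceeds. *)
Lemma multiplier_domE f v w :
  (forall b, BB b -> ip b w = f b * ip b v) -> multiplier_dom ip BB f v.
Proof.
move=> h; apply/multiplier_domP; exists (`|w| ^+ 2) => A.
rewrite (le_trans _ (bessel w A))// /sqr_sum; apply: ler_sum => b _.
by case: ifPn => // /set_mem Bb; rewrite h.
Qed.

(** Bessel for v bounds the coordinates of w; [l2_cvg] rebuilds from them a vector satisfying the
    norm bound, and that vector is w by [coord_inj]. *)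
Lemma norm_le_coord v C : 0 <= C -> forall w,
  (forall b, BB b -> `|ip b w| <= C * `|ip b v|) -> `|w| <= C * `|v|.
Proof.
move=> C0 w h.
have : l2_bound (fun b => ip b w) ((C * `|v|) ^+ 2).
  move=> A; rewrite exprMn; apply: le_trans (ler_wpM2l _ (bessel v A)); last exact: sqr_ge0.
  rewrite /sqr_sum mulr_sumr; apply: ler_sum => b _.
  case: ifPn => [/set_mem Bb|_]; last by rewrite mulr0.
  rewrite -[X in X <= _]real_normK ?num_real// -[X in _ * X]real_normK ?num_real//.
  by rewrite -exprMn ler_pXn2r ?nnegrE ?mulr_ge0//; exact: h.
move=> /l2_cvg[s [_ sw]].
have -> : s = w by apply: coord_inj.
by rewrite ler_pXn2r ?nnegrE ?mulr_ge0.
Qed.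

Lemma bounded_multiplier_dom f C v : (forall b, BB b -> `|f b| <= C) ->
  multiplier_dom ip BB f v.
Proof.
move=> fC; apply/multiplier_domP; exists (C ^+ 2 * `|v| ^+ 2) => A.
apply: le_trans (ler_wpM2l _ (bessel v A)); last exact: sqr_ge0.
rewrite /sqr_sum mulr_sumr; apply: ler_sum => b _.
case: ifPn => [/set_mem Bb|_]; last by rewrite mulr0.
rewrite exprMn ler_wpM2r ?sqr_ge0//.
rewrite -[X in X <= _]real_normK ?num_real// ler_pXn2r ?nnegrE ?fC//.
exact: le_trans (fC _ Bb).
Qed.

End coordinates.

(** * Exponentials of bounded operators *)

Section operator_exponential.
Context {R : realType} {V : completeNormedModType R}.
Implicit Types (S T : V -> V) (a b : R) (v : V).

(** A predicate on plain functions, since [multiplier], [exponent] and [exp_op] return functions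
    without bundled structure. *)
Definition bounded_by S a := linear S /\ forall v, `|S v| <= a * `|v|.

Lemma lin0 (W W' : lmodType R) (f : W -> W') : linear f -> f 0 = 0.
Proof. by move=> h; have := h (-1) 0 0; rewrite scaler0 addr0 scaleN1r addNr. Qed.

Lemma linZ (W W' : lmodType R) (f : W -> W') a (v : W) : linear f -> f (a *: v) = a *: f v.
Proof. by move=> h; have := h a v 0; rewrite !addr0 (lin0 h) addr0. Qed.

Lemma linD (W W' : lmodType R) (f : W -> W') (u v : W) : linear f -> f (u + v) = f u + f v.
Proof. by move=> h; have := h 1 u v; rewrite !scale1r. Qed.

Lemma linB (W W' : lmodType R) (f : W -> W') (u v : W) : linear f -> f (u - v) = f u - f v.
Proof. by move=> h; rewrite linD// -scaleN1r linZ// scaleN1r. Qed.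

Lemma lin_sum (W W' : lmodType R) (f : W -> W') (I : Type) (s : seq I) (P : pred I)
    (F : I -> W) : linear f ->
  f (\sum_(i <- s | P i) F i) = \sum_(i <- s | P i) f (F i).
Proof.
move=> h; elim: s => [|i s IH]; first by rewrite !big_nil lin0.
by rewrite !big_cons; case: ifP => // _; rewrite linD// IH.
Qed.

Lemma lin_iter (W : lmodType R) (f : W -> W) n : linear f -> linear (iter n f).
Proof. by move=> h; elim: n => [//|n IH] a u v /=; rewrite IH h. Qed.

Lemma lipschitz_continuous (E E' : normedModType R) (f : E -> E') a :
  linear f -> (forall v : E, `|f v| <= a * `|v|) -> continuous f.
Proof.
move=> lf fa v; apply/cvgrPdist_lt => e e0.
have a1 : 0 < `|a| + 1 by rewrite ltr_wpDl.
near=> w.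
rewrite -linB// (le_lt_trans (fa _))// (@le_lt_trans _ _ ((`|a| + 1) * `|v - w|))//.
  by rewrite ler_wpM2r// (le_trans (ler_norm _))// lerDl.
rewrite mulrC -ltr_pdivlMr//.
by near: w; apply: cvgr_dist_lt; [exact: cvg_id|exact: divr_gt0].
Unshelve. all: by end_near.
Qed.

Lemma bounded_by_continuous S a : bounded_by S a -> continuous S.
Proof. by move=> [lS Sa]; exact: lipschitz_continuous Sa. Qed.

Lemma bounded_by_iter S a n : 0 <= a -> bounded_by S a ->
  bounded_by (iter n S) (a ^+ n).
Proof.
move=> a0 [lS Sa]; split; first exact: lin_iter.
elim: n => [v|n IH v]; first by rewrite mul1r.
by rewrite /= exprS -mulrA (le_trans (Sa _))// ler_wpM2l.
Qed.

Lemma bounded_byD S T a b : bounded_by S a -> bounded_by T b ->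
  bounded_by (fun v => S v + T v) (a + b).
Proof.
move=> [lS Sa] [lT Tb]; split.
  by move=> c u v; rewrite lS lT scalerDr addrACA.
by move=> v; rewrite mulrDl (le_trans (ler_normD _ _))// lerD.
Qed.

Lemma cvg0_le (u : nat -> V) (g : nat -> R) :
  (forall n, `|u n| <= g n) -> g @ \oo --> (0 : R) -> u @ \oo --> (0 : V).
Proof.
move=> ug g0; apply/cvgr0Pnorm_lt => e e0.
near=> n; apply: le_lt_trans (ug n) _; apply: le_lt_trans (ler_norm _) _.
by near: n; exact: cvgr0_norm_lt.
Unshelve. all: by end_near.
Qed.

Lemma cvg_dist0 (u : nat -> V) l : u @ \oo --> l -> (fun n => `|l - u n|) @ \oo --> (0 : R).
Proof.
move=> ul; rewrite -[0 in X in _ --> X](@normr0 _ V); apply: cvg_norm.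
by rewrite -[0 in X in _ --> X](subrr l); apply: cvgB ul; exact: cvg_cst.
Qed.

Definition exp_terms S v n : V := (n`!%:R)^-1 *: iter n S v.

Lemma norm_exp_terms S a v n : 0 <= a -> bounded_by S a ->
  `|exp_terms S v n| <= exp_coeff a n * `|v|.
Proof.
move=> a0 Sa; rewrite /exp_terms normrZ ger0_norm ?invr_ge0// /exp_coeff /=.
rewrite [leRHS]mulrAC [leRHS]mulrC ler_wpM2l ?invr_ge0//.
exact: (bounded_by_iter n a0 Sa).2.
Qed.

Lemma exp_coeff_sum_le a n : 0 <= a -> series (exp_coeff a) n <= expR a.
Proof.
move=> a0; apply: nondecreasing_cvgn_le; last exact: is_cvg_series_exp_coeff.
apply/nondecreasing_seqP => m.
by rewrite !seriesEnat/= big_nat_recr//= lerDl divr_ge0// exprn_ge0.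
Qed.

Lemma exp_terms_cvg S a v : 0 <= a -> bounded_by S a ->
  cvgn (series (exp_terms S v)).
Proof.
move=> a0 Sa; apply: normed_cvg; apply: nondecreasing_is_cvgn.
  apply/nondecreasing_seqP => m.
  by rewrite /normed_series_of /= /series /= big_nat_recr//= lerDl.
exists (expR a * `|v|) => _ [n _ <-].
apply: (@le_trans _ _ (series (exp_coeff a) n * `|v|)).
  by rewrite /normed_series_of /series /= mulr_suml; apply: ler_sum => i _; exact: norm_exp_terms.
by rewrite ler_wpM2r// exp_coeff_sum_le.
Qed.

Lemma exp_op_cvg S a v : 0 <= a -> bounded_by S a ->
  series (exp_terms S v) @ \oo --> exp_op S v.
Proof. by move=> a0 Sa; have := @exp_terms_cvg S a v a0 Sa. Qed.

Lemma exp_opE S a v w : 0 <= a -> bounded_by S a ->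
  series (exp_terms S v) @ \oo --> w -> exp_op S v = w.
Proof. by move=> a0 Sa h; exact: norm_cvg_lim h. Qed.

Lemma norm_lim_le (u : V ^nat) w M : u @ \oo --> w ->
  (forall n, `|u n| <= M) -> `|w| <= M.
Proof.
move=> uw uM; have h : (fun n => `|u n|) @ \oo --> `|w| by exact: cvg_norm.
rewrite -(norm_cvg_lim h); apply: limr_le; first exact: cvgP h.
by near=> n; exact: uM.
Unshelve. all: by end_near.
Qed.

Lemma exp_coeff_shift a m n : 0 <= a ->
  exp_coeff a (n + m)%N <= a ^+ m * exp_coeff a n.
Proof.
move=> a0; rewrite /exp_coeff /= exprD [a ^+ n * _]mulrC -mulrA.
rewrite ler_wpM2l ?exprn_ge0// ler_wpM2l ?exprn_ge0//.
rewrite lef_pV2 ?posrE ?ltr0n ?fact_gt0// ler_nat.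
elim: m => [|m IH]; first by rewrite addn0.
by rewrite addnS factS (leq_trans IH)// leq_pmull.
Qed.

(** The remainder a^m e^a rests on n! <= (n + m)!. The case m = 0 is the norm bound, m = 1 gives
    continuity in the exponent, m = 3 the expansion over a grid step. *)
Lemma exp_op_taylor S a v m : 0 <= a -> bounded_by S a ->
  `|exp_op S v - \sum_(0 <= i < m) exp_terms S v i| <= a ^+ m * expR a * `|v|.
Proof.
move=> a0 Sa.
have h := @exp_op_cvg S a v a0 Sa.
have {}h : (fun n => series (exp_terms S v) (n + m)%N) @ \oo --> exp_op S v.
  by apply: cvg_comp h; exact: cvg_addnr.
have {}h : (fun n => series (exp_terms S v) (n + m)%N -
    \sum_(0 <= i < m) exp_terms S v i) @ \oo -->
    exp_op S v - \sum_(0 <= i < m) exp_terms S v i.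
  by apply: cvgB h _; exact: cvg_cst.
apply: norm_lim_le h _ => n.
rewrite seriesEnat/= addnC (big_cat_nat (n := m)) ?leq_addr//= addrAC subrr add0r.
rewrite -{1}[m]add0n big_addn addKn.
apply: (@le_trans _ _ (\sum_(0 <= i < n) (a ^+ m * exp_coeff a i) * `|v|)).
  rewrite (le_trans (ler_norm_sum _ _ _))//; apply: ler_sum => i _.
  rewrite (le_trans (norm_exp_terms v _ a0 Sa))// ler_wpM2r//.
  exact: exp_coeff_shift.
rewrite -mulr_suml -mulr_sumr ler_wpM2r// ler_wpM2l ?exprn_ge0//.
by have := exp_coeff_sum_le n a0; rewrite seriesEnat.
Qed.

Lemma exp_op_norm S a v : 0 <= a -> bounded_by S a -> `|exp_op S v| <= expR a * `|v|.
Proof.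
by move=> a0 Sa; have := exp_op_taylor v 0 a0 Sa; rewrite big_geq// subr0 expr0 mul1r.
Qed.

Lemma exp_op_linear S a : 0 <= a -> bounded_by S a -> linear (exp_op S).
Proof.
move=> a0 Sa c u v; apply: (exp_opE a0 Sa).
have -> : series (exp_terms S (c *: u + v)) =
    (fun n => c *: series (exp_terms S u) n + series (exp_terms S v) n).
  apply/funext => n; rewrite !seriesEnat/= scaler_sumr -big_split; apply: eq_bigr => i _.
  by rewrite /exp_terms (lin_iter i Sa.1) scalerDr !scalerA mulrC.
apply: cvgD; last exact: exp_op_cvg Sa.
by apply: cvgZr; exact: exp_op_cvg Sa.
Qed.

Lemma iter_comm S T n v : (forall v, T (S v) = S (T v)) -> T (iter n S v) = iter n S (T v).
Proof. by move=> TS; elim: n => //= n <-. Qed.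

Lemma exp_op0 v : exp_op (fun _ => 0) v = v.
Proof.
have z : bounded_by (fun _ : V => 0 : V) 0.
  by split=> [c u w|w]; rewrite ?scaler0 ?addr0// normr0 mul0r.
apply/eqP; rewrite -subr_eq0 -normr_le0.
have := exp_op_taylor v 1 (lexx _) z.
by rewrite big_nat1 /exp_terms /= fact0 invr1 scale1r expr1 !mul0r.
Qed.

Let w S T v (i j : nat) : V := (i`!%:R)^-1 *: iter i S ((j`!%:R)^-1 *: iter j T v).

(** The binomial formula without binomial coefficients: n + 1 times the term of order n + 1 is S + T
    applied to the term of order n, and the weight n + 1 = i + (n + 1 - i) splits into the
    contributions of S and of T. *)
Lemma exp_termsD S T v n : linear S -> linear T ->
  (forall v, T (S v) = S (T v)) ->
  exp_terms (fun v => S v + T v) v n = \sum_(0 <= i < n.+1) w S T v i (n - i).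
Proof.
move=> lS lT TS.
have factV (m : nat) : (m.+1)%:R * ((m.+1)`!%:R)^-1 = (m`!%:R)^-1 :> R.
  by rewrite factS natrM invfM mulrA mulfV ?mul1r// pnatr_eq0.
have wS i j : S (w S T v i j) = (i.+1)%:R *: w S T v i.+1 j.
  by rewrite /w (linZ _ _ lS) scalerA factV.
have wT i j : T (w S T v i j) = (j.+1)%:R *: w S T v i j.+1.
  rewrite /w (linZ _ _ lT) (@iter_comm S T) // (linZ _ _ lT) -[T (iter j T v)]/(iter j.+1 T v).
  rewrite !(linZ _ _ (lin_iter _ lS)) !scalerA; congr (_ *: _).
  by rewrite -[in LHS](factV j); ring.
elim: n => [|n IH].
  by rewrite big_nat1 /w /exp_terms /= fact0 invr1 !scale1r.
have n1 : (n.+1)%:R != 0 :> R by rewrite pnatr_eq0.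
apply: (scalerI n1); transitivity (S (exp_terms (fun v => S v + T v) v n) +
    T (exp_terms (fun v => S v + T v) v n)).
  by rewrite /exp_terms /= scalerA factV (linZ _ _ lS) (linZ _ _ lT) scalerDr.
rewrite IH (lin_sum _ _ _ lS) (lin_sum _ _ _ lT) scaler_sumr.
have -> : \sum_(0 <= i < n.+2) (n.+1)%:R *: w S T v i (n.+1 - i) =
    \sum_(0 <= i < n.+2) i%:R *: w S T v i (n.+1 - i) +
    \sum_(0 <= i < n.+2) (n.+1 - i)%:R *: w S T v i (n.+1 - i).
  rewrite -big_split/= big_nat_cond [RHS]big_nat_cond; apply: eq_bigr => i.
  by move=> /andP[/andP[_ iN] _]; rewrite -scalerDl -natrD subnKC.
congr (_ + _).
  rewrite [RHS]big_nat_recl// scale0r add0r; apply: eq_bigr => i _.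
  by rewrite wS subSS.
rewrite [RHS]big_nat_recr//= subnn scale0r addr0 big_nat_cond [RHS]big_nat_cond.
apply: eq_bigr => i /andP[/andP[_ iN] _].
by rewrite wT subSn.
Qed.

End operator_exponential.

Lemma antidiagonal_sum (W : zmodType) (f : nat -> nat -> W) N :
  \sum_(0 <= n < N) \sum_(0 <= i < n.+1) f i (n - i)%N =
  \sum_(0 <= i < N) \sum_(0 <= j < N - i) f i j.
Proof.
elim: N => [|N IH]; first by rewrite !big_geq.
rewrite big_nat_recr//= IH [in RHS]big_nat_recr//= subSnn big_nat1.
rewrite [X in _ + X]big_nat_recr//= subnn addrA -big_split/=; congr (_ + _).
rewrite big_nat_cond [RHS]big_nat_cond; apply: eq_bigr => i /andP[/andP[_ iN] _].
by rewrite subSn ?(ltnW iN)// big_nat_recr.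
Qed.

Lemma square_minus_triangle (W : zmodType) (f : nat -> nat -> W) N :
  \sum_(0 <= i < N) \sum_(0 <= j < N) f i j -
  \sum_(0 <= i < N) \sum_(0 <= j < N - i) f i j =
  \sum_(0 <= i < N) \sum_(N - i <= j < N) f i j.
Proof.
rewrite -sumrB; apply: eq_bigr => i _.
by rewrite (big_cat_nat (n := (N - i)%N)) ?leq_subr//= addrAC subrr add0r.
Qed.

(** * The exponential law for commuting operators *)

Section exponential_addition.
Context {R : realType} {V : completeNormedModType R}.
Implicit Types (S T : V -> V) (a b : R) (v : V).

(** The product of the partial sums runs over the square i, j < N, the partial sum for S + T over
    the triangle i + j < N. The terms in between are dominated by those of the scalar series, whose
    own gap tends to 0 because e^a e^b = e^(a + b). *)
Lemma exp_op_partial_sum S T a b v N : 0 <= a -> 0 <= b ->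
  bounded_by S a -> bounded_by T b -> (forall v, T (S v) = S (T v)) ->
  `|series (exp_terms S (series (exp_terms T v) N)) N -
    series (exp_terms (fun v => S v + T v) v) N| <=
  (series (exp_coeff a) N * series (exp_coeff b) N - series (exp_coeff (a + b)) N) * `|v|.
Proof.
move=> a0 b0 Sa Tb TS.
pose w i j : V := (i`!%:R)^-1 *: iter i S ((j`!%:R)^-1 *: iter j T v).
pose r i j : R := exp_coeff a i * exp_coeff b j.
have wr i j : `|w i j| <= r i j * `|v|.
  rewrite /r -mulrA; apply: (le_trans (norm_exp_terms _ i a0 Sa)).
  by rewrite ler_wpM2l ?divr_ge0 ?exprn_ge0//; exact: norm_exp_terms.
have -> : series (exp_terms S (series (exp_terms T v) N)) N =
    \sum_(0 <= i < N) \sum_(0 <= j < N) w i j.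
  rewrite !seriesEnat /=; apply: eq_bigr => i _.
  by rewrite /exp_terms (lin_sum _ _ _ (lin_iter i Sa.1)) scaler_sumr.
have -> : series (exp_terms (fun v => S v + T v) v) N =
    \sum_(0 <= i < N) \sum_(0 <= j < N - i) w i j.
  rewrite seriesEnat/= -antidiagonal_sum; apply: eq_bigr => n _.
  by rewrite exp_termsD//; [case: Sa|case: Tb].
have -> : series (exp_coeff a) N * series (exp_coeff b) N =
    \sum_(0 <= i < N) \sum_(0 <= j < N) r i j.
  rewrite !seriesEnat /= mulr_suml; apply: eq_bigr => i _.
  by rewrite mulr_sumr.
have -> : series (exp_coeff (a + b)) N =
    \sum_(0 <= i < N) \sum_(0 <= j < N - i) r i j.
  rewrite seriesEnat/= -antidiagonal_sum; apply: eq_bigr => n _.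
  rewrite /exp_coeff/= addrC exprDn mulr_suml big_mkord; apply: eq_bigr => i _.
  have iN : (i <= n)%N by rewrite -ltnS.
  rewrite /r /exp_coeff/= -mulr_natr -(bin_fact iN) !natrM.
  rewrite mulrC [b ^+ _ * _]mulrC !invfM -!mulrA.
  have h m : (m`!)%:R != 0 :> R by rewrite pnatr_eq0 -lt0n fact_gt0.
  have hb : 'C(n, i)%:R != 0 :> R by rewrite pnatr_eq0 -lt0n bin_gt0.
  by field; rewrite !h hb.
rewrite !square_minus_triangle mulr_suml.
rewrite (le_trans (ler_norm_sum _ _ _))//; apply: ler_sum => i _.
rewrite mulr_suml (le_trans (ler_norm_sum _ _ _))//; apply: ler_sum => j _.
exact: wr.
Qed.

Lemma exp_opD S T a b v : 0 <= a -> 0 <= b ->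
  bounded_by S a -> bounded_by T b -> (forall v, T (S v) = S (T v)) ->
  exp_op (fun v => S v + T v) v = exp_op S (exp_op T v).
Proof.
move=> a0 b0 Sa Tb TS.
have ab0 : 0 <= a + b by rewrite addr_ge0.
apply: (exp_opE ab0 (bounded_byD Sa Tb)).
pose p N := series (exp_terms S (series (exp_terms T v) N)) N.
(* This error consists of the tail of the S series at [exp_op T v] and of N terms of the S series
   acting on the tail of the T series, the latter at most e^a times that tail. *)
have h1 : (fun N => exp_op S (exp_op T v) - p N) @ \oo --> (0 : V).
  apply: (@cvg0_le _ _ _
    (fun N => `|exp_op S (exp_op T v) - series (exp_terms S (exp_op T v)) N| +
     expR a * `|exp_op T v - series (exp_terms T v) N|)) => [N|].
    rewrite -[X in `|X|](subrKA (series (exp_terms S (exp_op T v)) N)).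
    rewrite (le_trans (ler_normD _ _))// lerD2l /p !seriesEnat/= -sumrB.
    set x := exp_op T v; set y := \sum_(0 <= k < N) exp_terms T v k.
    apply: (@le_trans _ _ (\sum_(0 <= i < N) exp_coeff a i * `|x - y|)).
      rewrite (le_trans (ler_norm_sum _ _ _))//; apply: ler_sum => i _.
      rewrite /exp_terms -scalerBr -(linB _ _ (lin_iter i Sa.1)).
      exact: (@norm_exp_terms _ _ S a (x - y) i).
    rewrite -mulr_suml ler_wpM2r//.
    by have := exp_coeff_sum_le N a0; rewrite seriesEnat.
  rewrite -[0 in X in _ --> X]addr0; apply: cvgD.
    by apply: cvg_dist0; exact: exp_op_cvg Sa.
  rewrite -[0 in X in _ --> X](mulr0 (expR a)); apply: cvgM; first exact: cvg_cst.
  by apply: cvg_dist0; exact: exp_op_cvg Tb.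
have h2 : (fun N => p N - series (exp_terms (fun v => S v + T v) v) N) @ \oo --> (0 : V).
  apply: (@cvg0_le _ _ _
    (fun N => (series (exp_coeff a) N * series (exp_coeff b) N -
       series (exp_coeff (a + b)) N) * `|v|)) => [N|].
    exact: exp_op_partial_sum.
  rewrite -[0 in X in _ --> X](mul0r `|v|); apply: cvgM; last exact: cvg_cst.
  rewrite -[0 in X in _ --> X](subrr (expR (a + b))) {1}expRD.
  apply: cvgB; last exact: is_cvg_series_exp_coeff.
  by apply: cvgM; exact: is_cvg_series_exp_coeff.
have h3 : (fun N => exp_op S (exp_op T v) - (exp_op S (exp_op T v) - p N) -
    (p N - series (exp_terms (fun v => S v + T v) v) N)) @ \oo -->
    exp_op S (exp_op T v) - 0 - 0.
  by apply: cvgB h2; apply: cvgB h1; exact: cvg_cst.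
rewrite !subr0 in h3.
apply: cvg_trans h3; apply: near_eq_cvg; near=> N.
by rewrite subKr subKr.
Unshelve. all: by end_near.
Qed.

End exponential_addition.

Section exponential_intertwining.
Context {R : realType} {V V' : completeNormedModType R}.

(** Two spaces, because J is either a multiplier on H commuting with the exponent or the isometry
    from H onto H_r. *)
Lemma exp_op_comm (S : V -> V) (S' : V' -> V') (J : V -> V') a a' v :
  0 <= a -> 0 <= a' ->
  bounded_by S a -> bounded_by S' a' -> linear J -> continuous J ->
  (forall v, J (S v) = S' (J v)) -> J (exp_op S v) = exp_op S' (J v).
Proof.
move=> a0 a'0 Sa Sa' lJ cJ JS; apply/esym/(exp_opE a'0 Sa').
have -> : series (exp_terms S' (J v)) = J \o series (exp_terms S v).
  apply/funext => n; rewrite /= !seriesEnat/= lin_sum//; apply: eq_bigr => i _.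
  rewrite /exp_terms linZ//; congr (_ *: _).
  by elim: i => //= i ->.
by apply: cvg_comp (@exp_op_cvg _ _ S a v a0 Sa) _; exact: cJ.
Qed.

End exponential_intertwining.

(** * Functional calculus of the diagonal operator *)

Lemma within_itv_continuousP {R : realType} (E : normedModType R) (f : R -> E) (T : R) :
  {within `[0, T], continuous f} <->
  forall s, 0 <= s <= T -> forall e : R, 0 < e -> exists2 d : R, 0 < d &
    forall t, 0 <= t <= T -> `|s - t| < d -> `|f s - f t| < e.
Proof.
split=> [/subspace_continuousP h s sT e e0|h].
  have /= := h s; rewrite in_itv/= => /(_ sT)/cvgrPdist_lt/(_ e e0).
  rewrite near_withinE => /nbhs_normP[d d0 hd]; exists d => // t tT st.
  by apply: hd => //=; rewrite in_itv.
apply/subspace_continuousP => s /=; rewrite in_itv/= => sT.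
apply/cvgrPdist_lt => e e0; rewrite near_withinE.
have [d d0 hd] := h s sT e e0.
apply/nbhs_normP; exists d => //= t st /=; rewrite in_itv/= => tT.
exact: hd.
Qed.

Section diagonal_calculus.
Context {R : realType} {H : completeNormedModType R} (ip : {dot H for @idfun R})
  (BB : set H) (lam : H -> R) (eta : R).
Hypothesis (hip : induces_norm ip) (hBB : orthonormal_basis ip BB).
Local Notation mult := (multiplier ip BB).
Local Notation mdom := (multiplier_dom ip BB).
Implicit Types (f g : H -> R) (u v w : H).

(** On the basis f is a function of the eigenvalue, so its multiplier is a function of A and acts as
    a scalar on each eigenspace. *)
Definition spectral f := forall b b', BB b -> BB b' -> lam b = lam b' -> f b = f b'.

Definition bounded_on_basis f := exists C, forall b, BB b -> `|f b| <= C.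

Lemma mult_coord f v : bounded_on_basis f ->
  forall b, BB b -> ip b (mult f v) = f b * ip b v.
Proof. by move=> [C fC]; apply: multiplierP => //; exact: (bounded_multiplier_dom hip hBB _ fC). Qed.

Lemma mult_comp f g v : mdom g v -> mdom (fun b => f b * g b) v ->
  mdom f (mult g v) /\ mult f (mult g v) = mult (fun b => f b * g b) v.
Proof.
move=> gv fgv.
have h b : BB b -> ip b (mult (fun b => f b * g b) v) = f b * ip b (mult g v).
  by move=> Bb; rewrite !multiplierP// mulrA.
by split; [exact: (multiplier_domE hip hBB h)|
  exact: (multiplier_eq hip hBB (multiplier_domE hip hBB h) h)].
Qed.

Lemma eq_mult f g v : (forall b, BB b -> f b = g b) -> mult f v = mult g v.
Proof.
move=> fg; rewrite /multiplier; congr (summability.sum _); apply/funext => b.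
by case: ifPn => // /set_mem Bb; rewrite fg.
Qed.

Lemma mult1 v : mult (fun=> 1) v = v.
Proof.
have h b : BB b -> ip b v = 1 * ip b v by rewrite mul1r.
by apply: (multiplier_eq hip hBB _ h);
  exact: (@multiplier_domE _ _ _ _ hip hBB (fun=> 1) v v h).
Qed.

Lemma mult_linear_dom f a u v : mdom f u -> mdom f v ->
  mdom f (a *: u + v) /\ mult f (a *: u + v) = a *: mult f u + mult f v.
Proof.
move=> fu fv.
have h b : BB b -> ip b (a *: mult f u + mult f v) = f b * ip b (a *: u + v).
  by move=> Bb; rewrite !ipDr !ipZr !multiplierP//; ring.
by split; [exact: (multiplier_domE hip hBB h)|
  exact: (multiplier_eq hip hBB (multiplier_domE hip hBB h) h)].
Qed.

Lemma mult_bounded f C : 0 <= C -> (forall b, BB b -> `|f b| <= C) ->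
  bounded_by (mult f) C.
Proof.
move=> C0 fC; have dom v := bounded_multiplier_dom hip hBB v fC.
split=> [a u v|v]; first by have [] := mult_linear_dom a (dom u) (dom v).
apply: (norm_le_coord hip hBB C0) => b Bb.
by rewrite multiplierP// normrM ler_wpM2r// fC.
Qed.

Lemma basis_norm b : BB b -> `|b| = 1.
Proof.
move=> Bb; apply/eqP; rewrite -(@eqrXn2 _ 2)// expr1n -hip.
by rewrite (hBB.1 _ _ Bb Bb) eqxx.
Qed.

Lemma mult_basis f b : BB b -> mdom f b /\ mult f b = f b *: b.
Proof.
move=> Bb.
have h b' : BB b' -> ip b' (f b *: b) = f b' * ip b' b.
  move=> Bb'; rewrite ipZr (hBB.1 _ _ Bb' Bb); case: eqP => [->//|_].
  by rewrite !mulr0.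
by split; [exact: (multiplier_domE hip hBB h)|
  exact: (multiplier_eq hip hBB (multiplier_domE hip hBB h) h)].
Qed.

(** A continuous functional is the limit of its values on finite basis sums, so proportionality of
    the two expansions term by term passes to the limit. *)
Lemma functional_coord (phi : H -> R) u v a : linear (phi : H -> R^o) -> continuous phi ->
  (forall b, BB b -> ip b u * phi b = a * (ip b v * phi b)) -> phi u = a * phi v.
Proof.
move=> lphi cphi h; have FF := @summability.totally_filter H.
have cvgphi w : (fun A => phi (basis_sum BB (fun b => ip b w) A)) @
    summability.totally --> phi w.
  have := hBB.2 w; rewrite partial_sumE => hw.
  exact: (cvg_comp _ _ hw (cphi w)).
have phiE A w : phi (basis_sum BB (fun b => ip b w) A) =
    \sum_(b <- A) (if b \in BB then ip b w * phi b else 0).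
  rewrite /basis_sum (lin_sum _ _ _ lphi); apply: eq_bigr => b _.
  by case: ifP => _; [rewrite (linZ _ _ lphi)|rewrite (lin0 lphi)].
have cu := cvgphi u.
have cv : (fun A => phi (basis_sum BB (fun b => ip b u) A)) @
    summability.totally --> a * phi v.
  rewrite (_ : (fun A => _) = (fun A => a * phi (basis_sum BB (fun b => ip b v) A))).
    by apply: cvgM; [exact: cvg_cst|exact: cvgphi].
  apply/funext => A; rewrite !phiE mulr_sumr; apply: eq_bigr => b _.
  by case: ifPn => [/set_mem Bb|_]; rewrite ?mulr0// h.
exact: (cvg_unique (@norm_hausdorff _ R^o) cu cv).
Qed.

Section commuting_operator.
Variable (L : H -> H).
Hypotheses (lL : linear L) (cL : continuous L)
  (L_eig : forall b b', BB b -> BB b' -> ip b' (L b) != 0 -> lam b = lam b').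

(** In the basis, L connects only vectors with equal eigenvalues, on which f is constant. Unbounded
    f are included, in particular the positive powers of eta - A. *)
Lemma mult_comm f v : spectral f -> mdom f v ->
  mdom f (L v) /\ mult f (L v) = L (mult f v).
Proof.
move=> sf fv.
have h b' : BB b' -> ip b' (L (mult f v)) = f b' * ip b' (L v).
  move=> Bb'; apply: (@functional_coord (fun w => ip b' (L w))).
  - by move=> a u w; rewrite lL ipDr ipZr.
  - by move=> w; apply: (@continuous_comp _ _ _ L (ip b')); [exact: cL|exact: ip_continuous].
  - move=> b Bb; have [->|n0] := eqVneq (ip b' (L b)) 0; first by rewrite !mulr0.
    by rewrite multiplierP// (sf b b' Bb Bb' (L_eig Bb Bb' n0)) mulrA.
by split; [exact: (multiplier_domE hip hBB h)|
  exact: (multiplier_eq hip hBB (multiplier_domE hip hBB h) h)].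
Qed.

End commuting_operator.

(** * Commutation with A and the spectral gap *)

Section operator_A.
Variables (DA : set H) (A : H -> H).
Hypothesis (hA : diagonal_operator ip BB lam DA A).

Lemma A_basis b : BB b -> DA b /\ A b = - lam b *: b.
Proof.
move=> Bb; have [db mb] := mult_basis lam Bb.
have Db : DA b by rewrite hA.1.
by split=> //; rewrite hA.2// mb scaleNr.
Qed.

(** The coordinate along b' of L (A b) = A (L b) reads (lam b' - lam b) <b', L b> = 0. *)
Lemma comm_A_eig (L : {linear H -> H}) : L @` DA `<=` DA ->
  (forall u, DA u -> L (A u) - A (L u) = 0) ->
  forall b b', BB b -> BB b' -> ip b' (L b) != 0 -> lam b = lam b'.
Proof.
move=> LD LA b b' Bb Bb' n0.
have [Db Ab] := A_basis Bb.
have DLb : DA (L b) by apply: LD; exists b.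
have := LA b Db; rewrite Ab (hA.2 _ DLb) linearZ/= opprK => h.
have : ip b' (- lam b *: L b + mult lam (L b)) = 0 by rewrite h ip0r.
rewrite ipDr ipZr multiplierP//; last by rewrite -hA.1.
rewrite mulNr addrC -mulrBl => /eqP; rewrite mulf_eq0 (negPf n0) orbF subr_eq0.
by move=> /eqP.
Qed.

(** An eigenvalue - lam b is not in the resolvent set, hence lies below eta. The bound uniform in b
    is the continuity of the resolvent S at eta itself: S b = b / (eta + lam b) has norm at most C,
    whence the gap 1 / C. *)
Lemma spectral_gap : spectrum DA A `<=` [set x | x < eta] ->
  exists2 c, 0 < c & forall b, BB b -> c <= eta + lam b.
Proof.
move=> hspec.
have res mu : eta <= mu -> resolvent_set DA A mu.
  move=> emu; apply: contrapT => /hspec /=; by rewrite ltNge emu.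
have eigS mu (S : {linear H -> H}) b : (forall u, DA u -> S (mu *: u - A u) = u) ->
    BB b -> (mu + lam b) *: S b = b.
  move=> SA Bb; have [Db Ab] := A_basis Bb.
  by have := SA b Db; rewrite Ab scaleNr opprK -scalerDl linearZ.
have nz mu b : eta <= mu -> BB b -> mu + lam b != 0.
  move=> /res[S [_ _ SA]] Bb; apply/eqP => z.
  have := eigS mu S b SA Bb; rewrite z scale0r => b0.
  by have := basis_norm Bb; rewrite -b0 normr0 => /eqP; rewrite eq_sym oner_eq0.
have pos b : BB b -> 0 < eta + lam b.
  move=> Bb; rewrite ltNge; apply/negP => le0.
  have /(_ (- lam b)) := nz; move=> /(_ b _ Bb); rewrite addNr eqxx => h.
  by suff : false by []; apply: h; lra.
have [S [cS _ SA]] := res eta (lexx _).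
have /linear_boundedP/pinfty_ex_gt0[C C0 SC] : bounded_near S (nbhs 0).
  by apply: continuous_linear_bounded; exact: cS.
exists C^-1; first by rewrite invr_gt0.
move=> b Bb; have := eigS eta S b SA Bb.
move=> /(congr1 Num.norm); rewrite (basis_norm Bb) normrZ gtr0_norm ?pos// => E1.
have SbC : `|S b| <= C by have := SC b; rewrite (basis_norm Bb) mulr1.
rewrite -(@ler_pM2l _ C)// divff ?gt_eqF// -E1 mulrC.
by rewrite ler_wpM2r// ltW// pos.
Qed.

End operator_A.

(** * Fractional powers, smoothing and strong continuity *)

Section powers.
Variable c : R.
Hypotheses (c0 : 0 < c) (lamc : forall b, BB b -> c <= eta + lam b).

Let gpos b : BB b -> 0 < eta + lam b.
Proof. by move=> Bb; exact: lt_le_trans (lamc Bb). Qed.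

Lemma semigroup_bound t T b : 0 <= t -> t <= T -> BB b ->
  `|expR (- (t * lam b))| <= expR (T * `|eta|).
Proof.
move=> t0 tT Bb; rewrite ger0_norm ?expR_ge0// ler_expR.
have h : t * eta <= T * `|eta|.
  by rewrite (le_trans (ler_norm _))// normrM ger0_norm// ler_wpM2r.
have := mulr_ge0 t0 (ltW (gpos Bb)); lra.
Qed.

Lemma smoothing_bound s t : 0 < t ->
  bounded_on_basis (fun b => (eta + lam b) `^ s * expR (- (t * lam b))).
Proof.
move=> t0.
have [s0|s0] := leP s 0.
  exists (expR (s * ln c + t * eta)) => b Bb.
  rewrite ger0_norm ?mulr_ge0 ?powR_ge0 ?expR_ge0//.
  rewrite /powR gt_eqF ?gpos// -expRD ler_expR.
  have : ln c <= ln (eta + lam b) by rewrite ler_ln ?posrE ?gpos ?lamc.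
  have := mulr_ge0 (ltW t0) (ltW (gpos Bb)); nra.
(* The constant comes from ln y < y at y = (eta + lam b) / (s / t): the scale s / t turns s * y into
   t * (eta + lam b), which the decay of the exponential absorbs. *)
exists (expR (s * ln (s / t) + t * eta)) => b Bb.
rewrite ger0_norm ?mulr_ge0 ?powR_ge0 ?expR_ge0//.
rewrite /powR gt_eqF ?gpos// -expRD ler_expR.
have st : 0 < s / t by rewrite divr_gt0.
have := ln_sublinear (divr_gt0 (gpos Bb) st).
rewrite ln_div ?posrE ?gpos// -(ltr_pM2l s0) => h.
have : s * ((eta + lam b) / (s / t)) = t * (eta + lam b).
  by field; rewrite !gt_eqF.
nra.
Qed.

Lemma spectral_pow s : spectral (fun b => (eta + lam b) `^ s).
Proof. by move=> b b' _ _ ->. Qed.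

Lemma spectral_exp t : spectral (fun b => expR (- (t * lam b))).
Proof. by move=> b b' _ _ ->. Qed.

Lemma powD s r b : BB b -> (eta + lam b) `^ s * (eta + lam b) `^ r = (eta + lam b) `^ (s + r).
Proof. by move=> Bb; rewrite powRD//; apply/implyP => _; rewrite gt_eqF ?gpos. Qed.

Lemma neg_pow_bounded s : s <= 0 -> bounded_on_basis (fun b => (eta + lam b) `^ s).
Proof.
move=> s0; exists (expR (s * ln c)) => b Bb.
rewrite ger0_norm ?powR_ge0// /powR gt_eqF ?gpos// ler_expR.
have : ln c <= ln (eta + lam b) by rewrite ler_ln ?posrE ?gpos ?lamc.
nra.
Qed.

Lemma semigroup_bounded t : 0 <= t -> bounded_on_basis (fun b => expR (- (t * lam b))).
Proof. by move=> t0; exists (expR (t * `|eta|)) => b; exact: semigroup_bound. Qed.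

(** The semigroup is bounded uniformly on [0, T], so v may be replaced by a finite basis sum, on
    which it is a finite sum of scalar exponentials. *)
Lemma semigroup_continuous T v :
  {within `[0, T], continuous (fun t => semigroup ip BB lam t v)}.
Proof.
apply/within_itv_continuousP => s /andP[s0 sT] e e0.
have FF := @summability.totally_filter H.
pose M := expR (T * `|eta|).
have M0 : 0 < M by exact: expR_gt0.
have Mb t : 0 <= t <= T -> bounded_by (semigroup ip BB lam t) M.
  by case/andP => t0 tT; apply: mult_bounded => [|b Bb]; [exact: ltW|exact: semigroup_bound].
have [A hA] : exists A, `|v - basis_sum BB (fun b => ip b v) A| < e / (3 * M).
  have := hBB.2 v; rewrite partial_sumE => /cvgrPdist_lt/(_ (e / (3 * M))).
  rewrite divr_gt0// ?mulr_gt0// => /(_ isT)[A _ hA]; exists A; apply: hA => /=.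
  exact: fsubset_refl.
pose w := basis_sum BB (fun b => ip b v) A.
have Ew t : 0 <= t <= T -> semigroup ip BB lam t w =
    basis_sum BB (fun b => expR (- (t * lam b)) * ip b v) A.
  move=> /andP[t0 tT]; apply: (coord_inj hBB) => b Bb.
  rewrite mult_coord//; last exact: semigroup_bounded.
  by rewrite !(ip_basis_sum hBB)//; case: ifP; rewrite ?mulr0.
have : continuous (fun t : R => basis_sum BB (fun b => expR (- (t * lam b)) * ip b v) A).
  pose F b (t : R) : H := if b \in BB then (expR (- (t * lam b)) * ip b v) *: b else 0.
  have cF b : continuous (F b).
    move=> t; rewrite /F; case: (b \in BB); last exact: cvg_cst.
    apply: cvgZ; last exact: cvg_cst.
    apply: cvgM; last exact: cvg_cst.
    apply: (cvg_comp (fun t => - (t * lam b)) expR); last exact: continuous_expR.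
    by apply: cvgN; apply: cvgM; [exact: cvg_id|exact: cvg_cst].
  rewrite (_ : (fun t => _) = (fun t => \sum_(b <- A) F b t))//.
  elim: (enum_fset A) => [|b l IH].
    by under eq_fun do rewrite big_nil; move=> t; exact: cvg_cst.
  rewrite (_ : (fun t => _) = (fun t => F b t + \sum_(b <- l) F b t)).
    by move=> t; apply: cvgD; [exact: cF|exact: IH].
  by apply/funext => t; rewrite big_cons.
move=> /(_ s)/cvgrPdist_lt/(_ (e / 3)); rewrite divr_gt0// => /(_ isT).
move=> /nbhs_normP[d d0 hd]; exists d => // t tT st.
have sT' : 0 <= s <= T by rewrite s0.
have := hd t st; rewrite -!Ew// => hst.
have close r : 0 <= r <= T ->
    `|semigroup ip BB lam r v - semigroup ip BB lam r w| < e / 3.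
  move=> rT; rewrite -(linB _ _ (Mb r rT).1) (le_lt_trans ((Mb r rT).2 _))//.
  by rewrite mulrC -ltr_pdivlMr// -mulrA -invfM.
have := close s sT'; have := close t tT => ct cs.
set a := semigroup ip BB lam s v in cs *; set a' := semigroup ip BB lam s w in cs hst *.
set d' := semigroup ip BB lam t v in ct *; set c' := semigroup ip BB lam t w in ct hst *.
have -> : a - d' = (a - a') + (a' - c') - (d' - c') by rewrite opprB !addrA !subrK.
rewrite (le_lt_trans (ler_normB _ _))// (le_lt_trans (lerD (ler_normD _ _) (lexx _)))//.
lra.
Qed.

End powers.
End diagonal_calculus.

(** * The scale of interpolation spaces *)

Section extension.
Context {R : realType} {E E' : completeNormedModType R}.

Lemma dense_ballP (D : set E) : dense D <->
  forall x (e : R), 0 < e -> exists2 y, D y & `|x - y| < e.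
Proof.
split=> [dD x e e0|h O [x Ox] oO].
  have [y [/= xy Dy]] : ball x e `&` D !=set0.
    by apply: dD; [exists x; exact: ballxx|exact: ball_open].
  by exists y => //; rewrite -ball_normE in xy.
have /nbhs_normP[e e0 he] : nbhs x O by apply: open_nbhs_nbhs.
have [y Dy xy] := h x e e0.
by exists y; split => //; exact: he.
Qed.

Lemma dense_eq (D : set E) (f g : E -> E') : dense D -> continuous f -> continuous g ->
  (forall x, D x -> f x = g x) -> f = g.
Proof.
move=> dD cf cg fg; apply/funext => x; apply/eqP; rewrite -subr_eq0 -normr_le0.
rewrite leNgt; apply/negP => n0.
have n2 : 0 < `|f x - g x| / 2 by rewrite divr_gt0.
have /cvgrPdist_lt/(_ _ n2)/nbhs_normP[e e0 he] := cf x.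
have /cvgrPdist_lt/(_ _ n2)/nbhs_normP[e' e'0 he'] := cg x.
have m0 : 0 < Num.min e e' by rewrite lt_min e0.
have [y Dy] := (dense_ballP D).1 dD x _ m0.
rewrite lt_min => /andP[/he/= h1 /he'/= h2].
have : `|f x - g x| < `|f x - g x|.
  rewrite {1}(_ : f x - g x = (f x - f y) - (g x - g y)).
    by rewrite (le_lt_trans (ler_normB _ _))//; lra.
  by rewrite (fg y Dy) opprB addrA subrK.
by rewrite ltxx.
Qed.

(* The extension is the closure of the graph [G]. *)
Lemma extend_bounded_relation (G : E -> E' -> Prop) (C : R) : 0 <= C ->
  (forall a x y x' y', G x y -> G x' y' -> G (a *: x + x') (a *: y + y')) ->
  (forall x y, G x y -> `|y| <= C * `|x|) ->
  dense [set x | exists y, G x y] ->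
  exists S : E -> E', [/\ linear S, forall x, `|S x| <= C * `|x|
    & forall x y, G x y -> S x = y].
Proof.
move=> C0 linG bG /dense_ballP dG.
pose cl x y := forall e : R, 0 < e -> exists x' y', [/\ G x' y', `|x - x'| < e & `|y - y'| < e].
have cl_sub x y : G x y -> cl x y.
  by move=> Gxy e e0; exists x, y; rewrite !subrr !normr0.
have cl_bound x y : cl x y -> `|y| <= C * `|x|.
  move=> h; apply/ler_addgt0Pl => e e0.
  have D0 : 0 < e / (C + 1) by rewrite divr_gt0// ltr_wpDl.
  have [x' [y' [Gxy xx' yy']]] := h _ D0.
  have h1 : `|y| <= `|y - y'| + `|y'| by rewrite -{1}(subrK y' y) ler_normD.
  have h2 : `|x'| <= `|x - x'| + `|x| by have := ler_normB x (x - x'); rewrite subKr addrC.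
  have h3 := ler_wpM2l C0 h2; have h4 := ler_wpM2l C0 (ltW xx').
  have h5 : C * (e / (C + 1)) + e / (C + 1) = e by field; rewrite gt_eqF// ltr_wpDl.
  have := bG _ _ Gxy; lra.
have cl_lin a x y x' y' : cl x y -> cl x' y' -> cl (a *: x + x') (a *: y + y').
  move=> h h' e e0.
  have D0 : 0 < e / (`|a| + 1) by rewrite divr_gt0// ltr_wpDl.
  have [x1 [y1 [G1 xx1 yy1]]] := h _ D0; have [x2 [y2 [G2 xx2 yy2]]] := h' _ D0.
  exists (a *: x1 + x2), (a *: y1 + y2); split; first exact: linG.
    rewrite opprD addrACA -scalerBr (le_lt_trans (ler_normD _ _))// normrZ.
    have h4 := ler_wpM2l (normr_ge0 a) (ltW xx1).
    have h5 : `|a| * (e / (`|a| + 1)) + e / (`|a| + 1) = e by field; rewrite gt_eqF// ltr_wpDl.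
    lra.
  rewrite opprD addrACA -scalerBr (le_lt_trans (ler_normD _ _))// normrZ.
  have h4 := ler_wpM2l (normr_ge0 a) (ltW yy1).
  have h5 : `|a| * (e / (`|a| + 1)) + e / (`|a| + 1) = e by field; rewrite gt_eqF// ltr_wpDl.
  lra.
have cl_uniq x y y' : cl x y -> cl x y' -> y = y'.
  move=> h h'; have := cl_lin (-1) _ _ _ _ h h'; rewrite !scaleN1r addNr.
  by move=> /cl_bound; rewrite normr0 mulr0 normr_le0 addrC subr_eq0 => /eqP.
(* Take points of the domain within 1/(n + 1) of x: their images form a Cauchy sequence by the bound
   on [G], and E' is complete. *)
have cl_ex x : exists y, cl x y.
  have /choice[u hu] : forall n : nat, exists p, G p.1 p.2 /\ `|x - p.1| < n.+1%:R^-1.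
    move=> n; have [x' [y' Gxy] xx'] := dG x (n.+1%:R^-1) ltac:(by rewrite invr_gt0).
    by exists (x', y').
  have small e : 0 < e -> exists N, forall n, (N <= n)%N -> `|x - (u n).1| < e.
    move=> e0; have : e / 2 > 0 by rewrite divr_gt0.
    move=> e2; have := @cvg_harmonic R => /cvgr_dist_lt/(_ e e0)[N _ hN].
    exists N => n Nn; rewrite (lt_trans (hu n).2)//.
    have := hN n Nn; rewrite /= sub0r normrN ger0_norm ?invr_ge0//.
  have cu : cvgn (fun n => (u n).2).
    apply/cauchy_cvgP/cauchy_exP => e e0.
    have D0 : 0 < e / (2 * (C + 1)) by rewrite divr_gt0// mulr_gt0// ltr_wpDl.
    have [N hN] := small _ D0; exists (u N).2; exists N => //= n Nn.
    rewrite -ball_normE/=.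
    have := linG (-1) _ _ _ _ (hu n).1 (hu N).1.
    rewrite !scaleN1r [- _ + _]addrC [- _ + (u N).2]addrC => /bG h.
    rewrite (le_lt_trans h)//.
    have : `|(u N).1 - (u n).1| <= `|x - (u n).1| + `|x - (u N).1|.
      rewrite (_ : (u N).1 - (u n).1 = (x - (u n).1) - (x - (u N).1)) ?ler_normB//.
      by rewrite opprB [RHS]addrC subrKA.
    have h5 : C * (e / (2 * (C + 1))) * 2 + e / (2 * (C + 1)) * 2 = e.
      by field; rewrite gt_eqF// ltr_wpDl.
    have := hN n Nn; have := hN N (leqnn N) => a1 a2 a3.
    have a4 : `|(u N).1 - (u n).1| <= e / (2 * (C + 1)) * 2 by lra.
    have a5 := ler_wpM2l C0 a4; lra.
  have [y hy] := (cvg_ex _).1 cu; exists y => e e0.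
  have [N hN] := small e e0.
  have /cvgrPdist_lt/(_ e e0)[M _ hM] := hy.
  exists (u (maxn N M)).1, (u (maxn N M)).2; split; first exact: (hu _).1.
    by apply: hN; exact: leq_maxl.
  by apply: hM => /=; exact: leq_maxr.
have [S hS] := choice cl_ex.
exists S; split=> [a x x'|x|x y Gxy].
- by apply: cl_uniq (hS _) _; exact: cl_lin.
- exact: cl_bound.
- by apply: cl_uniq (hS x) _; exact: cl_sub.
Qed.

End extension.

Section scale.
Context {R : realType} {H : completeNormedModType R} (ip : {dot H for @idfun R})
  (BB : set H) (lam : H -> R) (eta : R).
Hypothesis (hip : induces_norm ip) (hBB : orthonormal_basis ip BB).
Variable c : R.
Hypotheses (c0 : 0 < c) (lamc : forall b, BB b -> c <= eta + lam b).
Variable Hs : interpolation_spaces ip BB lam eta.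
Local Notation mult := (multiplier ip BB).
Local Notation pw r := (fun b => (eta + lam b) `^ r).
Local Notation mdom := (multiplier_dom ip BB).

Lemma lt0_mdom_pow r v : r < 0 -> mdom (pw r) v.
Proof.
move=> r0; have [C hC] := neg_pow_bounded c0 lamc (ltW r0).
exact: (bounded_multiplier_dom hip hBB _ hC).
Qed.

Lemma space_inj_dom r (x : Hs r) v : space_inj Hs r x = base_inj Hs v -> mdom (pw r) v.
Proof.
move=> xv; have [r0|r0] := leP 0 r; last exact: lt0_mdom_pow.
have : range (space_inj Hs r) (base_inj Hs v) by exists x.
by rewrite space_ge0// => -[w dw /(@base_injP _ _ _ _ _ _ Hs) <-].
Qed.

Lemma dom_space_inj r v : mdom (pw r) v -> exists x, space_inj Hs r x = base_inj Hs v.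
Proof.
move=> dv; have [r0|r0] := leP 0 r.
  have : (base_inj Hs @` frac_power_dom ip BB eta lam r) (base_inj Hs v) by exists v.
  by rewrite -space_ge0// => -[x _ <-]; exists x.
have [h _] := space_lt0 Hs r0.
by have [x _ <-] : range (space_inj Hs r) (base_inj Hs v); [apply: h; exists v|exists x].
Qed.

Lemma dense_base r : dense [set x : Hs r | range (base_inj Hs) (space_inj Hs r x)].
Proof.
have [r0|r0] := leP 0 r; last exact: (space_lt0 Hs r0).2.
apply/dense_ballP => x e e0; exists x; last by rewrite subrr normr0.
have : range (space_inj Hs r) (space_inj Hs r x) by exists x.
by rewrite space_ge0//= => -[v _ <-]; exists v.
Qed.

Lemma mult_pow_inv r v : mdom (pw (- r)) v ->
  mdom (pw r) (mult (pw (- r)) v) /\ mult (pw r) (mult (pw (- r)) v) = v.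
Proof.
move=> dv; have E b : BB b -> 1 = pw r b * pw (- r) b.
  by move=> Bb; rewrite (powD c0 lamc)// subrr powRr0.
have d1 : mdom (fun b => pw r b * pw (- r) b) v.
  by apply: (@multiplier_domE _ _ _ _ hip hBB _ v v) => b Bb; rewrite -E// mul1r.
have [d ->] := mult_comp hip hBB dv d1; split=> //.
by rewrite -(@eq_mult _ _ _ _ (fun=> 1) _ v E) (mult1 hip hBB).
Qed.

(** [J] is (eta - A)^r, extended to a linear isometry from H_r onto H, and [K] is its inverse (eta -
    A)^(-r). *)
Definition scale_iso r (J : Hs r -> H) (K : H -> Hs r) := [/\
  linear J /\ linear K, (forall x, `|J x| = `|x|) /\ (forall y, `|K y| = `|y|),
  cancel J K, cancel K J
  & forall x v, space_inj Hs r x = base_inj Hs v -> J x = mult (pw r) v].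

(** The graph of (eta - A)^r is isometric with dense domain and dense range, so it can be extended
    in both directions; the two extensions are inverse to each other on dense sets, hence
    everywhere. This treats all signs of r alike. *)
Lemma scale_iso_exists r : exists J K, @scale_iso r J K.
Proof.
pose G (x : Hs r) (y : H) := exists v, space_inj Hs r x = base_inj Hs v /\ y = mult (pw r) v.
have linG a x y x' y' : G x y -> G x' y' -> G (a *: x + x') (a *: y + y').
  move=> [v [xv ->]] [v' [xv' ->]]; exists (a *: v + v'); split.
    by rewrite !linearP xv xv'.
  by have [_ ->] := mult_linear_dom hip hBB a (space_inj_dom xv) (space_inj_dom xv').
have normG x y : G x y -> `|y| = `|x|.
  by move=> [v [xv ->]]; rewrite (space_norm xv).
have domG : dense [set x | exists y, G x y].
  apply/dense_ballP => x e e0; have [y [v _ yv] xy] := (dense_ballP _).1 (@dense_base r) x e e0.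
  by exists y => //=; exists (mult (pw r) v); exists v; rewrite yv.
have rangeG : dense [set y | exists x, G x y].
  apply/dense_ballP => y e e0.
  have FF := @summability.totally_filter H.
  have := hBB.2 y; rewrite partial_sumE => /cvgrPdist_lt/(_ e e0)[A _ hA].
  exists (basis_sum BB (fun b => ip b y) A); last by apply: hA => /=; exact: fsubset_refl.
  (* Finite basis sums lie in the domain of every power, so the preimage under (eta - A)^r is
     explicit. *)
  pose v := basis_sum BB (fun b => pw (- r) b * ip b y) A.
  have h b : BB b -> ip b (basis_sum BB (fun b => ip b y) A) = pw r b * ip b v.
    move=> Bb; rewrite !(ip_basis_sum hBB)//; case: ifP => _; rewrite ?mulr0//.
    by rewrite mulrA (powD c0 lamc)// subrr powRr0 mul1r.
  have dv := multiplier_domE hip hBB h.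
  have [x xv] := dom_space_inj dv.
  by exists x; exists v; split=> //; rewrite (multiplier_eq hip hBB dv h).
have [J [lJ bJ GJ]] : exists S : Hs r -> H, [/\ linear S, forall x, `|S x| <= 1 * `|x|
    & forall x y, G x y -> S x = y].
  apply: extend_bounded_relation => // x y /normG ->; by rewrite mul1r.
have [K [lK bK GK]] : exists S : H -> Hs r, [/\ linear S, forall x, `|S x| <= 1 * `|x|
    & forall x y, G y x -> S x = y].
  apply: extend_bounded_relation => // [a x y x' y'|x y /normG ->]; first exact: linG.
  by rewrite mul1r.
have cJ := lipschitz_continuous lJ bJ; have cK := lipschitz_continuous lK bK.
have JK : K \o J = id.
  apply: (dense_eq domG) => [x|x|x [y Gxy]].
  - by apply: continuous_comp; [exact: cJ|exact: cK].
  - exact: cvg_id.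
  - by rewrite /= (GJ _ _ Gxy) (GK _ _ Gxy).
have KJ : J \o K = id.
  apply: (dense_eq rangeG) => [x|x|y [x Gxy]].
  - by apply: continuous_comp; [exact: cK|exact: cJ].
  - exact: cvg_id.
  - by rewrite /= (GK _ _ Gxy) (GJ _ _ Gxy).
have JK' : cancel J K by move=> x; have := congr1 (fun f => f x) JK.
have KJ' : cancel K J by move=> x; have := congr1 (fun f => f x) KJ.
exists J, K; split=> //.
- have bJ1 x : `|J x| <= `|x| by have := bJ x; rewrite mul1r.
  have bK1 y : `|K y| <= `|y| by have := bK y; rewrite mul1r.
  split=> x; apply/eqP; rewrite eq_le.
    by rewrite bJ1/= -{1}(JK' x) bK1.
  by rewrite bK1/= -{1}(KJ' x) bJ1.
- by move=> x v xv; apply: GJ; exists v.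
Qed.

Section scale_iso_theory.
Variables (r : R) (J : Hs r -> H) (K : H -> Hs r).
Hypothesis JK : scale_iso J K.

Lemma scale_iso_space v : mdom (pw (- r)) v ->
  space_inj Hs r (K v) = base_inj Hs (mult (pw (- r)) v).
Proof.
move=> dv; have [d1 E] := mult_pow_inv dv.
have [x xv] := dom_space_inj d1; rewrite -xv.
by have [_ _ JKx _ hJ] := JK; rewrite -[in RHS](JKx x) (hJ _ _ xv) E.
Qed.

Lemma scale_iso_continuous : continuous J /\ continuous K.
Proof.
have [[lJ lK] [nJ nK] _ _ _] := JK.
by split; [apply: (@lipschitz_continuous _ _ _ _ 1)|apply: (@lipschitz_continuous _ _ _ _ 1)]
  => // x; rewrite mul1r ?nJ ?nK.
Qed.

(** [induced_op] is a choice, which this pins down: S conjugated by the isometry satisfies the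
    specification, and two continuous solutions agree on the dense set of vectors coming from H. *)
Lemma induced_opE (S : H -> H) C : bounded_by S C ->
  (forall v, mdom (pw r) v -> mdom (pw r) (S v) /\ mult (pw r) (S v) = S (mult (pw r) v)) ->
  induced_op (Hs := Hs) (r := r) S = (fun x => K (S (J x))).
Proof.
move=> SC comm; have [[lJ lK] [nJ nK] JKx KJx hJ] := JK.
have [cJ cK] := scale_iso_continuous.
have cS := bounded_by_continuous SC.
have spec : induced_op_spec (Hs := Hs) S (fun x => K (S (J x))).
  split=> [a u v|x|x v xv].
  - by rewrite lJ SC.1 lK.
  - apply: (@continuous_comp _ _ _ (fun x => S (J x)) K); last exact: cK.
    by apply: (@continuous_comp _ _ _ J S); [exact: cJ|exact: cS].
  - have dv := space_inj_dom xv; have [dSv E] := comm v dv.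
    have [x' x'v] := dom_space_inj dSv.
    by rewrite (hJ _ _ xv) -E -(hJ _ _ x'v) JKx.
rewrite /induced_op; apply: xget_unique => // S' [lS' cS' hS'].
apply: (dense_eq (@dense_base r)) => //; first by case: spec.
move=> x [v _ vx]; apply: (@space_injP _ _ _ _ _ _ Hs r).
by have [_ _ h] := spec; rewrite (h x v)// (hS' x v).
Qed.

End scale_iso_theory.
End scale.

(** * Measurability of functions with values in a separable space *)

Section open_measurability.
Context {R : realType}.

Definition dense_seq (E : normedModType R) (q : nat -> E) :=
  forall x (e : R), 0 < e -> exists n, `|x - q n| < e.

Lemma separable_dense_seq (E : normedModType R) : separable_space E ->
  exists q : nat -> E, dense_seq q.
Proof.
move=> [S [cS dS]].
have [x0 [_ Sx0]] : [set: E] `&` S !=set0 by apply: dS; [exists 0|exact: openT].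
have /pcard_surjP[g gS] : (S #<= [set: nat])%card by [].
have : exists f : nat -> E, forall y, S y -> exists n, f n = y.
  by exists g => y /gS[n _ <-]; exists n.
move=> [f fS]; exists f => x e e0.
have [y [/= xy Sy]] : ball x e `&` S !=set0.
  by apply: dS; [exists x; exact: ballxx|exact: ball_open].
have [n fny] := fS y Sy; exists n; rewrite fny.
by rewrite -ball_normE in xy.
Qed.

Lemma real_dense_seq : exists q : nat -> R, dense_seq (E := R^o) q.
Proof.
apply: separable_dense_seq; exists (range (@ratr R)); split; last exact: dense_rat.
apply: (@card_le_trans _ _ _ [set: rat]); first exact: card_image_le.
exact: countableP.
Qed.

Section closure.
Context {d : measure_display} {S : measurableType d}.

(** H and the H_r carry only a topology, so measurability is tested on open sets; the Borel form
    follows by generation. *)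
Definition open_measurable_fun (E : topologicalType) (f : S -> E) :=
  forall U, open U -> measurable (f @^-1` U).

Lemma omf_comp (E E' : topologicalType) (f : S -> E) (g : E -> E') :
  open_measurable_fun f -> continuous g -> open_measurable_fun (g \o f).
Proof.
move=> mf cg U oU; apply: (mf (g @^-1` U)).
by apply: open_comp => // x _; exact: cg.
Qed.

Lemma omf_cst (E : topologicalType) (x : E) : open_measurable_fun (fun=> x).
Proof.
move=> U oU; have [Ux|nUx] := pselect (U x).
  by rewrite (_ : _ @^-1` _ = setT)//; apply/seteqP; split.
by rewrite (_ : _ @^-1` _ = set0)//; apply/seteqP; split.
Qed.

Lemma omf_real (f : S -> R) : open_measurable_fun (f : S -> R^o) <-> measurable_fun setT f.
Proof.
split=> [mf|mf U oU]; last first.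
  by have := mf measurableT U (open_measurable oU); rewrite setTI.
apply: (measurability (@RGenOpens.G R) (RGenOpens.measurableE R)) => _ [U [x [y ->]] <-].
by rewrite setTI; apply: mf; exact: interval_open.
Qed.

(** Separability enters here: an open set of the product is a countable union of products of balls
    centred at the dense sequences. Sums and scalar multiples of measurable functions depend on
    it. *)
Lemma omf_pair (E E' E'' : normedModType R) (q : nat -> E) (q' : nat -> E')
    (f : S -> E) (g : S -> E') (h : E * E' -> E'') :
  dense_seq q -> dense_seq q' -> continuous h ->
  open_measurable_fun f -> open_measurable_fun g ->
  open_measurable_fun (fun s => h (f s, g s)).
Proof.
move=> dq dq' ch mf mg U oU.
have oV : open (h @^-1` U) by apply: open_comp => // x _; exact: ch.
set V := h @^-1` U in oV.
pose Q n i j := ball (q i) (n.+1%:R^-1 : R) `*` ball (q' j) (n.+1%:R^-1 : R) `<=` V.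
rewrite (_ : _ @^-1` _ = \bigcup_n \bigcup_i \bigcup_j
    (if `[< Q n i j >] then (f @^-1` ball (q i) (n.+1%:R^-1 : R)) `&`
       (g @^-1` ball (q' j) (n.+1%:R^-1 : R)) else set0)).
  apply: bigcupT_measurable => n; apply: bigcupT_measurable => i.
  apply: bigcupT_measurable => j; case: ifPn => // _; apply: measurableI.
    by apply: mf; exact: ball_open.
  by apply: mg; exact: ball_open.
apply/seteqP; split=> [s Us|s [n _ [i _ [j _]]]]; last first.
  by case: ifPn => // /asboolP Qh [fs gs]; apply: (Qh (f s, g s)).
have /nbhs_ballP[e e0 he] : nbhs (f s, g s) V by apply: open_nbhs_nbhs.
have e2 : 0 < e / 2 by rewrite divr_gt0.
have [n ne] : exists n, (n.+1%:R^-1 : R) < e / 2.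
  have /cvgr_dist_lt/(_ _ e2)[n _ hn] := @cvg_harmonic R.
  exists n; have := hn n (leqnn n); rewrite /= sub0r normrN ger0_norm ?invr_ge0//.
have n0 : 0 < (n.+1%:R^-1 : R) by rewrite invr_gt0.
have [i fi] := dq (f s) _ n0; have [j gj] := dq' (g s) _ n0.
exists n => //; exists i => //; exists j => //.
rewrite ifT; last first.
  apply/asboolP => -[x y] [/= qx qy]; apply: he; split => /=.
    rewrite -ball_normE/= in qx *; rewrite -(subrKA (q i)) (le_lt_trans (ler_normD _ _))//.
    by rewrite (splitr e) ltrD// (lt_trans _ ne).
  rewrite -ball_normE/= in qy *; rewrite -(subrKA (q' j)) (le_lt_trans (ler_normD _ _))//.
  by rewrite (splitr e) ltrD// (lt_trans _ ne).
by split; rewrite /= -ball_normE/= distrC.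
Qed.

Lemma omf_bigcup (E : topologicalType) (A : nat -> set S) (g : nat -> S -> E) (f : S -> E) :
  (forall k, measurable (A k)) -> (forall k, open_measurable_fun (g k)) ->
  (forall s, exists k, A k s) -> (forall k s, A k s -> f s = g k s) ->
  open_measurable_fun f.
Proof.
move=> mA mg AT fg U oU.
rewrite (_ : f @^-1` U = \bigcup_k (A k `&` g k @^-1` U)).
  by apply: bigcupT_measurable => k; apply: measurableI => //; exact: mg.
apply/seteqP; split=> [s /= Us|s [k _ [As]]]; last by rewrite /= (fg k).
by have [k Ak] := AT s; exists k => //; split=> //=; rewrite -(fg k).
Qed.

Lemma omf_if (E : topologicalType) (b : S -> bool) (f g : S -> E) :
  measurable [set s | b s] -> open_measurable_fun f -> open_measurable_fun g ->
  open_measurable_fun (fun s => if b s then f s else g s).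
Proof.
move=> mb mf mg.
apply: (@omf_bigcup _ (fun k => if k == 0%N then [set s | b s] else ~` [set s | b s])
  (fun k => if k == 0%N then f else g)).
- by move=> [|k]//=; exact: measurableC.
- by move=> [|k].
- move=> s; case bs : (b s); first by exists 0%N.
  by exists 1%N => /=; rewrite bs.
- by move=> [|k] s /= => [->//|/negP/negPf ->].
Qed.

(** The limit lies in U exactly when, for some m, the u n s eventually stay out of the 1/(m +
    1)-neighbourhood of the complement of U. *)
Lemma omf_lim (E : normedModType R) (u : nat -> S -> E) (f : S -> E) :
  (forall n, open_measurable_fun (u n)) -> (forall s, u ^~ s @ \oo --> f s) ->
  open_measurable_fun f.
Proof.
move=> mu uf U oU.
pose D (m : nat) := \bigcup_(z in ~` U) ball z (m.+1%:R^-1 : R).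
have oD m : open (D m) by apply: bigcup_open => z _; exact: ball_open.
rewrite (_ : f @^-1` U = \bigcup_m \bigcup_N \bigcap_(n in [set n | (N <= n)%N]) ~` (u n @^-1` D m)).
  apply: bigcupT_measurable => m; apply: bigcupT_measurable => N.
  by apply: bigcap_measurableType => n _; apply: measurableC; exact: mu.
apply/seteqP; split=> [s /= Us|s [m _ [N _ h]]].
  have /nbhs_normP[e e0 he] : nbhs (f s) U by apply: open_nbhs_nbhs.
  have e2 : 0 < e / 2 by rewrite divr_gt0.
  have /cvgr_dist_lt/(_ _ e2)[m _ hm] := @cvg_harmonic R.
  have {}hm : (m.+1%:R^-1 : R) < e / 2.
    by have := hm m (leqnn m); rewrite /= sub0r normrN ger0_norm ?invr_ge0.
  have /cvgrPdist_lt/(_ _ e2)[N _ hN] := uf s.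
  exists m => //; exists N => // n Nn [z nUz]; rewrite -ball_normE/= => zu.
  apply: nUz; apply: he => /=.
  rewrite -(subrKA (u n s)) (le_lt_trans (ler_normD _ _))// (splitr e).
  apply: ltrD; first exact: hN.
  by rewrite distrC (lt_trans zu).
apply: contrapT => nU; have m0 : 0 < (m.+1%:R^-1 : R) by rewrite invr_gt0.
have /cvgrPdist_lt/(_ _ m0)[M _ hM] := uf s.
have /= := h (maxn N M) (leq_maxl N M); apply.
by exists (f s) => //; rewrite -ball_normE/=; apply: hM => /=; exact: leq_maxr.
Qed.

Section with_dense_seq.
Variables (E : normedModType R) (q : nat -> E).
Hypothesis dq : dense_seq q.

Lemma omfD (f g : S -> E) : open_measurable_fun f -> open_measurable_fun g ->
  open_measurable_fun (fun s => f s + g s).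
Proof.
apply: (omf_pair (h := fun p => p.1 + p.2) dq dq) => x.
by apply: cvgD; [exact: cvg_fst|exact: cvg_snd].
Qed.

Lemma omfZ (a : S -> R) (f : S -> E) : measurable_fun setT a -> open_measurable_fun f ->
  open_measurable_fun (fun s => a s *: f s).
Proof.
have [p dp] := real_dense_seq => /omf_real.
apply: (@omf_pair R^o _ _ _ _ _ _ (fun p : R^o * E => (p.1 : R) *: p.2) dp dq) => x.
by apply: cvgZ; [exact: cvg_fst|exact: cvg_snd].
Qed.

Lemma omf_sum (I : Type) (s : seq I) (f : I -> S -> E) :
  (forall i, open_measurable_fun (f i)) ->
  open_measurable_fun (fun x => \sum_(i <- s) f i x).
Proof.
move=> mf; elim: s => [|i s IH].
  by rewrite (_ : (fun _ => _) = cst 0)//; [exact: omf_cst|apply/funext => x; rewrite big_nil].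
rewrite (_ : (fun _ => _) = (fun x => f i x + \sum_(i <- s) f i x)); first exact: omfD.
by apply/funext => x; rewrite big_cons.
Qed.

Lemma omf_norm (f : S -> E) : open_measurable_fun f -> measurable_fun setT (fun s => `|f s|).
Proof.
move=> mf; apply/omf_real; apply: (@omf_comp E R^o f Num.norm) => //.
exact: norm_continuous.
Qed.

(** Taking the least admissible index makes the choice measurable; f is thereby rounded to countably
    many values. *)
Lemma dense_index (f : S -> E) (e : R) : 0 < e -> open_measurable_fun f ->
  exists kappa : S -> nat, (forall Q : set nat, measurable (kappa @^-1` Q)) /\
    forall s, `|f s - q (kappa s)| < e.
Proof.
move=> e0 mf; pose a s j := `|f s - q j| < e.
have ex s : exists j, a s j by exact: dq.
exists (fun s => ex_minn (ex s)); split; last by move=> s; case: ex_minnP.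
move=> Q; pose A j := f @^-1` ball (q j) e.
have mA j : measurable (A j) by apply: mf; exact: ball_open.
have AE s j : A j s <-> a s j by rewrite /A /= -ball_normE/= distrC.
rewrite (_ : _ @^-1` Q = \bigcup_(j in Q) (A j `&` \bigcap_(i in [set i | (i < j)%N]) ~` A i)).
  apply: bigcup_measurable => j _; apply: measurableI => //.
  by apply: bigcap_measurableType => i _; exact: measurableC.
apply/seteqP; split=> [s /= Qs|s [j Qj [/AE asj h]]] /=.
  exists (ex_minn (ex s)) => //; case: ex_minnP => j aj jmin; split; first exact/AE.
  by move=> i /= ij /AE ai; have := jmin _ ai; rewrite leqNgt ij.
suff -> : ex_minn (ex s) = j by [].
case: ex_minnP => i ai imin; apply/eqP; rewrite eqn_leq imin//= leqNgt.
by apply/negP => ij; apply: (h i ij); exact/AE.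
Qed.

End with_dense_seq.
End closure.
End open_measurability.

(** * The flow *)

Section process_measurability.
Context {R : realType} {d : measure_display} {S : measurableType d}.

Lemma omf_snd d' (S' : measurableType d') (E : topologicalType) (f : S -> E) :
  open_measurable_fun f -> open_measurable_fun (fun p : S' * S => f p.2).
Proof.
move=> mf U oU; have := @measurable_snd _ _ S' S measurableT _ (mf U oU).
by rewrite setTI.
Qed.

(** Freezing Y at the last point before s of the grid of mesh 1/(n + 1) uses only times up to u, and
    path continuity gives the limit. With F_u as the sigma-algebra on S this is progressive
    measurability. *)
Lemma process_measurable (E : normedModType R) (T u : R) (Y : R -> S -> E) :
  u <= T -> (forall w, {within `[0, T], continuous (fun s => Y s w)}) ->
  (forall s, 0 <= s <= u -> open_measurable_fun (Y s)) ->
  open_measurable_fun (fun p : measurableTypeR R * S =>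
    if 0 < p.1 <= u then Y p.1 p.2 else 0).
Proof.
move=> uT cY mY.
pose g n (s : R) : R := (Num.truncn (n.+1%:R * s))%:R / n.+1%:R.
have gle n s : 0 <= s -> 0 <= g n s <= s /\ s - g n s < n.+1%:R^-1.
  move=> s0; have ns0 : 0 <= n.+1%:R * s by rewrite mulr_ge0.
  have /andP[h1 h2] := truncn_itv ns0.
  have n0 : 0 < n.+1%:R :> R by [].
  rewrite /g divr_ge0//= ler_pdivrMr// [s * _]mulrC h1; split=> //.
  rewrite -(ltr_pM2l n0) mulrBr mulrCA divff ?gt_eqF// mulr1.
  by rewrite ltrBlDr addrC natr1.
apply: (@omf_lim _ _ _ _ (fun n (p : measurableTypeR R * S) => if 0 < p.1 <= u then Y (g n p.1) p.2 else 0)).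
  move=> n; pose a k : R := k%:R / n.+1%:R.
  (* Index 0 is the complement of ]0, u] and index k' + 1 the part of the cell [a k', a (k' + 1)[
     inside it; if a k' exceeds u that part is empty and the value 0 is a default. *)
  apply: (@omf_bigcup _ _ _ (fun k => if k is k'.+1 then
      (`]0, u] `&` `[a k', a k'.+1[) `*` setT else (~` `]0, u]) `*` setT)
    (fun k => if k is k'.+1 then (if a k' <= u then fun p : measurableTypeR R * S => Y (a k') p.2 else cst 0)
      else cst 0)).
  - case=> [|k]; apply: measurableX => //; first by apply: measurableC; exact: measurable_itv.
    by apply: measurableI; exact: measurable_itv.
  - case=> [|k]; first exact: omf_cst.
    case: ifPn => ku; last exact: omf_cst.
    by apply: (@omf_snd _ (measurableTypeR R)); apply: mY; rewrite ku divr_ge0.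
  - move=> [s w]; have [su|su] := pselect (`]0, u]%classic s); last by exists 0%N.
    have := su; rewrite /= in_itv/= => /andP[s0 _].
    have ns0 : 0 <= n.+1%:R * s by rewrite mulr_ge0// ltW.
    have /andP[h1 h2] := truncn_itv ns0.
    exists (Num.truncn (n.+1%:R * s)).+1; split=> //; split=> //.
    by rewrite /= in_itv/= /a ler_pdivrMr// ltr_pdivlMr// ![s * _]mulrC h1.
  - case=> [|k] [s w] /=; rewrite !in_itv/=; first by case=> /negP/negPf ->.
    move=> [[su /andP[h1 h2]] _]; rewrite su.
    have tE : Num.truncn (n.+1%:R * s) = k.
      apply: truncn_def; move: h1 h2; rewrite /a ler_pdivrMr// ltr_pdivlMr//.
      by rewrite ![s * _]mulrC => -> ->.
    by rewrite /g tE (le_trans h1)//; case/andP: su.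
move=> [s w] /=; case: ifPn => [/andP[s0 su]|_]; last exact: cvg_cst.
have sT : 0 <= s <= T by rewrite ltW//= (le_trans su).
apply/cvgrPdist_lt => e e0.
have /within_itv_continuousP/(_ s sT e e0)[D D0 hD] := cY w.
have /cvgr_dist_lt/(_ _ D0)[N _ hN] := @cvg_harmonic R.
exists N => //= n Nn; have [/andP[g0 gs] gn] := gle n s (ltW s0).
apply: hD; first by rewrite g0/= (le_trans gs)//; case/andP: sT.
rewrite ger0_norm ?subr_ge0// (lt_trans gn)//.
by have := hN n Nn; rewrite /= sub0r normrN ger0_norm ?invr_ge0.
Qed.

End process_measurability.

Section exponent_theory.
Context {R : realType} {V : completeNormedModType R} {k : nat}.
Variables (L : 'I_k -> V -> V) (C : R).
Hypotheses (C0 : 0 <= C) (LC : forall i, bounded_by (L i) C)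
  (LL : forall i j v, L i (L j v) = L j (L i v)).
Implicit Types (w : 'rV[R]_k) (s : R) (v : V).

Definition exponent_bound s w := C * (\sum_(i < k) `|w 0 i|) + k%:R * C ^+ 2 * `|s| / 2.

Lemma exponent_bound_ge0 s w : 0 <= exponent_bound s w.
Proof. by rewrite addr_ge0 ?mulr_ge0 ?exprn_ge0// sumr_ge0. Qed.

Lemma exponent_bounded s w : bounded_by (exponent L s w) (exponent_bound s w).
Proof.
split=> [a u v|v].
  rewrite /exponent scaler_sumr -big_split; apply: eq_bigr => i _ /=.
  rewrite !(LC i).1 scalerBr !scalerDr !scalerA opprD addrACA.
  by rewrite [a * w 0 i]mulrC [a * (s / 2)]mulrC.
rewrite /exponent (le_trans (ler_norm_sum _ _ _))//.
apply: (@le_trans _ _ (\sum_(i < k) (`|w 0 i| * C + C ^+ 2 * `|s| / 2) * `|v|)).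
  apply: ler_sum => i _; rewrite (le_trans (ler_normB _ _))// mulrDl lerD// normrZ.
    by rewrite -mulrA ler_wpM2l// (LC i).2.
  rewrite normrM (@ger0_norm _ (2^-1)) ?invr_ge0//.
  have -> : C ^+ 2 * `|s| / 2 * `|v| = `|s| / 2 * (C ^+ 2 * `|v|) by field.
  rewrite ler_wpM2l ?divr_ge0// expr2 -mulrA (le_trans ((LC i).2 _))//.
  by rewrite ler_wpM2l// (LC i).2.
rewrite -mulr_suml ler_wpM2r// /exponent_bound big_split/= -mulr_suml mulrC lerD2l.
by rewrite sumr_const card_ord -[X in X <= _]mulr_natl !mulrA.
Qed.

Lemma exponentD s s' w w' v :
  exponent L (s + s') (w + w') v = exponent L s w v + exponent L s' w' v.
Proof.
rewrite /exponent -big_split; apply: eq_bigr => i _ /=.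
by rewrite mxE mulrDl !scalerDl opprD addrACA.
Qed.

Lemma exponent_comm (S : V -> V) s w v : linear S -> (forall i v, S (L i v) = L i (S v)) ->
  S (exponent L s w v) = exponent L s w (S v).
Proof.
move=> lS SL; rewrite /exponent (lin_sum _ _ _ lS); apply: eq_bigr => i _.
by rewrite (linB _ _ lS) !(linZ _ _ lS) !SL.
Qed.

Lemma exponent_exponent s s' w w' v :
  exponent L s w (exponent L s' w' v) = exponent L s' w' (exponent L s w v).
Proof.
apply: exponent_comm; first exact: (exponent_bounded s w).1.
by move=> i u; rewrite (exponent_comm _ _ _ (LC i).1)// => j u'; exact: LL.
Qed.

(** Time and noise are independent deterministic arguments. The Brownian value is substituted only
    later, so the estimates on the flow are pathwise. *)
Definition flow s w v := exp_op (exponent L s w) v.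

Lemma flow_linear s w : linear (flow s w).
Proof. exact: (exp_op_linear (exponent_bound_ge0 s w) (exponent_bounded s w)). Qed.

Lemma flow_norm s w v : `|flow s w v| <= expR (exponent_bound s w) * `|v|.
Proof. exact: (exp_op_norm v (exponent_bound_ge0 s w) (exponent_bounded s w)). Qed.

Lemma flowD s s' w w' v : flow (s' + s) (w' + w) v = flow s' w' (flow s w v).
Proof.
rewrite /flow -(exp_opD v (exponent_bound_ge0 s' w') (exponent_bound_ge0 s w)
  (exponent_bounded s' w') (exponent_bounded s w)); last first.
  by move=> u; rewrite exponent_exponent.
by congr (exp_op _ _); apply/funext => u; exact: exponentD.
Qed.

Lemma flow_comm (S : V -> V) s w v : linear S -> continuous S ->
  (forall i v, S (L i v) = L i (S v)) -> S (flow s w v) = flow s w (S v).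
Proof.
move=> lS cS SL; rewrite /flow.
apply: (@exp_op_comm _ _ _ _ _ S _ _ v (exponent_bound_ge0 s w) (exponent_bound_ge0 s w)
  (exponent_bounded s w) (exponent_bounded s w)) => // u.
exact: exponent_comm.
Qed.

Lemma flow0 v : flow 0 0 v = v.
Proof.
rewrite /flow (_ : exponent L 0 0 = fun=> 0) ?exp_op0//.
apply/funext => u; rewrite /exponent big1// => i _.
by rewrite mxE mul0r !scale0r subrr.
Qed.

Lemma flow_dist s s' w w' v : `|flow s' w' v - flow s w v| <=
  exponent_bound (s' - s) (w' - w) * expR (exponent_bound (s' - s) (w' - w)) *
  `|flow s w v|.
Proof.
have -> : flow s' w' v = flow (s' - s) (w' - w) (flow s w v).
  by rewrite -flowD !subrK.
have := exp_op_taylor (flow s w v) 1 (exponent_bound_ge0 (s' - s) (w' - w))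
  (exponent_bounded (s' - s) (w' - w)).
by rewrite big_nat1 /exp_terms /= fact0 invr1 scale1r expr1.
Qed.

(* Second-order expansion: the diagonal of the quadratic term is compensated by
   the Ito correction [- s / 2 * (L i) ^ 2] of the exponent. *)
Lemma flow_taylor s w v (x := C * (\sum_(i < k) `|w 0 i|))
    (y := k%:R * C ^+ 2 * s / 2) : 0 <= s ->
  `|flow s w v - v - \sum_(i < k) w 0 i *: L i v
    - 2^-1 *: \sum_(i < k) \sum_(j < k) (w 0 i * w 0 j - (i == j)%:R * s) *: L i (L j v)|
  <= (x * y + y ^+ 2 / 2 + (x + y) ^+ 3 * expR (x + y)) * `|v|.
Proof.
move=> s0.
have x0 : 0 <= x by rewrite mulr_ge0// sumr_ge0.
have y0 : 0 <= y by rewrite /y !mulr_ge0 ?exprn_ge0.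
have bE : exponent_bound s w = x + y by rewrite /exponent_bound ger0_norm.
pose N u := \sum_(i < k) w 0 i *: L i u.
pose Q u := \sum_(i < k) (s / 2) *: L i (L i u).
have DE u : exponent L s w u = N u - Q u by rewrite /exponent sumrB.
have NB : bounded_by N x.
  split=> [a u u'|u].
    rewrite /N scaler_sumr -big_split; apply: eq_bigr => i _ /=.
    by rewrite (LC i).1 scalerDr !scalerA [a * _]mulrC.
  rewrite (le_trans (ler_norm_sum _ _ _))// /x mulr_sumr mulr_suml.
  apply: ler_sum => i _; rewrite normrZ [C * _]mulrC -mulrA ler_wpM2l//.
  exact: (LC i).2.
have QB : bounded_by Q y.
  split=> [a u u'|u].
    rewrite /Q scaler_sumr -big_split; apply: eq_bigr => i _ /=.
    by rewrite !(LC i).1 scalerDr !scalerA [a * _]mulrC.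
  rewrite (le_trans (ler_norm_sum _ _ _))//.
  apply: (@le_trans _ _ (\sum_(i < k) (s / 2) * (C ^+ 2 * `|u|))).
    apply: ler_sum => i _; rewrite normrZ ger0_norm ?divr_ge0// ler_wpM2l ?divr_ge0//.
    by rewrite expr2 -mulrA (le_trans ((LC i).2 _))// ler_wpM2l// (LC i).2.
  by rewrite sumr_const card_ord -mulr_natl /y; lra.
have NN u : N (N u) = \sum_(i < k) \sum_(j < k) (w 0 i * w 0 j) *: L i (L j u).
  rewrite {1}/N; apply: eq_bigr => i _.
  rewrite /N (lin_sum _ _ _ (LC i).1) scaler_sumr; apply: eq_bigr => j _.
  by rewrite (linZ _ _ (LC i).1) scalerA.
have ->: 2^-1 *: (\sum_(i < k) \sum_(j < k) (w 0 i * w 0 j - (i == j)%:R * s) *: L i (L j v))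
    = 2^-1 *: N (N v) - Q v.
  rewrite NN /Q; apply: (@scalerI _ _ 2) => //.
  rewrite scalerBr !scalerA mulfV// !scale1r scaler_sumr -sumrB; apply: eq_bigr => i _.
  rewrite scalerA mulrCA mulfV// mulr1 -[s in RHS]mul1r.
  have -> : (1 * s) *: L i (L i v) = \sum_(j < k) ((i == j)%:R * s) *: L i (L j v).
    rewrite (bigD1 i)//= eqxx big1 ?addr0// => j ji.
    by rewrite eq_sym (negPf ji) mul0r scale0r.
  by rewrite -sumrB; apply: eq_bigr => j _; rewrite scalerBl.
have := exp_op_taylor v 3 (exponent_bound_ge0 s w) (exponent_bounded s w).
rewrite -/(flow s w v) !big_nat_recr//= big_geq// add0r /exp_terms/= bE.
rewrite fact0 invr1 !scale1r !DE; set D3 := _ - _ => h3.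
have -> : flow s w v - v - N v - (2^-1 *: N (N v) - Q v) =
    D3 + 2^-1 *: (- N (Q v) - Q (N v) + Q (Q v)).
  rewrite /D3 (linB _ _ NB.1) (linB _ _ QB.1) (_ : 2`! = 2%N)//.
  have E : 2^-1 *: (N (N v) - N (Q v) - (Q (N v) - Q (Q v))) =
      2^-1 *: N (N v) + 2^-1 *: (- N (Q v) - Q (N v) + Q (Q v)).
    by rewrite -scalerDr opprB !addrA [_ + Q (Q v) - _]addrAC.
  rewrite E !opprD !opprK !addrA addrNK addrAC.
  by [].
(* The part of half the squared exponent that contains the drift Q: the mixed products contribute x
   * y together, the square of Q contributes y^2 / 2. *)
have h1 : `|2^-1 *: (- N (Q v) - Q (N v) + Q (Q v))| <= (x * y + y ^+ 2 / 2) * `|v|.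
  rewrite normrZ ger0_norm ?invr_ge0//.
  have a1 : `|N (Q v)| <= x * (y * `|v|).
    by rewrite (le_trans (NB.2 _))// ler_wpM2l// QB.2.
  have a2 : `|Q (N v)| <= y * (x * `|v|).
    by rewrite (le_trans (QB.2 _))// ler_wpM2l// NB.2.
  have a3 : `|Q (Q v)| <= y * (y * `|v|).
    by rewrite (le_trans (QB.2 _))// ler_wpM2l// QB.2.
  have a4 : `|- N (Q v) - Q (N v) + Q (Q v)| <= `|N (Q v)| + `|Q (N v)| + `|Q (Q v)|.
    by rewrite (le_trans (ler_normD _ _))// lerD2r (le_trans (ler_normB _ _))// normrN.
  have -> : (x * y + y ^+ 2 / 2) * `|v| =
      2^-1 * (x * (y * `|v|) + y * (x * `|v|) + y * (y * `|v|)) by field.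
  by rewrite ler_wpM2l ?invr_ge0//; lra.
by rewrite (le_trans (ler_normD _ _))// mulrDl addrC lerD.
Qed.

End exponent_theory.

(** * Moments of Gaussian variables *)

Section real_integrals.
Context {R : realType} {d : measure_display} {S : measurableType d}.
Variable mu : probability S R.
Implicit Types f g : S -> R.

Definition rint f := mu.-integrable setT (EFin \o f).
Definition expect f : R := \int[mu]_x f x.

Lemma rint_measurable f : rint f -> measurable_fun setT f.
Proof. by move=> /integrableP[/measurable_EFinP]. Qed.

Lemma rint_le f g : measurable_fun setT f -> (forall x, `|f x| <= g x) -> rint g -> rint f.
Proof.
move=> mf fg; apply: le_integrable => //; first exact/measurable_EFinP.
by move=> x _ /=; rewrite lee_fin (le_trans (fg x))// ler_norm.
Qed.

Lemma rintD f g : rint f -> rint g -> rint (fun x => f x + g x).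
Proof. by move=> hf hg; exact: (integrableD measurableT hf hg). Qed.

Lemma rintZ a f : rint f -> rint (fun x => a * f x).
Proof. by move=> hf; exact: (integrableZl measurableT a hf). Qed.

Lemma rintB f g : rint f -> rint g -> rint (fun x => f x - g x).
Proof. by move=> hf hg; exact: (integrableB measurableT hf hg). Qed.

Lemma rint_cst a : rint (fun=> a).
Proof.
apply: (@measurable_bounded_integrable _ _ _ mu (fun=> a) setT) => //.
  exact: (le_lt_trans (probability_le1 mu measurableT) (ltry _)).
by exists `|a|; split=> // x ax y _ /=; rewrite ltW.
Qed.

Lemma expectD f g : rint f -> rint g -> expect (fun x => f x + g x) = expect f + expect g.
Proof. by move=> hf hg; exact: RintegralD. Qed.

Lemma expectB f g : rint f -> rint g -> expect (fun x => f x - g x) = expect f - expect g.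
Proof. by move=> hf hg; exact: RintegralB. Qed.

Lemma expectZ a f : rint f -> expect (fun x => a * f x) = a * expect f.
Proof. by move=> hf; exact: RintegralZl. Qed.

Lemma expect_cst a : expect (fun=> a) = a.
Proof. rewrite /expect Rintegral_cst//.
exact: (etrans (congr1 (fun x => a * fine x) (probability_setT mu)) (mulr1 a)). Qed.

Lemma le_expect f g : rint f -> rint g -> (forall x, f x <= g x) -> expect f <= expect g.
Proof. by move=> hf hg fg; apply: le_Rintegral => // x _. Qed.

Lemma norm_expect_le f g : rint f -> rint g -> (forall x, `|f x| <= g x) ->
  `|expect f| <= expect g.
Proof.
move=> hf hg fg; rewrite (le_trans (le_normr_Rintegral measurableT hf))//.
by apply: le_Rintegral => //; exact: integrable_norm.
Qed.

Lemma expectE f : rint f -> (\int[mu]_x (f x)%:E)%E = (expect f)%:E.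
Proof. by move=> hf; rewrite /expect /Rintegral fineK//; exact: integrable_fin_num. Qed.

Lemma markov_le f a : (forall x, 0 <= f x) -> rint f -> 0 < a ->
  (mu [set x | (a <= f x)%R] <= (expect f / a)%:E)%E.
Proof.
move=> f0 hf a0.
have : (a%:E * mu (setT `&` [set x | a%:E <= `|(EFin \o f) x|]) <=
    \int[mu]_(x in setT) `|(EFin \o f) x|)%E.
  apply: (le_integral_comp_abse mu measurableT (f := id)) => //.
  by apply/measurable_EFinP; exact: rint_measurable.
under eq_integral do rewrite /= ger0_norm//.
rewrite expectE// setTI => h.
rewrite EFinM lee_pdivlMr// muleC; apply: le_trans h; rewrite le_eqVlt; apply/orP; left.
by apply/eqP; congr (_ * mu _)%E; apply/seteqP; split => x /=; rewrite lee_fin ger0_norm.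
Qed.

End real_integrals.

(** The n-th power of y <= e^y at y = x / (n c). *)
Lemma powr_le_exp {R : realType} (x c : R) n : 0 < c -> 0 <= x ->
  x ^+ n <= (n%:R * c) ^+ n * expR (x / c).
Proof.
move=> c0 x0; case: n => [|n]; first by rewrite !expr0 mul1r -expR0 ler_expR divr_ge0// ltW.
have nc0 : 0 < n.+1%:R * c by rewrite mulr_gt0.
have -> : expR (x / c) = expR (x / (n.+1%:R * c)) ^+ n.+1.
  rewrite -expRM_natl; congr expR; field.
  by rewrite gt_eqF//= pnatr_eq0.
rewrite -exprMn lerXn2r// ?nnegrE ?mulr_ge0 ?expR_ge0 ?(ltW c0)//.
by rewrite [leRHS]mulrC -ler_pdivrMr// (le_trans _ (expR_ge1Dx _))// lerDr.
Qed.

Section gaussian_moments.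
Context {R : realType}.
Variable s : R.
Hypothesis s0 : 0 < s.
Local Notation nu := (normal_prob 0 s : probability (measurableTypeR R) R).

Lemma integral_normal_prob (f : R -> \bar R) : measurable_fun setT f ->
  (forall x, 0 <= f x)%E ->
  (\int[normal_prob 0 s]_x f x = \int[lebesgue_measure]_x (f x * (normal_pdf 0 s x)%:E))%E.
Proof.
move=> mf f0; have dom := @normal_prob_dominates R 0 s.
rewrite -(Radon_Nikodym_SigmaFinite.change_of_variables dom)//.
apply: ae_eq_integral => //.
- apply: emeasurable_funM => //; apply: (measurable_int lebesgue_measure).
  exact: Radon_Nikodym_SigmaFinite.f_integrable.
- by apply: emeasurable_funM => //; apply/measurable_EFinP; exact: measurable_normal_pdf.
- apply: ae_eqe_mul2l; apply: integral_ae_eq => //.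
  + exact: Radon_Nikodym_SigmaFinite.f_integrable.
  + by apply/measurable_EFinP; exact: measurable_normal_pdf.
  + by move=> A _ mA; rewrite -Radon_Nikodym_SigmaFinite.f_integral.
Qed.

Lemma measurable_expM (h : R) : measurable_fun setT (fun x : R => expR (h * x)).
Proof.
apply: (@measurableT_comp _ _ _ _ _ _ expR _ (fun x : R => h * x)) => //.
exact: mulrl_measurable.
Qed.

(** Completing the square: the factor e^(h x) moves the centre of the density to h s^2. *)
Lemma integral_normal_exp (h : R) :
  (\int[normal_prob 0 s]_x (expR (h * x))%:E = (expR (h ^+ 2 * s ^+ 2 / 2))%:E)%E.
Proof.
rewrite integral_normal_prob; last 2 first.
- by apply/measurable_EFinP; exact: measurable_expM.
- by move=> x; rewrite lee_fin expR_ge0.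
transitivity (\int[lebesgue_measure]_x ((expR (h ^+ 2 * s ^+ 2 / 2))%:E *
    (normal_pdf (h * s ^+ 2) s x)%:E))%E.
  apply: eq_integral => x _; rewrite -!EFinM; congr (_%:E).
  rewrite !normal_pdfE ?gt_eqF// /normal_fun mulrCA [RHS]mulrCA -!expRD; congr (_ * expR _).
  by field; rewrite gt_eqF.
rewrite ge0_integralZl//=.
- by rewrite integral_normal_pdf mule1.
- by apply/measurable_EFinP; exact: measurable_normal_pdf.
- by move=> x _; rewrite lee_fin normal_pdf_ge0.
Qed.

Lemma rint_exp h : rint nu (fun x => expR (h * x)).
Proof.
apply/integrableP; split.
  by apply/measurable_EFinP; exact: measurable_expM.
under eq_integral do rewrite /= ger0_norm ?expR_ge0//.
by rewrite integral_normal_exp ltry.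
Qed.

Lemma expect_exp h : expect nu (fun x => expR (h * x)) = expR (h ^+ 2 * s ^+ 2 / 2).
Proof. by rewrite /expect /Rintegral integral_normal_exp. Qed.

(** This is 2 cosh (x / s), an integrable majorant of e^(|x| / s) and hence, up to constants, of all
    powers of |x|. *)
Let c2 (x : R) := expR (s^-1 * x) + expR (- s^-1 * x).

Let rint_c2 : rint nu c2.
Proof. by apply: rintD; exact: rint_exp. Qed.

Let exp2_le : expR (2^-1) <= 2 :> R.
Proof.
have h : 2^-1 <= expR (- 2^-1) :> R by rewrite (le_trans _ (expR_ge1Dx _))//; lra.
rewrite -[2^-1]opprK expRN -[leRHS]invrK lef_pV2// ?posrE ?expR_gt0//.
Qed.

Let expect_c2 : expect nu c2 <= 4.
Proof.
rewrite expectD; [|exact: rint_exp..].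
rewrite !expect_exp sqrrN -exprMn mulVf ?gt_eqF// expr1n mul1r.
by have := exp2_le; lra.
Qed.

Let exp_abs_le x : expR (`|x| / s) <= c2 x.
Proof.
rewrite /c2; have [x0|x0] := leP 0 x.
  by rewrite ger0_norm// mulrC lerDl expR_ge0.
by rewrite ltr0_norm// mulNr -mulrN mulrC mulNr lerDr expR_ge0.
Qed.

Let pow_le x n : `|x| ^+ n <= (n%:R * s) ^+ n * c2 x.
Proof.
rewrite (le_trans (powr_le_exp n s0 (normr_ge0 x)))// ler_wpM2l//.
by rewrite exprn_ge0// mulr_ge0// ltW.
Qed.

Lemma rint_pow n : rint nu (fun x => x ^+ n).
Proof.
apply: (@rint_le _ _ _ nu _ (fun x => (n%:R * s) ^+ n * c2 x)).
- exact: measurable_funX.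
- by move=> x; rewrite normrX.
- exact: rintZ.
Qed.

(** 1024 is 4^4 from x^4 <= (4 s)^4 e^(|x| / s), times the bound 4 on [expect nu c2]; what matters
    later is the order s^4. *)
Lemma expect_pow4 : expect nu (fun x => x ^+ 4) <= 1024 * s ^+ 4.
Proof.
apply: (@le_trans _ _ (expect nu (fun x => (4 * s) ^+ 4 * c2 x))).
  apply: le_expect; [exact: rint_pow|exact: rintZ|move=> x].
  by rewrite -[x ^+ 4]ger0_norm ?exprn_even_ge0// normrX.
rewrite expectZ//.
have -> : 1024 * s ^+ 4 = (4 * s) ^+ 4 * 4 by rewrite exprMn; ring.
by rewrite ler_wpM2l// exprn_ge0// mulr_ge0// ltW.
Qed.

(** The operator bound on the one-dimensional space R, for multiplication by u. *)
Lemma exp_taylor2 (u : R) : `|expR u - (1 + u + u ^+ 2 / 2)| <= `|u| ^+ 3 * expR `|u|.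
Proof.
have bu : bounded_by (fun x : R^o => (u * x : R^o)) `|u|.
  by split=> [a x y|x]; rewrite ?normrM// mulrDr; congr (_ + _); exact: mulrCA.
have E : exp_op (fun x : R^o => (u * x : R^o)) 1 = expR u.
  apply: (exp_opE (normr_ge0 u) bu).
  have -> : exp_terms (fun x : R^o => (u * x : R^o)) 1 = exp_coeff u.
    apply/funext => n; rewrite /exp_terms /exp_coeff/= [RHS]mulrC; congr (_ * _).
    by elim: n => //= n ->; rewrite exprS.
  exact: is_cvg_series_exp_coeff.
have := exp_op_taylor (1 : R^o) 3 (normr_ge0 u) bu.
rewrite E !big_nat_recr//= big_geq// add0r /exp_terms/= normr1 !mulr1.
rewrite fact0 (_ : 1`! = 1%N)// (_ : 2`! = 2%N)// !invr1 !scale1r.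
by rewrite (_ : 2^-1 *: _ = u ^+ 2 / 2)// /GRing.scale/= expr2 mulrC.
Qed.

Let m1 := expect nu (fun x => x).
Let m2 := expect nu (fun x => x ^+ 2).

(** Both sides of E e^(h x) = e^(h^2 s^2 / 2) are expanded to second order in h, so that the first
    two moments follow by comparing coefficients. The restriction on h leaves half of the weight
    e^(|x| / s) to dominate |x|^3. *)
Let moment_expansion : exists2 K, 0 <= K & forall h, `|h| <= (2 * s)^-1 ->
  `|h * m1 + h ^+ 2 * ((m2 - s ^+ 2) / 2)| <= K * `|h| ^+ 3.
Proof.
have s3 : 0 <= s ^+ 3 by exact: exprn_ge0 (ltW s0).
have p216 : 0 <= 216 * s ^+ 3 by exact: (mulr_ge0 (ler0n R 216) s3).
(* 865 = 216 * 4 + 1: 216 = 6^3 comes from |x|^3 <= (3 * 2 s)^3 e^(|x| / (2 s)), 4 bounds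
   [expect nu c2], and 1 accounts for the second-order remainder of the right-hand side. *)
exists (865 * s ^+ 3) => [|h hs]; first exact: (mulr_ge0 (ler0n R 865) s3).
have s20 : 0 < 2 * s by rewrite mulr_gt0.
have hs2 : `|h| * s <= 2^-1.
  by move: hs; rewrite -(ler_pM2r s0) invfM -mulrA mulVf ?gt_eqF// mulr1.
pose f x := expR (h * x) - (1 + h * x + h ^+ 2 / 2 * x ^+ 2).
have r1 : rint nu (fun x => h * x) by apply: rintZ; exact: (rint_pow 1).
have r2 : rint nu (fun x => h ^+ 2 / 2 * x ^+ 2) by apply: rintZ; exact: (rint_pow 2).
have r01 : rint nu (fun x => 1 + h * x) by apply: rintD => //; exact: rint_cst.
have r012 : rint nu (fun x => 1 + h * x + h ^+ 2 / 2 * x ^+ 2) by apply: rintD.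
have rf : rint nu f by apply: rintB => //; exact: rint_exp.
have Ef : expect nu f = expR (h ^+ 2 * s ^+ 2 / 2) - (1 + h * m1 + h ^+ 2 / 2 * m2).
  rewrite expectB ?expect_exp//; last exact: rint_exp.
  rewrite expectD// (@expectD _ _ _ nu (fun=> 1))//; last exact: rint_cst.
  by rewrite expect_cst expectZ ?expectZ//; [exact: (rint_pow 2)|exact: (rint_pow 1)].
have Bf : `|expect nu f| <= 864 * s ^+ 3 * `|h| ^+ 3.
  apply: (@le_trans _ _ (expect nu (fun x => 216 * s ^+ 3 * `|h| ^+ 3 * c2 x))).
    apply: norm_expect_le => //; first exact: rintZ.
    move=> x; rewrite /f (_ : h ^+ 2 / 2 * x ^+ 2 = (h * x) ^+ 2 / 2); last by field.
    rewrite (le_trans (exp_taylor2 _))// normrM exprMn.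
    have hx : expR (`|h| * `|x|) <= expR (`|x| / (2 * s)).
      by rewrite ler_expR mulrC ler_wpM2l.
    have h3 := powr_le_exp 3 s20 (normr_ge0 x).
    have h4 : expR (`|x| / (2 * s)) * expR (`|x| / (2 * s)) <= c2 x.
      rewrite -expRD (_ : _ + _ = `|x| / s) ?exp_abs_le//.
      by field; rewrite gt_eqF.
    have h5 : `|x| ^+ 3 * expR (`|h| * `|x|) <=
        (3%:R * (2 * s)) ^+ 3 * expR (`|x| / (2 * s)) * expR (`|x| / (2 * s)).
      by apply: ler_pM; rewrite ?exprn_ge0 ?expR_ge0.
    have h6 : (3%:R * (2 * s)) ^+ 3 * expR (`|x| / (2 * s)) * expR (`|x| / (2 * s)) <=
        216 * s ^+ 3 * c2 x.
      rewrite -mulrA (_ : (3%:R * (2 * s)) ^+ 3 = 216 * s ^+ 3); last by ring.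
      by apply: ler_wpM2l.
    rewrite -[leLHS]mulrA [leRHS](_ : _ = `|h| ^+ 3 * (216 * s ^+ 3 * c2 x)); last by ring.
    by rewrite ler_wpM2l ?exprn_ge0// (le_trans h5).
  rewrite expectZ// (_ : 864 = 216 * 4 :> R); last by ring.
  have -> : 216 * 4 * s ^+ 3 * `|h| ^+ 3 = 216 * s ^+ 3 * `|h| ^+ 3 * 4 by ring.
  apply: ler_wpM2l; last exact: expect_c2.
  exact: (mulr_ge0 p216 (exprn_ge0 3 (normr_ge0 h))).
set u := h ^+ 2 * s ^+ 2 / 2 in Ef.
have u0 : 0 <= u by rewrite /u divr_ge0// mulr_ge0// sqr_ge0.
have uE : u = (`|h| * s) ^+ 2 / 2 by rewrite /u exprMn real_normK ?num_real.
have hs0 : 0 <= `|h| * s by rewrite mulr_ge0// ltW.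
have Bu : `|expR u - 1 - u| <= s ^+ 3 * `|h| ^+ 3.
  have := exp_taylor2 u; rewrite (ger0_norm u0) => tu.
  have u8 : u <= 2^-1 ^+ 3 by rewrite uE; nra.
  have eu : expR u <= 2.
    by rewrite (le_trans _ exp2_le)// ler_expR (le_trans u8)//; lra.
  have t2 : u ^+ 3 * expR u <= u ^+ 3 * 2 by rewrite ler_wpM2l// exprn_ge0.
  have : `|expR u - 1 - u| <= u ^+ 2 / 2 + u ^+ 3 * 2.
    have -> : expR u - 1 - u = (expR u - (1 + u + u ^+ 2 / 2)) + u ^+ 2 / 2 by ring.
    rewrite (le_trans (ler_normD _ _))// [X in _ + X]ger0_norm; last first.
      by rewrite divr_ge0// sqr_ge0.
    lra.
  move=> /le_trans; apply.
  have -> : s ^+ 3 * `|h| ^+ 3 = (`|h| * s) ^+ 3 by ring.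
  have : u ^+ 3 * 2 <= u ^+ 2 / 2.
    have -> : u ^+ 3 * 2 = u ^+ 2 * (u * 2) by ring.
    by rewrite ler_wpM2l ?sqr_ge0//; lra.
  suff : u ^+ 2 <= (`|h| * s) ^+ 3 by lra.
  rewrite uE; set y := `|h| * s in hs0 hs2 *.
  have -> : (y ^+ 2 / 2) ^+ 2 = y ^+ 3 * (y / 4) by field.
  by rewrite ler_piMr ?exprn_ge0//; lra.
have -> : h * m1 + h ^+ 2 * ((m2 - s ^+ 2) / 2) = (expR u - 1 - u) - expect nu f.
  by rewrite Ef /u; field.
rewrite (le_trans (ler_normB _ _))// (le_trans (lerD Bu Bf))//.
lra.
Qed.

Let small_eq0 (x K h0 : R) : 0 < h0 -> (forall h, 0 < h -> h <= h0 -> `|x| <= K * h) -> x = 0.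
Proof.
move=> h00 H; apply/eqP; rewrite -normr_le0 leNgt; apply/negP => x0.
have K1 : 0 < `|K| + 1 by rewrite ltr_wpDl.
pose h := Num.min h0 (`|x| / (2 * (`|K| + 1))).
have hpos : 0 < h by rewrite lt_min h00 divr_gt0// mulr_gt0.
have hh0 : h <= h0 by rewrite /h ge_min lexx.
have hx : h <= `|x| / (2 * (`|K| + 1)) by rewrite /h ge_min lexx orbT.
have h1 : K * h <= (`|K| + 1) * h.
  by rewrite ler_wpM2r ?(ltW hpos)// (le_trans (ler_norm _))// lerDl.
have h2 : (`|K| + 1) * h <= (`|K| + 1) * (`|x| / (2 * (`|K| + 1))) by rewrite ler_pM2l.
have h3 : (`|K| + 1) * (`|x| / (2 * (`|K| + 1))) = `|x| / 2 by field; rewrite gt_eqF.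
have := H h hpos hh0; lra.
Qed.

Lemma expect_id : expect nu (fun x => x) = 0.
Proof.
have [K K0 mK] := moment_expansion.
have h00 : 0 < (2 * s)^-1 by rewrite invr_gt0 mulr_gt0.
apply: (@small_eq0 _ (K * (2 * s)^-1) _ h00) => h hp hh.
have hn : `|h| <= (2 * s)^-1 by rewrite gtr0_norm.
(* Using h and - h together eliminates the quadratic coefficient and leaves |m1| <= K h^2. *)
have := mK h hn; have := mK (- h).
rewrite normrN sqrrN (gtr0_norm hp) => /(_ hh); set a := (m2 - _) / 2.
rewrite !ler_norml => /andP[a1 a2] /andP[a3 a4].
have h2 : K * h ^+ 3 <= K * (2 * s)^-1 * h * h.
  have -> : K * h ^+ 3 = K * h * h * h by ring.
  by rewrite !ler_wpM2r ?(ltW hp)// ler_wpM2l.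
have a5 : h * m1 <= h * (K * (2 * s)^-1 * h) by lra.
have a6 : h * - (K * (2 * s)^-1 * h) <= h * m1 by lra.
by apply/andP; rewrite !(ler_pM2l hp) in a5 a6.
Qed.

Lemma expect_sqr : expect nu (fun x => x ^+ 2) = s ^+ 2.
Proof.
have [K K0 mK] := moment_expansion.
have h00 : 0 < (2 * s)^-1 by rewrite invr_gt0 mulr_gt0.
apply/eqP; rewrite -subr_eq0; apply/eqP.
apply: (@small_eq0 _ (2 * K) _ h00) => h hp hh.
have hn : `|h| <= (2 * s)^-1 by rewrite gtr0_norm.
have := mK h hn; rewrite (gtr0_norm hp).
rewrite (_ : m1 = 0) ?mulr0 ?add0r; last exact: expect_id.
have h2 : 0 < h ^+ 2 by rewrite exprn_gt0.
have -> : K * h ^+ 3 = h ^+ 2 * (K * h) by ring.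
rewrite normrM (gtr0_norm h2) ler_pM2l// -/m2.
rewrite !ler_norml => /andP[a1 a2]; apply/andP; split; lra.
Qed.

End gaussian_moments.

(** * Independence and Brownian increments *)

Section independence.
Context {R : realType} {d d1 d2 : measure_display} {S : measurableType d}
  {S1 : measurableType d1} {S2 : measurableType d2}.

Lemma measure_unique_rectangles (m m' : {measure set (S1 * S2) -> \bar R}) :
  (forall A B, measurable A -> measurable B -> m (A `*` B) = m' (A `*` B)) ->
  (m setT < +oo)%E -> forall X, measurable X -> m X = m' X.
Proof.
move=> mm' mT X mX.
pose C : set (set (S1 * S2)) :=
  [set C | exists A, measurable A /\ exists B, measurable B /\ C = A `*` B].
have CI : setI_closed C.
  move=> /= _ _ [X1 [mX1 [X2 [mX2 ->]]]] [Y1 [mY1 [Y2 [mY2 ->]]]].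
  rewrite -setXI; exists (X1 `&` Y1); split; first exact: measurableI.
  by exists (X2 `&` Y2); split => //; exact: measurableI.
apply: (measure_unique C (fun=> setT)) => //.
- rewrite measurable_prod_measurableType //; congr (<<s _ >>).
  rewrite predeqE; split => [[A mA [B mB <-]]|[A [mA [B [mB ->]]]]].
    by exists A; split => //; exists B.
  by exists A => //; exists B.
- by move=> n; exists setT; split => //; exists setT; split => //; rewrite setXTT.
- by rewrite bigcup_const//; exists 0%N.
- by move=> _ [A [mA [B [mB ->]]]]; exact: mm'.
Qed.

Variables (P : probability S R) (nu : probability S2 R).
Variables (X : S -> S1) (V : S -> S2).
Hypotheses (mX : measurable_fun setT X) (mV : measurable_fun setT V).
Hypothesis ind : forall A D, measurable A -> measurable D ->
  P (X @^-1` A `&` V @^-1` D) = (P (X @^-1` A) * nu D)%E.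

(** Independence says that the law of (X, V) is a product measure, and Fubini integrates g first. *)
Lemma expect_indep_mean0 (f : S1 -> R) (g : S2 -> R) :
  measurable_fun setT f -> rint nu g -> expect nu g = 0 ->
  rint P (fun w => f (X w) * g (V w)) -> expect P (fun w => f (X w) * g (V w)) = 0.
Proof.
move=> mf rg g0 rfg.
pose X' : {mfun S >-> S1} := MeasurableFun.Pack (MeasurableFun.Class (isMeasurableFun.Build _ _ _ _ _ mX)).
pose m1 := distribution P X'.
have mXV : measurable_fun setT (fun w => (X w, V w)) by exact: measurable_fun_pair.
pose XV : {mfun S >-> (S1 * S2)%type} :=
  MeasurableFun.Pack (MeasurableFun.Class (isMeasurableFun.Build _ _ _ _ _ mXV)).
pose m' := distribution P XV.
have m'E E : measurable E -> (m1 \x nu)%E E = m' E.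
  apply: product_measure_unique => A B mA mB.
  by rewrite /m' /m1 /distribution /pushforward -ind.
pose h (p : S1 * S2) : R := f p.1 * g p.2.
have mg := rint_measurable rg.
have mh : measurable_fun setT h.
  apply: measurable_funM.
    by apply: (measurableT_comp mf); exact: measurable_fst.
  by apply: (measurableT_comp mg); exact: measurable_snd.
have mEh : measurable_fun setT (EFin \o h) by apply/measurable_EFinP.
have rh' : m'.-integrable setT (EFin \o h).
  by apply: integrable_pushforward.
have rh : (m1 \x nu)%E.-integrable setT (EFin \o h).
  apply/integrableP; split=> //; move/integrableP : rh' => [_].
  suff -> : (\int[m1 \x nu]_x `|(EFin \o h) x| = \int[m']_x `|(EFin \o h) x|)%E by [].
  by apply: eq_measure_integral => A mA _; exact: m'E.
have E1 : (\int[P]_w (f (X w) * g (V w))%:E = \int[m1 \x nu]_z (EFin \o h) z)%E.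
  transitivity (\int[m']_z (EFin \o h) z)%E.
    by rewrite /m' /distribution integral_pushforward.
  by apply: eq_measure_integral => A mA _; exact: esym (m'E A mA).
rewrite /expect /Rintegral E1 -(integral12_prod_meas1 rh).
rewrite (eq_integral (cst 0%E)) ?integral0// => a _.
rewrite /fubini_F/= /h/=.
under eq_integral do rewrite EFinM.
by rewrite integralZl// expectE// g0 mule0.
Qed.

End independence.

Section independent_pair.
Context {R : realType} {d d1 d2 d3 : measure_display} {S : measurableType d}
  {S1 : measurableType d1} {S2 : measurableType d2} {S3 : measurableType d3}.
Variables (P : probability S R) (nu2 : probability S2 R) (nu3 : probability S3 R).
Variables (X : S -> S1) (V : S -> S2) (V' : S -> S3).
Hypotheses (mX : measurable_fun setT X) (mV : measurable_fun setT V)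
  (mV' : measurable_fun setT V').
Hypothesis ind : forall A D D', measurable A -> measurable D -> measurable D' ->
  P (X @^-1` A `&` V @^-1` D `&` V' @^-1` D') = (P (X @^-1` A) * nu2 D * nu3 D')%E.

(** As functions of E both sides are finite measures that agree on rectangles. This groups the past
    and one coordinate of an increment into a single variable independent of another coordinate. *)
Lemma indep_pairl E D' : measurable E -> measurable D' ->
  P ((fun w => (X w, V w)) @^-1` E `&` V' @^-1` D') =
  (P ((fun w => (X w, V w)) @^-1` E) * nu3 D')%E.
Proof.
move=> mE mD'.
have mXV : measurable_fun setT (fun w => (X w, V w)) by exact: measurable_fun_pair.
have mVD : measurable (V' @^-1` D') by rewrite -[_ @^-1` _]setTI; exact: mV'.
have fin3 : nu3 D' \is a fin_num by exact: fin_num_measure.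
pose r : {nonneg R} := NngNum (fine_ge0 (measure_ge0 nu3 D')).
pose XV w := (X w, V w).
have := @measure_unique_rectangles R _ _ S1 S2 (pushforward (mrestr P mVD) XV)
  (mscale r (pushforward P XV)).
move=> /(_ mXV mXV) h.
have rE : (r%:num%:E)%E = nu3 D' by rewrite /r /= fineK.
have /= := h _ _ E mE; rewrite /mscale rE /pushforward /mrestr /= [in X in _ -> X]muleC; apply.
  move=> A B mA mB; rewrite -[RHS]/(nu3 D' * P (XV @^-1` (A `*` B)))%E.
  have -> : XV @^-1` (A `*` B) = X @^-1` A `&` V @^-1` B by [].
  rewrite ind//; have := ind mA mB measurableT.
  rewrite preimage_setT setIT => ->.
  by rewrite (probability_setT nu3) mule1 muleC.
apply: (@le_lt_trans _ _ 1%E); last exact: ltry.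
by apply: probability_le1; rewrite preimage_setT setTI.
Qed.

End independent_pair.

Section flow_measurability.
Context {R : realType} {V : completeNormedModType R} {k : nat}
  {d : measure_display} {S : measurableType d}.
Variables (L : 'I_k -> V -> V) (C : R) (q : nat -> V).
Hypotheses (C0 : 0 <= C) (LC : forall i, bounded_by (L i) C) (dq : dense_seq q).

Lemma flow_measurable s (w : S -> 'rV[R]_k) (z : S -> V) :
  (forall i, measurable_fun setT (fun x => w x 0 i)) -> open_measurable_fun z ->
  open_measurable_fun (fun x => flow L s (w x) (z x)).
Proof.
move=> mw mz.
have mexponent (f : S -> V) : open_measurable_fun f ->
    open_measurable_fun (fun x => exponent L s (w x) (f x)).
  move=> mf; have cL i : continuous (L i) by exact: (bounded_by_continuous (LC i)).
  apply: (omf_sum dq) => i; apply: (omfD dq).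
    by apply: (omfZ dq); [exact: mw|exact: (omf_comp mf (cL i))].
  rewrite (_ : (fun x => _) = (fun x => (- (s / 2)) *: L i (L i (f x)))); last first.
    by apply/funext => x; rewrite scaleNr.
  apply: (omfZ dq); first exact: measurable_cst.
  exact: (omf_comp (omf_comp mf (cL i)) (cL i)).
have miter n : open_measurable_fun (fun x => iter n (exponent L s (w x)) (z x)).
  by elim: n => [|n IH]; [exact: mz|exact: mexponent].
apply: (@omf_lim _ _ _ _ (fun n x => series (exp_terms (exponent L s (w x)) (z x)) n)).
  move=> n; rewrite (_ : (fun x => _) = (fun x =>
      \sum_(i <- index_iota 0 n) (i`!%:R)^-1 *: iter i (exponent L s (w x)) (z x)))//.
  apply: (omf_sum dq) => i; apply: (omfZ dq); first exact: measurable_cst.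
  exact: miter.
move=> x; apply: exp_op_cvg (exponent_bound_ge0 C0 s (w x)) _.
exact: exponent_bounded.
Qed.

End flow_measurability.

Section brownian_increments.
Context {R : realType} {d : measure_display} {Omega : measurableType d}.
Variables (P : probability Omega R) (T : R) (F : R -> set (set Omega)).
Hypothesis hF : normal_filtration P T F.
Variables (k : nat) (W : R -> Omega -> 'rV[R]_k).
Hypothesis hW : standard_brownian_motion P T F W.

(** Omega is given the sigma-algebra generated by F s, so that the closure properties above apply;
    by [filtrationE] this adds no set to F s. *)
Definition adapted s (E : topologicalType) (f : Omega -> E) :=
  @open_measurable_fun _ (g_sigma_algebraType (F s)) E f.

Lemma filtrationE s A : 0 <= s <= T ->
  measurable (A : set (g_sigma_algebraType (F s))) <-> F s A.
Proof.
by move=> sT; have [/(_ s sT)[/sigma_algebra_id FE _] _ _ _] := hF; rewrite -[X in _ <-> X A]FE.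
Qed.

Lemma adapted_mono s t (E : topologicalType) (f : Omega -> E) :
  0 <= s -> s <= t -> t <= T -> adapted s f -> adapted t f.
Proof.
move=> s0 st tT mf U oU; apply/filtrationE; first by rewrite (le_trans s0).
have [_ Fst _ _] := hF; apply: (Fst s t s0 st tT); apply/filtrationE; last exact: mf.
by rewrite s0 (le_trans st).
Qed.

Lemma adapted_omf s (E : topologicalType) (f : Omega -> E) :
  0 <= s <= T -> adapted s f -> open_measurable_fun f.
Proof.
move=> sT mf U oU; have [/(_ s sT)[_ Fm] _ _ _] := hF.
by apply: Fm; apply/filtrationE => //; exact: mf.
Qed.

Lemma adapted_real s (f : Omega -> R) : adapted s (f : Omega -> R^o) <->
  @measurable_fun _ _ (g_sigma_algebraType (F s)) R setT f.
Proof. exact: omf_real. Qed.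

Lemma brownian_adapted s i : 0 <= s <= T -> adapted s (fun w => W s w 0 i : R^o).
Proof.
move=> sT U oU; apply/filtrationE => //; have [_ mW _] := hW.
by apply: (mW s i sT); exact: sub_sigma_algebra.
Qed.

Section increment.
Variables (s t : R).
Hypotheses (s0 : 0 <= s) (st : s < t) (tT : t <= T).
Local Notation x i := (fun w => W t w 0 i - W s w 0 i).
Local Notation sd := (Num.sqrt (t - s)).
Local Notation nu := (normal_prob 0 sd : probability (measurableTypeR R) R).

Let sT : 0 <= s <= T. Proof. by rewrite s0 (le_trans (ltW st)). Qed.
Let tT' : 0 <= t <= T. Proof. by rewrite (le_trans s0 (ltW st)). Qed.
Let D0 : 0 < t - s. Proof. by rewrite subr_gt0. Qed.
Let sd0 : 0 < sd. Proof. by rewrite sqrtr_gt0. Qed.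
Let sd2 : sd ^+ 2 = t - s. Proof. by rewrite sqr_sqrtr// ltW. Qed.

Lemma increment_adapted i : adapted t (x i : Omega -> R^o).
Proof.
apply/adapted_real; apply: measurable_funB; apply/adapted_real.
  exact: brownian_adapted.
apply: (adapted_mono s0 (ltW st)) => //; exact: brownian_adapted.
Qed.

Lemma increment_measurable i : measurable_fun setT (x i).
Proof. by apply/omf_real; apply: (adapted_omf tT'); exact: increment_adapted. Qed.

Lemma increment_pair_law i j (G : set Omega) (D D' : set R) : i != j -> F s G ->
  measurable D -> measurable D' ->
  P (G `&` x i @^-1` D `&` x j @^-1` D') = (P G * nu D * nu D')%E.
Proof.
move=> ij FG mD mD'; have [_ _ /(_ s t s0 st tT G)] := hW.
move=> /(_ (fun l => if l == i then D else if l == j then D' else setT) FG) h.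
have {}h := h ltac:(by move=> l; case: ifP => // _; case: ifP).
rewrite (bigD1 i)//= eqxx (bigD1 j)/= ?(eq_sym j i)// (negPf ij) eqxx in h.
rewrite big1 ?mule1 ?muleA in h; last first.
  by move=> l /andP[/negPf -> /negPf ->]; exact: (probability_setT nu).
rewrite -h -setIA; congr (P (G `&` _)); apply/seteqP; split => [w /= [wD wD'] l|w /= hw].
  by case: eqP => [->//|_]; case: eqP => [->|].
have := hw i; have := hw j; rewrite !eqxx eq_sym (negPf ij).
by split.
Qed.

Lemma increment_law i (G : set Omega) (D : set R) : F s G -> measurable D ->
  P (G `&` x i @^-1` D) = (P G * nu D)%E.
Proof.
move=> FG mD; have [_ _ /(_ s t s0 st tT G)] := hW.
move=> /(_ (fun l => if l == i then D else setT) FG) h.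
have {}h := h ltac:(by move=> l; case: ifP).
rewrite (bigD1 i)//= eqxx big1 ?mule1 in h; last first.
  by move=> l /negPf ->; exact: (probability_setT nu).
rewrite -h; congr (P (G `&` _)); apply/seteqP; split => [w /= wD l|w /= hw].
  by case: eqP => [->|].
by have := hw i; rewrite eqxx.
Qed.

Lemma increment_expect i (f : R -> R) : rint nu f ->
  rint P (f \o x i) /\ expect P (f \o x i) = expect nu f.
Proof.
move=> rf; have mf := rint_measurable rf.
have FT : F s setT.
  by apply/filtrationE => //; exact: measurableT.
pose m' := pushforward P (x i : Omega -> measurableTypeR R).
have m'E A : measurable A -> m' A = nu A.
  move=> mA; have := increment_law i FT mA.
  by rewrite setTI (probability_setT P) mul1e.
have mEf : measurable_fun setT (EFin \o f) by apply/measurable_EFinP.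
have rP : rint P (f \o x i).
  apply/integrableP; split.
    by apply/measurable_EFinP; apply: (measurableT_comp mf); exact: increment_measurable.
  move/integrableP : rf => [_].
  suff -> : (\int[nu]_y `|(EFin \o f) y| = \int[P]_w `|(EFin \o (f \o x i)) w|)%E by [].
  transitivity (\int[m']_y `|(EFin \o f) y|)%E.
    apply: eq_measure_integral; first exact: increment_measurable.
    by move=> mx A mA _; exact: esym (m'E A mA).
  rewrite /m' ge0_integral_pushforward//.
  - exact: increment_measurable.
  - exact: measurableT_comp.
split=> //; rewrite /expect /Rintegral; congr fine.
transitivity (\int[m']_y (f y)%:E)%E.
  exact: (esym (@integral_pushforward _ _ _ (measurableTypeR R) _ _ (increment_measurable i)
    P setT (EFin \o f) mEf rP measurableT)).
apply: eq_measure_integral; first exact: increment_measurable.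
by move=> mx A mA _; exact: m'E.
Qed.

Definition quad_noise i j w : R := x i w * x j w - (i == j)%:R * (t - s).

Lemma quad_noise_adapted i j : adapted t (quad_noise i j : Omega -> R^o).
Proof.
apply/adapted_real; apply: measurable_funB => //.
by apply: measurable_funM; apply/adapted_real; exact: increment_adapted.
Qed.

Lemma quad_noise_measurable i j : measurable_fun setT (quad_noise i j).
Proof. by apply/omf_real; apply: (adapted_omf tT'); exact: quad_noise_adapted. Qed.

Lemma increment_sqr i : rint P (fun w => x i w ^+ 2) /\
  expect P (fun w => x i w ^+ 2) = t - s.
Proof.
have [h1 h2] := increment_expect i (rint_pow sd0 2).
by split=> //; rewrite -[RHS]sd2 -(expect_sqr sd0).
Qed.

Lemma increment_pow4 i : rint P (fun w => x i w ^+ 4) /\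
  expect P (fun w => x i w ^+ 4) <= 1024 * (t - s) ^+ 2.
Proof.
have [h1 h2] := increment_expect i (rint_pow sd0 4).
split=> //; rewrite (_ : (t - s) ^+ 2 = sd ^+ 4); last by rewrite (exprM sd 2 2) sd2.
by rewrite -[leLHS]/(expect P ((fun y => y ^+ 4) \o x i)) h2; exact: (expect_pow4 sd0).
Qed.

Lemma quad_noise_sqr i j : rint P (fun w => quad_noise i j w ^+ 2) /\
  expect P (fun w => quad_noise i j w ^+ 2) <= 2050 * (t - s) ^+ 2.
Proof.
have [ri Ei] := increment_pow4 i; have [rj Ej] := increment_pow4 j.
pose g w := x i w ^+ 4 + x j w ^+ 4 + 2%:R * (t - s) ^+ 2.
have rij : rint P (fun w => x i w ^+ 4 + x j w ^+ 4) by exact: rintD.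
have rg : rint P g by apply: rintD => //; exact: rint_cst.
(* (a b - D)^2 <= a^4 + b^4 + 2 D^2, which explains 2050 = 2 * 1024 + 2. *)
have qg w : quad_noise i j w ^+ 2 <= g w.
  rewrite /quad_noise /g; set a := x i w; set b := x j w; set D := t - s.
  case: (i == j); rewrite ?mul1r ?mul0r ?subr0.
    by have := sqr_ge0 (a * b + D); have := sqr_ge0 (a ^+ 2 - b ^+ 2); nra.
  by have := sqr_ge0 D; have := sqr_ge0 (a ^+ 2 - b ^+ 2); nra.
have rq : rint P (fun w => quad_noise i j w ^+ 2).
  apply: (@rint_le _ _ _ P _ g) => //.
    by apply: measurable_funX; exact: quad_noise_measurable.
  by move=> w; rewrite ger0_norm ?sqr_ge0.
split=> //; rewrite (le_trans (le_expect rq rg qg))//.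
rewrite /g expectD ?expectD//; last exact: rint_cst.
by rewrite expect_cst; lra.
Qed.

Lemma quad_noise_mean0 i j (xi : Omega -> R) : adapted s (xi : Omega -> R^o) ->
  rint P (fun w => xi w * quad_noise i j w) ->
  expect P (fun w => xi w * quad_noise i j w) = 0.
Proof.
move=> /adapted_real axi rxi.
have mxi : measurable_fun setT (xi : Omega -> measurableTypeR R).
  by apply/omf_real; apply: (adapted_omf sT); apply/adapted_real.
have Fxi A : measurable A -> F s (xi @^-1` A).
  by move=> mA; apply/filtrationE => //; have := axi measurableT A mA; rewrite setTI.
have [ij|ij] := eqVneq i j.
  subst j; pose g (y : R) := y ^+ 2 - (t - s).
  have rg : rint nu g by apply: rintB; [exact: (rint_pow sd0 2)|exact: rint_cst].
  have E0 : expect nu g = 0.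
    rewrite expectB; [|exact: (rint_pow sd0 2)|exact: rint_cst].
    by rewrite (expect_sqr sd0) expect_cst sd2 subrr.
  have qE : (fun w => xi w * quad_noise i i w) = (fun w => id (xi w) * g (x i w)).
    by apply/funext => w; rewrite /quad_noise eqxx mul1r /g expr2.
  rewrite qE in rxi *.
  have mi : measurable_fun setT (x i : Omega -> measurableTypeR R) by exact: increment_measurable.
  have ind (A : set (measurableTypeR R)) (D : set (measurableTypeR R)) :
      measurable A -> measurable D ->
      P (xi @^-1` A `&` x i @^-1` D) = (P (xi @^-1` A) * nu D)%E.
    by move=> mA mD; apply: increment_law => //; exact: Fxi.
  exact: (expect_indep_mean0 mxi mi ind (f := id) (g := g)).
(* Off the diagonal, xi and the i-th increment form one variable independent of the j-th increment,
   whose mean vanishes; on the diagonal the variance was used instead. *)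
have qE : (fun w => xi w * quad_noise i j w) =
    (fun w => (fun p : measurableTypeR R * measurableTypeR R => p.1 * p.2 : R) (xi w, x i w) * id (x j w)).
  by apply/funext => w; rewrite /quad_noise (negPf ij) mul0r subr0 /= mulrA.
rewrite qE in rxi *.
have mi : measurable_fun setT (x i : Omega -> measurableTypeR R) by exact: increment_measurable.
have mj : measurable_fun setT (x j : Omega -> measurableTypeR R) by exact: increment_measurable.
have mp : measurable_fun setT
    (fun w => (xi w, x i w) : measurableTypeR R * measurableTypeR R).
  exact: measurable_fun_pair.
have ind (A : set (measurableTypeR R * measurableTypeR R)) (D : set (measurableTypeR R)) :
    measurable A -> measurable D ->
    P ((fun w => (xi w, x i w)) @^-1` A `&` x j @^-1` D) =
    (P ((fun w => (xi w, x i w)) @^-1` A) * nu D)%E.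
  move=> mA mD; apply: (@indep_pairl _ _ _ _ _ _ _ _ _ P nu nu xi (x i) (x j)) => //.
  by move=> B D1 D2 mB mD1 mD2; apply: increment_pair_law => //; exact: Fxi.
apply: (expect_indep_mean0 mp mj ind
  (f := fun p : measurableTypeR R * measurableTypeR R => p.1 * p.2 : R) (g := id)) => //.
- by apply: measurable_funM; [exact: measurable_fst|exact: measurable_snd].
- exact: (rint_pow sd0 1).
- exact: (expect_id sd0).
Qed.

End increment.

(** * Second moments of the quadratic noise sums *)

Section quadratic_martingale.
Context {H : completeNormedModType R} (ip : {dot H for @idfun R}).
Hypothesis hip : induces_norm ip.
Variables (q : nat -> H).
Hypothesis dq : dense_seq q.
Variables (tau : nat -> R) (D K : R) (U : nat -> Omega -> H) (i j : 'I_k) (n : nat).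
Hypotheses (tau0 : 0 <= tau 0%N) (D0 : 0 < D) (tauS : forall m, (m < n)%N -> tau m.+1 - tau m = D)
  (tauT : forall m, (m <= n)%N -> 0 <= tau m <= T) (K0 : 0 <= K).
Hypotheses (aU : forall m, (m < n)%N -> adapted (tau m) (U m))
  (UK : forall m w, (m < n)%N -> `|U m w| <= K).
Local Notation Q m := (quad_noise (tau m) (tau m.+1) i j).

Definition quad_martingale m w : H := \sum_(l < m) Q l w *: U l w.

(** In the expansion of |M + Q U|^2 the cross term is Q times <M, U>, which is known at the left end
    point, so its expectation vanishes and second moments add up. With D = t / n the total is of
    order 1 / n. *)
Lemma quad_martingale_bound m : (m <= n)%N ->
  [/\ adapted (tau m) (quad_martingale m), rint P (fun w => `|quad_martingale m w| ^+ 2)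
    & expect P (fun w => `|quad_martingale m w| ^+ 2) <= m%:R * (2050 * D ^+ 2 * K ^+ 2)].
Proof.
elim: m => [_|m IH mn].
  have -> : quad_martingale 0 = fun=> 0 by apply/funext => w; rewrite /quad_martingale big_ord0.
  split; first exact: omf_cst.
    by rewrite normr0 expr0n; exact: rint_cst.
  by rewrite normr0 expr0n expect_cst mul0r.
have [aS rS ES] := IH (ltnW mn).
have tm := tauT (ltnW mn); have tm1 := tauT mn.
have tlt : tau m < tau m.+1 by rewrite -subr_gt0 tauS.
have SE : quad_martingale m.+1 = fun w => quad_martingale m w + Q m w *: U m w.
  by apply/funext => w; rewrite /quad_martingale big_ord_recr.
have [tm0 tmT] := andP tm; have [tm10 tm1T] := andP tm1.
have [rQ EQ] := quad_noise_sqr tm0 tlt tm1T i j; rewrite tauS// in EQ.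
have mono (E : topologicalType) (f : Omega -> E) := @adapted_mono (tau m) (tau m.+1) E f tm0 (ltW tlt) tm1T.
have aQ := quad_noise_adapted tm0 tlt tm1T i j.
have aS1 : adapted (tau m.+1) (quad_martingale m.+1).
  rewrite SE; apply: (omfD dq); first exact: mono.
  apply: (omfZ dq); first by apply/adapted_real.
  by apply: mono; exact: aU.
pose xi w := ip (quad_martingale m w) (U m w).
have axi : adapted (tau m) (xi : Omega -> R^o).
  (* Polarization reduces the measurability of an inner product to that of norms. *)
  have xiE : xi = fun w => 4^-1 * (`|quad_martingale m w + U m w| ^+ 2 -
      `|quad_martingale m w - U m w| ^+ 2).
    by apply/funext => w; rewrite /xi (normD2 hip) (normB2 hip); field.
  rewrite xiE; apply/adapted_real; apply: measurable_funM => //.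
  apply: measurable_funB; apply: measurable_funX; apply: omf_norm.
    by apply: (omfD dq) => //; exact: aU.
  apply: (omfD dq) => //.
  rewrite (_ : (fun w => _) = (fun w => (-1) *: U m w)); last first.
    by apply/funext => w; rewrite scaleN1r.
  by apply: (omfZ dq); [exact: measurable_cst|exact: aU].
have mQ := quad_noise_measurable tm0 tlt tm1T i j.
have mxi : measurable_fun setT xi.
  by apply/omf_real; apply: (adapted_omf tm).
have rxiQ : rint P (fun w => xi w * Q m w).
  apply: (@rint_le _ _ _ P _ (fun w => `|quad_martingale m w| ^+ 2 + K ^+ 2 * Q m w ^+ 2)).
  - exact: measurable_funM.
  - move=> w; have h1 := ip_CS hip (quad_martingale m w) (U m w).
    have h2 := UK w mn; rewrite normrM.
    have h3 : `|xi w| <= `|quad_martingale m w| * K.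
      by rewrite (le_trans h1)// ler_wpM2l.
    rewrite -[Q m w ^+ 2]real_normK ?num_real//.
    have h4 : `|xi w| * `|Q m w| <= `|quad_martingale m w| * K * `|Q m w| by rewrite ler_wpM2r.
    rewrite (le_trans h4)//.
    have := sqr_ge0 (`|quad_martingale m w| - K * `|Q m w|).
    have := sqr_ge0 (`|quad_martingale m w|).
    have := sqr_ge0 (K * `|Q m w|); nra.
  - by apply: rintD => //; exact: rintZ.
have E0 := quad_noise_mean0 tm0 tlt tm1T axi rxiQ.
have rQU : rint P (fun w => Q m w ^+ 2 * `|U m w| ^+ 2).
  apply: (@rint_le _ _ _ P _ (fun w => K ^+ 2 * Q m w ^+ 2)); last exact: rintZ.
    apply: measurable_funM; apply: measurable_funX => //.
    by apply: omf_norm; apply: (adapted_omf tm); exact: aU.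
  move=> w; have q0 : 0 <= Q m w ^+ 2 * `|U m w| ^+ 2.
    by apply: mulr_ge0; exact: sqr_ge0.
  rewrite (ger0_norm q0) mulrC; apply: ler_wpM2r; first exact: sqr_ge0.
  by rewrite lerXn2r ?nnegrE// UK.
have NE : (fun w => `|quad_martingale m.+1 w| ^+ 2) =
    (fun w => `|quad_martingale m w| ^+ 2 + 2%:R * (xi w * Q m w) + Q m w ^+ 2 * `|U m w| ^+ 2).
  apply/funext => w; rewrite SE (normD2 hip) ipZr normrZ exprMn real_normK ?num_real//.
  by rewrite /xi; ring.
have r2 : rint P (fun w => 2%:R * (xi w * Q m w)) by exact: rintZ.
have r12 : rint P (fun w => `|quad_martingale m w| ^+ 2 + 2%:R * (xi w * Q m w)) by exact: rintD.
split=> //; rewrite NE; first exact: rintD.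
rewrite expectD// expectD// expectZ// E0 mulr0 addr0.
have EU : expect P (fun w => Q m w ^+ 2 * `|U m w| ^+ 2) <= 2050 * D ^+ 2 * K ^+ 2.
  apply: (@le_trans _ _ (expect P (fun w => K ^+ 2 * Q m w ^+ 2))).
    apply: (le_expect rQU (rintZ (K ^+ 2) rQ)) => w /=.
    rewrite mulrC; apply: ler_wpM2r; first exact: sqr_ge0.
    by rewrite lerXn2r ?nnegrE// UK.
  by rewrite expectZ// mulrC; apply: ler_wpM2r; first exact: sqr_ge0.
rewrite -[m.+1%:R]natr1 [leRHS]mulrDl mul1r.
exact: lerD.
Qed.

End quadratic_martingale.
End brownian_increments.

(** * Convergence in probability *)

Lemma within_itv_uniform {R : realType} (E : normedModType R) (f : R -> E) (T e : R) :
  {within `[0, T], continuous f} -> 0 < e -> exists2 d : R, 0 < d &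
    forall s t, 0 <= s <= T -> 0 <= t <= T -> `|s - t| < d -> `|f s - f t| < e.
Proof.
move=> /within_itv_continuousP cf e0.
have e2 : 0 < e / 2 by rewrite divr_gt0.
have := @segment_compact R 0 T => /compact_near_coveringP.
move=> /(_ R (nbhs (0 : R)) (fun d x => 0 <= x <= T -> forall t, 0 <= t <= T ->
  `|x - t| < d -> `|f x - f t| < e) _) h.
have {h} : \forall d \near nbhs (0 : R), `[0, T]%classic `<=` (fun x => 0 <= x <= T ->
    forall t, 0 <= t <= T -> `|x - t| < d -> `|f x - f t| < e).
  apply: h => x /=; rewrite in_itv/= => xT.
  have [d d0 hd] := cf x xT _ e2.
  have d2 : 0 < d / 2 by rewrite divr_gt0.
  exists (ball x (d / 2), ball (0 : R) (d / 2)); first by split; exact: nbhsx_ballx.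
  move=> [y r] [/= xy r0] yT t tT yt.
  rewrite -ball_normE/= in xy; rewrite -ball_normE/= sub0r normrN in r0.
  have h1 : `|f x - f y| < e / 2 by apply: hd => //; lra.
  have h2 : `|f x - f t| < e / 2.
    apply: hd => //; rewrite -(subrKA y) (le_lt_trans (ler_normD _ _))//.
    have := ler_norm r; lra.
  rewrite -(subrKA (f x)) (le_lt_trans (ler_normD _ _))// distrC; lra.
move=> /nbhs_normP[d d0 hd]; exists (d / 2); first by rewrite divr_gt0.
move=> s t sT tT st; apply: (hd (d / 2)) => //.
rewrite /= sub0r normrN gtr0_norm ?divr_gt0//.
by rewrite ltr_pdivrMr// mulr_natr mulr2n ltrDl.
Qed.

Lemma within_itv_bounded {R : realType} (E : normedModType R) (f : R -> E) (T : R) :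
  {within `[0, T], continuous f} -> exists M, forall s, 0 <= s <= T -> `|f s| <= M.
Proof.
move=> cf; have [T0|T0] := leP 0 T; last first.
  by exists 0 => s /andP[s0 sT]; have := le_trans s0 sT; rewrite leNgt T0.
have cnf : {within `[0, T], continuous (fun s => `|f s| : R)}.
  apply/within_itv_continuousP => s sT e e0.
  have [d d0 hd] := (within_itv_continuousP f T).1 cf s sT e e0.
  exists d => // t tT st; exact: le_lt_trans (ler_dist_dist _ _) (hd t tT st).
have [c _ hc] := EVT_max T0 cnf.
by exists `|f c| => s sT; apply: hc; rewrite in_itv.
Qed.

Section convergence_in_probability.
Context {R : realType} {d : measure_display} {Omega : measurableType d}.
Variable P : probability Omega R.

Definition outside_small (e eta : R) (f : Omega -> R) :=
  exists B, [/\ measurable B, (P B <= eta%:E)%E & forall w, ~ B w -> f w < e].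

(* Convergence to 0 in outer probability, so that [f n] need not be measurable. *)
Definition cvg_outer (f : nat -> Omega -> R) := forall e eta, 0 < e -> 0 < eta ->
  exists N, forall n, (N <= n)%N -> outside_small e eta (f n).

Lemma prob_setU (A B : set Omega) a b : measurable A -> measurable B ->
  (P A <= a%:E)%E -> (P B <= b%:E)%E -> (P (A `|` B) <= (a + b)%:E)%E.
Proof.
move=> mA mB PA PB; rewrite (le_trans (measureU2 _ mA mB))// EFinD.
exact: leeD.
Qed.

(** Continuity of P from above along the unions of the tails, which decrease to the empty set. *)
Lemma eventually_notin (E : nat -> set Omega) : (forall n, measurable (E n)) ->
  (forall w, exists N, forall n, (N <= n)%N -> ~ E n w) ->
  forall eta, 0 < eta -> exists N, forall n, (N <= n)%N -> (P (E n) <= eta%:E)%E.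
Proof.
move=> mE Ew eta eta0.
pose D n := \bigcup_(i in [set i | (n <= i)%N]) E i.
have mD n : measurable (D n) by exact: bigcup_measurable.
have D0 : \bigcap_n D n = set0.
  apply/seteqP; split=> // w Dw; have [N hN] := Ew w.
  by have [i /= Ni Ei] := Dw N I; exact: (hN i Ni Ei).
have : P (D n) @[n --> \oo] --> P (\bigcap_n D n).
  apply: nonincreasing_cvg_mu => //.
  - by rewrite (le_lt_trans (probability_le1 P (mD 0%N)))// ltry.
  - by rewrite D0.
  - move=> m n mn; apply/subsetPset => w [i /= ni Ei]; exists i => //=.
    exact: leq_trans ni.
rewrite D0 measure0 => /fine_cvgP[_ /cvgrPdist_lt/(_ eta eta0)[N _ hN]].
exists N => n Nn; have := hN n Nn; rewrite /= sub0r normrN => h.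
apply: (@le_trans _ _ (P (D n))).
  apply: le_measure; [exact: mem_set|exact: mem_set|move=> w Ew'].
  by exists n => /=.
rewrite -(fineK (fin_num_measure P _ (mD n))) lee_fin.
by rewrite (le_trans (ler_norm _))// ltW.
Qed.

Lemma cvg_outer_prob (f : nat -> Omega -> \bar R) (g : nat -> Omega -> R) :
  (forall n, measurable_fun setT (f n)) ->
  cvg_outer g -> (forall n w, (f n w <= (g n w)%:E)%E) ->
  cvg_in_probability0 P f.
Proof.
move=> mf cg fg; split=> // e e0.
have mE n : measurable [set w | (e%:E <= f n w)%E].
  rewrite -[X in measurable X]setTI.
  by apply: emeasurable_fun_c_infty.
apply/fine_cvgP; split.
  by near=> n; rewrite fin_num_measure.
apply/cvgrPdist_lt => eta eta0.
have eta2 : 0 < eta / 2 by rewrite divr_gt0.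
have [N hN] := cg e _ e0 eta2; exists N => // n Nn /=.
rewrite sub0r normrN ger0_norm ?fine_ge0//.
have [B [mB PB hB]] := hN n Nn.
rewrite -lte_fin fineK ?fin_num_measure//.
apply: (@le_lt_trans _ _ (P B)).
  apply: le_measure; [exact: mem_set|exact: mem_set|move=> w /= ef].
  apply: contrapT => nB.
  by have := hB w nB; rewrite -lte_fin ltNge (le_trans ef).
rewrite (le_lt_trans PB)// lte_fin; lra.
Unshelve. all: by end_near.
Qed.

Lemma cvg_outer_le (f g : nat -> Omega -> R) : (forall n w, f n w <= g n w) ->
  cvg_outer g -> cvg_outer f.
Proof.
move=> fg cg e eta e0 eta0; have [N hN] := cg e eta e0 eta0.
exists N => n Nn; have [B [mB PB hB]] := hN n Nn; exists B; split=> // w nB.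
exact: le_lt_trans (fg n w) (hB w nB).
Qed.

Lemma cvg_outerD (f g : nat -> Omega -> R) : cvg_outer f -> cvg_outer g ->
  cvg_outer (fun n w => f n w + g n w).
Proof.
move=> cf cg e eta e0 eta0.
have e2 : 0 < e / 2 by rewrite divr_gt0.
have eta2 : 0 < eta / 2 by rewrite divr_gt0.
have [N hN] := cf _ _ e2 eta2; have [M hM] := cg _ _ e2 eta2.
exists (maxn N M) => n; rewrite geq_max => /andP[Nn Mn].
have [B [mB PB hB]] := hN n Nn; have [D [mD PD hD]] := hM n Mn.
exists (B `|` D); split; first exact: measurableU.
  by rewrite (splitr eta); exact: prob_setU.
move=> w /not_orP[nB nD]; rewrite (splitr e).
by apply: ltrD; [exact: hB|exact: hD].
Qed.

Lemma cvg_outer0 : cvg_outer (fun _ _ => 0).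
Proof.
move=> e eta e0 eta0; exists 0%N => n _; exists set0; split=> //.
by rewrite measure0 lee_fin ltW.
Qed.

Lemma cvg_outer_sum (I : Type) (s : seq I) (f : I -> nat -> Omega -> R) :
  (forall i, cvg_outer (f i)) -> cvg_outer (fun n w => \sum_(i <- s) f i n w).
Proof.
move=> cf; elim: s => [|i s IH].
  by apply: cvg_outer_le cvg_outer0 => n w; rewrite big_nil.
apply: cvg_outer_le (cvg_outerD (cf i) IH) => n w.
by rewrite big_cons.
Qed.

Lemma cvg_outerZ c (f : nat -> Omega -> R) : 0 <= c -> cvg_outer f ->
  cvg_outer (fun n w => c * f n w).
Proof.
move=> c0 cf e eta e0 eta0.
have c1 : 0 < c + 1 by rewrite ltr_wpDl.
have [N hN] := cf _ _ (divr_gt0 e0 c1) eta0.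
exists N => n Nn; have [B [mB PB hB]] := hN n Nn; exists B; split=> // w nB.
have h := ltW (hB w nB).
apply: (@le_lt_trans _ _ (c * (e / (c + 1)))); first by rewrite ler_wpM2l.
by rewrite mulrA ltr_pdivrMr// mulrC ltr_pM2l// ltrDl.
Qed.

(** Localization: outside a set of small probability f may be replaced by a truncated version that
    has moments. *)
Lemma cvg_outer_local (f : nat -> Omega -> R) :
  (forall eta, 0 < eta -> exists A g, [/\ measurable A, (P (~` A) <= eta%:E)%E,
     cvg_outer g & forall n w, A w -> f n w <= g n w]) -> cvg_outer f.
Proof.
move=> H e eta e0 eta0.
have eta2 : 0 < eta / 2 by rewrite divr_gt0.
have [A [g [mA PA cg fg]]] := H _ eta2.
have [N hN] := cg _ _ e0 eta2; exists N => n Nn.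
have [B [mB PB hB]] := hN n Nn; exists (B `|` ~` A); split.
- by apply: measurableU => //; exact: measurableC.
- by rewrite (splitr eta); apply: prob_setU => //; exact: measurableC.
- move=> w /not_orP[nB /contrapT Aw].
  exact: le_lt_trans (fg n w Aw) (hB w nB).
Qed.

Lemma cvg_outer_expect (f : nat -> Omega -> R) : (forall n w, 0 <= f n w) ->
  (forall rho, 0 < rho -> exists N, forall n, (N <= n)%N -> exists g,
     [/\ forall w, f n w <= g w, rint P g & expect P g <= rho]) -> cvg_outer f.
Proof.
move=> f0 H e eta e0 eta0.
have [N hN] := H _ (mulr_gt0 e0 eta0); exists N => n Nn.
have [g [fg rg Eg]] := hN n Nn.
have g0 w : 0 <= g w by exact: le_trans (f0 n w) (fg w).
exists [set w | e <= g w]; split.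
- by rewrite -[X in measurable X]setTI; apply: measurable_fun_le => //; exact: rint_measurable rg.
- rewrite (le_trans (markov_le g0 rg e0))// lee_fin ler_pdivrMr// mulrC//.
- by move=> w /negP; rewrite -ltNge; exact: le_lt_trans (fg w).
Qed.

End convergence_in_probability.

Lemma omf_borel {R : realType} {d : measure_display} {S : measurableType d}
    (E : topologicalType) (f : S -> E) :
  open_measurable_fun f -> borel_measurable_wrt measurable f.
Proof.
move=> mf U; apply: (@smallest_sub _ _ _ [set U | measurable (f @^-1` U)]) => //.
split=> /=.
- by rewrite preimage_set0.
- by move=> A mA; rewrite setTD preimage_setC; exact: measurableC.
- by move=> A mA; rewrite preimage_bigcup; exact: bigcupT_measurable.
Qed.

Section square_integral.
Context {R : realType} {d : measure_display} {Omega : measurableType d}.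
Context {H : normedModType R} {k : nat}.
Variables (t : R) (Psi : R -> Omega -> 'rV[R]_k -> H).
Hypothesis mPsi : forall l, open_measurable_fun (fun p : measurableTypeR R * Omega =>
  if 0 < p.1 <= t then Psi p.1 p.2 (delta_mx 0 l) else 0).

Let G (p : measurableTypeR R * Omega) : R :=
  \sum_(l < k) `|if 0 < p.1 <= t then Psi p.1 p.2 (delta_mx 0 l) else 0| ^+ 2.

Let mG : measurable_fun setT G.
Proof.
apply: measurable_sum => l; apply: measurable_funX.
exact: omf_norm.
Qed.

Let GE s w : G (s, w) = if 0 < s <= t then HSnorm2 (Psi s w) else 0.
Proof.
rewrite /G /HSnorm2 /=; case: ifP => // _.
by rewrite big1// => l _; rewrite normr0 expr0n.
Qed.

Lemma sq_integralE w : sq_integral t Psi w = (\int[lebesgue_measure]_s (G (s, w))%:E)%E.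
Proof.
rewrite /sq_integral integral_mkcond; apply: eq_integral => s _.
rewrite GE /patch mem_setE in_itv/=; by case: ifP.
Qed.

Lemma measurable_sq_integral : measurable_fun setT (sq_integral t Psi).
Proof.
rewrite (_ : sq_integral t Psi = fubini_G (@lebesgue_measure R) (EFin \o G)).
  apply: measurable_fun_fubini_tonelli_G; first by apply/measurable_EFinP.
  by move=> p; rewrite lee_fin sumr_ge0// => l _; exact: sqr_ge0.
by apply/funext => w; rewrite sq_integralE.
Qed.

Lemma sq_integral_le w M : 0 <= t -> (forall s, 0 < s <= t -> HSnorm2 (Psi s w) <= M) ->
  (sq_integral t Psi w <= (M * t)%:E)%E.
Proof.
move=> t0 hM.
have m1 : measurable_fun setT (fun s : measurableTypeR R => G (s, w)).
  by apply: (measurableT_comp mG); exact: pair2_measurable.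
apply: (@le_trans _ _ (\int[lebesgue_measure]_(s in `]0%R, t]) M%:E)%E).
  apply: ge0_le_integral => //.
  - by move=> s _; rewrite lee_fin sumr_ge0// => l _; exact: sqr_ge0.
  - apply/measurable_EFinP.
    apply: (@eq_measurable_fun _ _ _ _ _ (fun s => G (s, w))).
      by move=> s /set_mem; rewrite /= in_itv/= => st; rewrite GE st.
    by apply: measurable_funTS; exact: m1.
rewrite integral_cst//= lebesgue_measure_itv/= lte_fin.
case: ifPn => t1; first by rewrite oppr0 adde0.
rewrite mule0 lee_fin; have -> : t = 0 by apply/eqP; rewrite eq_le t0 leNgt t1.
by rewrite mulr0.
Qed.

End square_integral.

(** * Expansion of the flow along a grid *)

Lemma cvg_finsum {R : realType} (E : normedModType R) (X I : Type) (F : set_system X)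
    (FF : Filter F) (s : seq I) (f : I -> X -> E) (l : I -> E) :
  (forall i, f i @ F --> l i) ->
  (fun x => \sum_(i <- s) f i x) @ F --> \sum_(i <- s) l i.
Proof.
move=> fl; elim: s => [|i s IH].
  rewrite big_nil (_ : (fun _ => _) = fun=> 0); first exact: cvg_cst.
  by apply/funext => x; rewrite big_nil.
rewrite big_cons (_ : (fun _ => _) = fun x => f i x + \sum_(i <- s) f i x).
  exact: cvgD.
by apply/funext => x; rewrite big_cons.
Qed.

Lemma sum_pow_le {R : realType} k p (a : 'I_k -> R) : (0 < p)%N -> (forall i, 0 <= a i) ->
  (\sum_i a i) ^+ p <= k%:R ^+ p * \sum_i a i ^+ p.
Proof.
move=> p0 a0; case: k a a0 => [|k] a a0.
  by rewrite !big_ord0 expr0n gtn_eqF// mulr0.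
have [i _ hi] := @arg_maxP _ _ _ (@ord0 k) xpredT a isT.
apply: (@le_trans _ _ ((k.+1%:R * a i) ^+ p)).
  rewrite lerXn2r ?nnegrE ?sumr_ge0 ?mulr_ge0//.
  apply: (@le_trans _ _ (\sum_(j < k.+1) a i)); first by apply: ler_sum => j _; exact: hi.
  by rewrite sumr_const card_ord mulr_natl.
rewrite exprMn ler_wpM2l ?exprn_ge0// (bigD1 i)//= lerDl sumr_ge0// => j _.
by rewrite exprn_ge0.
Qed.

Section flow_paths.
Context {R : realType} {V : completeNormedModType R} {k : nat}.
Variables (L : 'I_k -> V -> V) (C : R).
Hypotheses (C0 : 0 <= C) (LC : forall i, bounded_by (L i) C)
  (LL : forall i j v, L i (L j v) = L j (L i v)).

(** The vector moves too, because X_t is the flow applied to e^(tA) xi. An increment is split into a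
    change of the vector under a fixed flow and a change of the flow at a fixed vector. *)
Lemma flow_path_continuous T (w : R -> 'rV[R]_k) (v : R -> V) :
  (forall i, {within `[0, T], continuous (fun s => w s 0 i : R)}) ->
  {within `[0, T], continuous v} ->
  {within `[0, T], continuous (fun s => flow L s (w s) (v s))}.
Proof.
move=> cw cv; apply/subspace_continuousP => s sT.
set FF := within _ _.
have hw i : (fun r => w r 0 i : R) @ FF --> (w s 0 i : R).
  by have /subspace_continuousP/(_ s sT) := cw i.
have hv : v @ FF --> v s by have /subspace_continuousP/(_ s sT) := cv.
have hid : (fun r : R => r) @ FF --> s by apply: cvg_within_filter; exact: cvg_id.
pose b1 r := exponent_bound (k := k) C r (w r).
pose b2 r := exponent_bound (k := k) C (r - s) (w r - w s).
have hb1 : b1 @ FF --> b1 s.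
  apply: cvgD.
    apply: cvgM; first exact: cvg_cst.
    by apply: cvg_finsum => i; apply: (@cvg_norm _ R^o); exact: hw.
  apply: cvgM; last exact: cvg_cst.
  apply: cvgM; first exact: cvg_cst.
  by apply: (@cvg_norm _ R^o).
have hb2 : b2 @ FF --> (0 : R).
  have -> : (0 : R) = C * (\sum_(i < k) `|w s 0 i - w s 0 i|) + k%:R * C ^+ 2 * `|s - s| / 2.
    by rewrite big1 ?mulr0 ?subrr ?normr0 ?mulr0 ?mul0r ?addr0// => i _; rewrite subrr normr0.
  apply: cvgD.
    apply: cvgM; first exact: cvg_cst.
    apply: cvg_finsum => i; apply: (@cvg_norm _ R^o).
    rewrite (_ : (fun r => _) = (fun r => w r 0 i - w s 0 i)); last first.
      by apply/funext => r; rewrite !mxE.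
    by apply: (@cvgB _ R^o); [exact: hw|exact: cvg_cst].
  apply: cvgM; last exact: cvg_cst.
  apply: cvgM; first exact: cvg_cst.
  by apply: (@cvg_norm _ R^o); apply: (@cvgB _ R^o) => //; exact: cvg_cst.
have hexp (b : R -> R) (l : R) : b @ FF --> l -> (fun r => expR (b r)) @ FF --> expR l.
  by move=> h; apply: (cvg_comp b expR) h _; exact: continuous_expR.
pose g r := expR (b1 r) * `|v r - v s| + b2 r * expR (b2 r) * `|flow L s (w s) (v s)|.
have hg : g @ FF --> (0 : R).
  have -> : (0 : R) = expR (b1 s) * `|v s - v s| + 0 * expR 0 * `|flow L s (w s) (v s)|.
    by rewrite subrr normr0 mulr0 mul0r mul0r addr0.
  apply: cvgD.
    apply: cvgM; first exact: hexp.
    by apply: cvg_norm; apply: cvgB => //; exact: cvg_cst.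
  apply: cvgM; last exact: cvg_cst.
  by apply: cvgM => //; exact: hexp.
apply/cvgrPdist_lt => e e0.
have /cvgrPdist_lt/(_ e e0) := hg; apply: filterS => r.
rewrite sub0r normrN => /(le_lt_trans (ler_norm _)); apply: le_lt_trans.
rewrite distrC (_ : flow L r (w r) (v r) - flow L s (w s) (v s) =
  flow L r (w r) (v r - v s) + (flow L r (w r) (v s) - flow L s (w s) (v s))); last first.
  by rewrite (linB _ _ (flow_linear C0 LC r (w r))) addrA subrK.
rewrite (le_trans (ler_normD _ _))// lerD//; first exact: (flow_norm C0 LC).
exact: (flow_dist C0 LC LL).
Qed.

End flow_paths.

Section ito.
Context {R : realType} {H : completeNormedModType R} (ip : {dot H for @idfun R}).
Hypothesis hip : induces_norm ip.
Variables (q : nat -> H).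
Hypothesis dq : dense_seq q.
Context {d : measure_display} {Omega : measurableType d}.
Variables (P : probability Omega R) (T : R) (F : R -> set (set Omega)).
Hypothesis hF : normal_filtration P T F.
Variables (k : nat) (W : R -> Omega -> 'rV[R]_k).
Hypothesis hW : standard_brownian_motion P T F W.
Hypothesis hWc : forall omega (i : 'I_k),
  {within `[0, T], continuous (fun t => W t omega 0 i : R)}.
Variables (L : 'I_k -> H -> H) (C : R).
Hypotheses (C0 : 0 <= C) (LC : forall i, bounded_by (L i) C)
  (LL : forall i j v, L i (L j v) = L j (L i v)).
Variable (z : Omega -> H).
Hypothesis az : adapted F 0 z.

Definition ito_flow s w := flow L s (W s w) (z w).
Local Notation Y := ito_flow.

Lemma ito_flow_adapted s : 0 <= s <= T -> adapted F s (Y s).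
Proof.
move=> sT; have /andP[s0 sT'] := sT.
apply: (@flow_measurable _ _ _ _ (g_sigma_algebraType (F s)) L C q C0 LC dq).
  by move=> i; apply/adapted_real; exact: (brownian_adapted hF hW).
exact: (adapted_mono hF (lexx 0) s0 sT').
Qed.

Lemma ito_flow_continuous w : {within `[0, T], continuous (fun s => Y s w)}.
Proof.
apply: (flow_path_continuous C0 LC LL (T := T) (w := fun s => W s w) (v := fun=> z w)) => //.
by apply: continuous_subspaceT => s; exact: cvg_cst.
Qed.

Variable t : R.
Hypotheses (t0 : 0 < t) (tT : t <= T).

Definition grid n m : R := t * m%:R / n%:R.
Local Notation tau := grid.

Lemma grid0 n : tau n 0 = 0. Proof. by rewrite /grid mulr0 mul0r. Qed.

Lemma grid_max n : tau n.+1 n.+1 = t.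
Proof. by rewrite /grid mulfK. Qed.

Lemma grid_step n m : tau n.+1 m.+1 - tau n.+1 m = t / n.+1%:R.
Proof. by rewrite /grid -mulrBl -mulrBr -natrB// subSnn mulr1. Qed.

Lemma step_gt0 n : 0 < t / n.+1%:R.
Proof. by rewrite divr_gt0. Qed.

Lemma grid_bound n m : (m <= n.+1)%N -> 0 <= tau n.+1 m <= t.
Proof.
move=> mn; rewrite /grid divr_ge0 ?mulr_ge0 ?(ltW t0)//=.
by rewrite ler_pdivrMr// ler_wpM2l ?(ltW t0)// ler_nat.
Qed.

Lemma grid_boundT n m : (m <= n.+1)%N -> 0 <= tau n.+1 m <= T.
Proof. by move=> /grid_bound/andP[-> h] /=; exact: le_trans tT. Qed.

Lemma grid_lt n m : tau n.+1 m < tau n.+1 m.+1.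
Proof. by rewrite -subr_gt0 grid_step step_gt0. Qed.

Definition dW n m w i : R := W (tau n.+1 m.+1) w 0 i - W (tau n.+1 m) w 0 i.

Let xx n m w : R := C * \sum_(i < k) `|dW n m w i|.
Let yy n : R := k%:R * C ^+ 2 * (t / n.+1%:R) / 2.

(** The error bound of [flow_taylor] summed over the grid, without its exponential factor and the
    norm of the state; those are bounded on the localizing event and reappear as constants in
    [ito_error]. *)
Definition taylor_remainder n w : R := \sum_(m < n.+1)
  (xx n m w * yy n + yy n ^+ 2 / 2 + (xx n m w + yy n) ^+ 3).

Let xx0 n m w : 0 <= xx n m w.
Proof. by rewrite mulr_ge0// sumr_ge0. Qed.

Let yy0 n : 0 <= yy n.
Proof. by rewrite divr_ge0// !mulr_ge0 ?exprn_ge0// ltW// step_gt0. Qed.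

Let dW_moments n m i : (m < n.+1)%N ->
  [/\ rint P (fun w => dW n m w i ^+ 2), rint P (fun w => dW n m w i ^+ 4),
   expect P (fun w => dW n m w i ^+ 2) = t / n.+1%:R &
   expect P (fun w => dW n m w i ^+ 4) <= 1024 * (t / n.+1%:R) ^+ 2].
Proof.
move=> mn; have /andP[m0 _] := grid_boundT (ltnW mn).
have /andP[_ m1T] := grid_boundT mn.
have [r2 E2] := increment_sqr hF hW m0 (grid_lt n m) m1T i.
have [r4 E4] := increment_pow4 hF hW m0 (grid_lt n m) m1T i.
by rewrite grid_step in E2 E4; split.
Qed.

Lemma rint_sum (I : Type) (s : seq I) (f : I -> Omega -> R) :
  (forall i, rint P (f i)) -> rint P (fun w => \sum_(i <- s) f i w) /\
  expect P (fun w => \sum_(i <- s) f i w) = \sum_(i <- s) expect P (f i).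
Proof.
move=> rf; elim: s => [|i s [rs Es]].
  have -> : (fun w => \sum_(i <- [::]) f i w) = fun=> 0.
    by apply/funext => w; rewrite big_nil.
  by rewrite big_nil expect_cst; split=> //; exact: rint_cst.
have -> : (fun w => \sum_(i <- i :: s) f i w) = fun w => f i w + \sum_(i <- s) f i w.
  by apply/funext => w; rewrite big_cons.
by rewrite big_cons expectD// Es; split=> //; exact: rintD.
Qed.

Let xx_measurable n m : (m < n.+1)%N -> measurable_fun setT (xx n m).
Proof.
move=> mn; have /andP[m0 _] := grid_boundT (ltnW mn).
have /andP[_ m1T] := grid_boundT mn.
apply: measurable_funM => //; apply: measurable_sum => i.
apply: measurableT_comp => //.
exact: (increment_measurable hF hW m0 (grid_lt n m) m1T).
Qed.

Let xx_moment p n m M : (0 < p)%N -> ~~ odd p -> (m < n.+1)%N ->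
  (forall i, rint P (fun w => dW n m w i ^+ p)) ->
  (forall i, expect P (fun w => dW n m w i ^+ p) <= M) ->
  rint P (fun w => xx n m w ^+ p) /\
  expect P (fun w => xx n m w ^+ p) <= C ^+ p * k%:R ^+ p * (k%:R * M).
Proof.
move=> p0 ep mn rd Ed.
have [rs Es] := @rint_sum _ (index_enum 'I_k) (fun i w => dW n m w i ^+ p) rd.
pose g w := C ^+ p * k%:R ^+ p * \sum_(i < k) dW n m w i ^+ p.
have rg : rint P g by exact: rintZ.
have xg w : xx n m w ^+ p <= g w.
  rewrite /xx exprMn /g -mulrA ler_wpM2l ?exprn_ge0//.
  rewrite (le_trans (sum_pow_le p0 _))// ler_wpM2l ?exprn_ge0//.
  apply: ler_sum => i _; rewrite -normrX ger0_norm// exprn_even_ge0//.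
have rx : rint P (fun w => xx n m w ^+ p).
  apply: (rint_le (g := g)) => // [|w]; last by rewrite ger0_norm// exprn_ge0.
  by apply: measurable_funX; exact: xx_measurable.
split=> //; rewrite (le_trans (le_expect rx rg xg))// /g expectZ// Es.
rewrite ler_wpM2l ?mulr_ge0 ?exprn_ge0//.
apply: (@le_trans _ _ (\sum_(i < k) M)); first by apply: ler_sum => i _; exact: Ed.
by rewrite sumr_const card_ord mulr_natl.
Qed.

(* AM-GM with a parameter [th] turns the odd powers into the moments of order 2 and 4. *)
Let remainder_term_le (x y th psi : R) : 0 <= x -> 0 <= y -> 0 < psi -> th * psi = 1 ->
  x * y + y ^+ 2 / 2 + (x + y) ^+ 3 <=
  3 * th * x ^+ 2 + 8 * psi * x ^+ 4 +
  (psi * y ^+ 2 + y ^+ 2 / 2 + 2 * th * y ^+ 2 + 8 * psi * y ^+ 4).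
Proof.
move=> x0 y0 psi0 tp; have th0 : 0 < th.
  by rewrite -(pmulr_lgt0 _ psi0) tp.
have h1 : x * y <= th * x ^+ 2 + psi * y ^+ 2.
  have : 0 <= psi * (th * x - y) ^+ 2 by rewrite mulr_ge0 ?sqr_ge0// ltW.
  have -> : psi * (th * x - y) ^+ 2 =
      (th * psi) * th * x ^+ 2 - 2 * (th * psi) * (x * y) + psi * y ^+ 2 by ring.
  rewrite tp; have := mulr_ge0 x0 y0; lra.
pose u := x + y.
have h2 : u ^+ 3 <= th * u ^+ 2 + psi * u ^+ 4.
  have : 0 <= psi * u ^+ 2 * ((th - u / 2) ^+ 2 + 3 / 4 * u ^+ 2).
    apply: mulr_ge0; first by apply: mulr_ge0; [exact: ltW|exact: sqr_ge0].
    apply: addr_ge0; first exact: sqr_ge0.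
    by apply: mulr_ge0; [exact: divr_ge0|exact: sqr_ge0].
  have -> : psi * u ^+ 2 * ((th - u / 2) ^+ 2 + 3 / 4 * u ^+ 2) =
      (th * psi) * th * u ^+ 2 - (th * psi) * u ^+ 3 + psi * u ^+ 4 by field.
  rewrite tp; lra.
have h3 : u ^+ 2 <= 2 * x ^+ 2 + 2 * y ^+ 2.
  have := sqr_ge0 (x - y); rewrite /u; have -> : (x + y) ^+ 2 = 2 * x ^+ 2 + 2 * y ^+ 2 - (x - y) ^+ 2 by ring.
  lra.
have h4 : u ^+ 4 <= 8 * x ^+ 4 + 8 * y ^+ 4.
  have h5 : u ^+ 4 <= (2 * x ^+ 2 + 2 * y ^+ 2) ^+ 2.
    rewrite -[u ^+ 4]/(u ^+ (2 * 2)) exprM lerXn2r ?nnegrE ?sqr_ge0//.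
    by rewrite addr_ge0 ?mulr_ge0 ?sqr_ge0.
  rewrite (le_trans h5)//; have := sqr_ge0 (x ^+ 2 - y ^+ 2).
  have -> : (2 * x ^+ 2 + 2 * y ^+ 2) ^+ 2 =
    8 * x ^+ 4 + 8 * y ^+ 4 - 4 * (x ^+ 2 - y ^+ 2) ^+ 2 by ring.
  lra.
have h6 := ler_wpM2l (ltW th0) h3; have h7 := ler_wpM2l (ltW psi0) h4.
rewrite -/u; lra.
Qed.

Lemma nat_bound (x : R) : exists N : nat, forall n, (N <= n)%N -> x <= n.+1%:R.
Proof.
exists (Num.bound `|x|) => n Nn; rewrite (le_trans (ler_norm x))// ltW//.
by rewrite (lt_le_trans (archi_boundP (normr_ge0 x)))// ler_nat leqW.
Qed.

(** In each step the term with th x^2 has mean of order th / n and all others of order 1 / n^2.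
    Summation gives a multiple of th plus a term of order 1 / n: th is fixed small before n
    grows. *)
Lemma taylor_remainder_cvg : cvg_outer P taylor_remainder.
Proof.
apply: cvg_outer_expect => [n w|rho rho0].
  apply: sumr_ge0 => m _.
  apply: addr_ge0; last by apply: exprn_ge0; exact: addr_ge0.
  by apply: addr_ge0; [exact: mulr_ge0|exact: divr_ge0 (sqr_ge0 _) (ler0n _ 2)].
pose A2 := C ^+ 2 * k%:R ^+ 2 * (k%:R * t).
pose A4 := C ^+ 4 * k%:R ^+ 4 * (k%:R * (1024 * t ^+ 2)).
have A20 : 0 <= A2 by rewrite !mulr_ge0 ?exprn_ge0// ltW.
(* The factor 6 brings 3 * th * A2 below rho / 2; psi may be large, but it only multiplies terms
   that vanish as n grows. *)
pose th := rho / (6 * (A2 + 1)); pose psi := th^-1.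
have th0 : 0 < th by rewrite divr_gt0// mulr_gt0// ltr_wpDl.
have psi0 : 0 < psi by rewrite invr_gt0.
have tp : th * psi = 1 by rewrite mulfV// gt_eqF.
pose y1 := k%:R * C ^+ 2 * t / 2.
have y10 : 0 <= y1 by rewrite divr_ge0// !mulr_ge0 ?exprn_ge0// ltW.
pose ct := psi * y1 ^+ 2 + y1 ^+ 2 / 2 + 2 * th * y1 ^+ 2 + 8 * psi * y1 ^+ 4.
have [N hN] := nat_bound ((8 * psi * A4 + ct) / (rho / 2)).
exists N => n Nn.
have n0 : 0 < n.+1%:R :> R by [].
have tn0 : 0 <= t / n.+1%:R by rewrite ltW// step_gt0.
pose f (m : 'I_n.+1) w := 3 * th * xx n m w ^+ 2 + 8 * psi * xx n m w ^+ 4 + ct / n.+1%:R ^+ 2.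
have m2 (m : 'I_n.+1) : rint P (fun w => xx n m w ^+ 2) /\
    expect P (fun w => xx n m w ^+ 2) <= A2 / n.+1%:R.
  have -> : A2 / n.+1%:R = C ^+ 2 * k%:R ^+ 2 * (k%:R * (t / n.+1%:R)).
    by rewrite /A2 !mulrA.
  by apply: xx_moment => // i; have [r2 _ E2 _] := @dW_moments n m i (ltn_ord m); rewrite ?E2.
have m4 (m : 'I_n.+1) : rint P (fun w => xx n m w ^+ 4) /\
    expect P (fun w => xx n m w ^+ 4) <= A4 / n.+1%:R ^+ 2.
  have -> : A4 / n.+1%:R ^+ 2 = C ^+ 4 * k%:R ^+ 4 * (k%:R * (1024 * (t / n.+1%:R) ^+ 2)).
    by rewrite /A4 exprMn exprVn !mulrA.
  by apply: xx_moment => // i; have [_ r4 _ E4] := @dW_moments n m i (ltn_ord m).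
have rf (m : 'I_n.+1) : rint P (f m) /\ expect P (f m) <=
    3 * th * (A2 / n.+1%:R) + 8 * psi * (A4 / n.+1%:R ^+ 2) + ct / n.+1%:R ^+ 2.
  have [r2 E2] := m2 m; have [r4 E4] := m4 m.
  have r2' : rint P (fun w => 3 * th * xx n m w ^+ 2) by exact: rintZ.
  have r4' : rint P (fun w => 8 * psi * xx n m w ^+ 4) by exact: rintZ.
  have r24 : rint P (fun w => 3 * th * xx n m w ^+ 2 + 8 * psi * xx n m w ^+ 4) by exact: rintD.
  have rc : rint P (fun=> ct / n.+1%:R ^+ 2) by exact: rint_cst.
  split; first exact: rintD.
  rewrite /f (expectD r24 rc) expect_cst lerD2r (expectD r2' r4') !expectZ//.
  apply: lerD; apply: ler_wpM2l => //; apply: mulr_ge0; try exact: ltW; exact: ler0n.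
have [rs Es] := @rint_sum _ (index_enum 'I_n.+1) f (fun m => (rf m).1).
exists (fun w => \sum_(m < n.+1) f m w); split=> //.
  move=> w; apply: ler_sum => m _.
  have yE : yy n = y1 / n.+1%:R by rewrite /yy /y1 mulrA mulrAC.
  have hterm := remainder_term_le (xx0 n m w) (yy0 n) psi0 tp.
  rewrite (le_trans hterm)// /f lerD2l.
  have y2 : yy n ^+ 2 = y1 ^+ 2 / n.+1%:R ^+ 2 by rewrite yE exprMn exprVn.
  have y4 : yy n ^+ 4 <= y1 ^+ 4 / n.+1%:R ^+ 2.
    rewrite yE exprMn exprVn ler_wpM2l ?exprn_ge0// lef_pV2 ?posrE ?exprn_gt0//.
    by rewrite ler_weXn2l// ler1n.
  have p8 : 0 <= 8 * psi by apply: mulr_ge0; [exact: ler0n|exact: ltW].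
  have y4' := ler_wpM2l p8 y4.
  rewrite /ct y2; move: y4'; clearbody psi th.
  move: (y1 ^+ 2) (y1 ^+ 4) (yy n ^+ 4) (n.+1%:R ^+ 2)^-1 => a b c e h.
  suff -> : (psi * a + a / 2 + 2 * th * a + 8 * psi * b) * e = psi * (a * e) + a * e / 2 +
    2 * th * (a * e) + 8 * psi * (b * e) by rewrite lerD2l.
  by field.
rewrite Es (le_trans (ler_sum _ (fun m _ => (rf m).2)))//.
rewrite sumr_const card_ord -[leLHS]mulr_natl.
have -> : n.+1%:R * (3 * th * (A2 / n.+1%:R) + 8 * psi * (A4 / n.+1%:R ^+ 2) + ct / n.+1%:R ^+ 2)
    = 3 * th * A2 + (8 * psi * A4 + ct) / n.+1%:R.
  by move: (n.+1%:R : R) (gt_eqF n0) => c /negbT cz; field.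
have h1 : 3 * th * A2 <= rho / 2.
  have -> : 3 * th * A2 = rho / 2 * (A2 / (A2 + 1)).
    by rewrite /th; field; rewrite gt_eqF// ltr_wpDl.
  rewrite ler_piMr ?divr_ge0 ?(ltW rho0)// ler_pdivrMr ?ltr_wpDl//.
  by rewrite mul1r lerDl.
have h2 : (8 * psi * A4 + ct) / n.+1%:R <= rho / 2.
  have := hN n Nn; rewrite !ler_pdivrMr// ?divr_gt0//.
  by rewrite [leRHS]mulrC.
by rewrite (splitr rho) lerD.
Qed.

(** The condition concerns time s alone and is F_s-measurable, so its indicator can be put in front
    of a single summand without spoiling the martingale property. *)
Definition bounded_state K s w := (`|z w| <= K) && [forall i : 'I_k, `|W s w 0 i| <= K].

Definition quad_integrand K n i j m w : H :=
  if bounded_state K (tau n.+1 m) w then L i (L j (Y (tau n.+1 m) w)) else 0.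

Definition flow_bound K := expR (C * (k%:R * K) + k%:R * C ^+ 2 * T / 2) * K.

Lemma bounded_state_flow K s w : 0 <= K -> 0 <= s <= T -> bounded_state K s w -> `|Y s w| <= flow_bound K.
Proof.
move=> K0 /andP[s0 sT] /andP[zK /forallP WK].
rewrite (le_trans (flow_norm C0 LC s (W s w) (z w)))// ler_pM ?expR_ge0//.
rewrite ler_expR /exponent_bound lerD//.
  rewrite ler_wpM2l// (le_trans (ler_sum _ (fun i _ => WK i)))//.
  by rewrite sumr_const card_ord mulr_natl.
rewrite ler_wpM2r ?invr_ge0// ler_wpM2l ?mulr_ge0 ?exprn_ge0// ger0_norm//.
Qed.

Lemma bounded_state_measurable K s : 0 <= s <= T ->
  measurable ([set w | bounded_state K s w] : set (g_sigma_algebraType (F s))).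
Proof.
move=> sT; have /andP[s0 sT'] := sT.
rewrite (_ : [set w | _] = [set w | (`|z w| <= K)%R] `&`
    \bigcap_(i in [set: 'I_k]) [set w | (`|W s w 0 i| <= K)%R]).
  apply: measurableI.
    have mz : measurable_fun setT ((fun w => `|z w|) : g_sigma_algebraType (F s) -> R).
      by apply: omf_norm; exact: (adapted_mono hF (lexx 0) s0 sT').
    rewrite -[X in measurable X]setTI.
    exact: (measurable_fun_le measurableT mz (measurable_cst K)).
  apply: fin_bigcap_measurable => // i _.
  have mw : measurable_fun setT ((fun w => `|W s w 0 i|) : g_sigma_algebraType (F s) -> R).
    apply: measurableT_comp => //; apply/adapted_real; exact: (brownian_adapted hF hW).
  rewrite -[X in measurable X]setTI.
  exact: (measurable_fun_le measurableT mw (measurable_cst K)).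
apply/seteqP; split=> [w /andP[zK /forallP WK]|w [zK WK]].
  by split=> // i _; exact: WK.
by apply/andP; split=> //; apply/forallP => i; exact: WK.
Qed.

(** The n + 1 orthogonal summands have second moments of order (t / (n + 1))^2, so the sum tends to
    0 in mean square. *)
Lemma quad_martingale_cvg K i j : 0 <= K -> cvg_outer P (fun n w =>
  `|quad_martingale W (tau n.+1) (quad_integrand K n i j) i j n.+1 w|).
Proof.
move=> K0.
pose K' := C * (C * flow_bound K).
have fb0 : 0 <= flow_bound K by rewrite mulr_ge0// expR_ge0.
have K'0 : 0 <= K' by rewrite !mulr_ge0.
have qb n : rint P (fun w => `|quad_martingale W (tau n.+1) (quad_integrand K n i j) i j n.+1 w| ^+ 2) /\
    expect P (fun w => `|quad_martingale W (tau n.+1) (quad_integrand K n i j) i j n.+1 w| ^+ 2) <=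
    2050 * t ^+ 2 * K' ^+ 2 / n.+1%:R.
  have [|||||_ r E] := @quad_martingale_bound _ _ _ P T F hF k W hW H ip hip q dq (tau n.+1)
    (t / n.+1%:R) K' (quad_integrand K n i j) i j n.+1 (step_gt0 n) _ _ _ _ _ n.+1 (leqnn _).
  - by move=> m mn; exact: grid_step.
  - by move=> m mn; exact: grid_boundT.
  - exact: K'0.
  - move=> m mn; have mT := grid_boundT (ltnW mn).
    apply: omf_if; first exact: bounded_state_measurable.
      apply: omf_comp (bounded_by_continuous (LC i)).
      by apply: omf_comp (bounded_by_continuous (LC j)); exact: ito_flow_adapted.
    exact: omf_cst.
  - move=> m w mn; rewrite /quad_integrand; case: ifPn => [g|_]; last by rewrite normr0.
    have fb := bounded_state_flow K0 (grid_boundT (ltnW mn)) g.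
    rewrite (le_trans ((LC i).2 _))// ler_wpM2l// (le_trans ((LC j).2 _))//.
    by rewrite ler_wpM2l.
  split=> //; rewrite (le_trans E)// le_eqVlt; apply/orP; left; apply/eqP.
  by have := pnatr_eq0 R n.+1; move: (n.+1%:R : R) => c /= /negbT cz; field.
have sq : cvg_outer P (fun n w =>
    `|quad_martingale W (tau n.+1) (quad_integrand K n i j) i j n.+1 w| ^+ 2).
  apply: cvg_outer_expect => [n w|rho rho0]; first exact: sqr_ge0.
  have [N hN] := nat_bound (2050 * t ^+ 2 * K' ^+ 2 / rho).
  exists N => n Nn; have [r E] := qb n.
  exists (fun w => `|quad_martingale W (tau n.+1) (quad_integrand K n i j) i j n.+1 w| ^+ 2).
  split=> //; rewrite (le_trans E)// ler_pdivrMr// [leRHS]mulrC -ler_pdivrMr//.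
  exact: hN.
move=> e eta e0 eta0; have e2 : 0 < e ^+ 2 by rewrite exprn_gt0.
have [N hN] := sq _ _ e2 eta0; exists N => n Nn.
have [B [mB PB hB]] := hN n Nn; exists B; split=> // w nB.
by rewrite -(@ltr_pXn2r _ 2) ?nnegrE ?(ltW e0)//; exact: hB.
Qed.

End ito.

(** * Elementary approximations *)

Section off_exceptional_sets.
Context {R : realType} {d : measure_display} {Omega : measurableType d}.
Variable P : probability Omega R.

(** The bounds 1/(n + 1) on P (B n) are not summable, so a fixed w may return to these sets for
    ever. Pointwise smallness is therefore asked only for the n with w outside B n, and P (B n) is
    added at the end. *)
Lemma cvg_probability_off (f : nat -> Omega -> \bar R) (B : nat -> set Omega) :
  (forall n, measurable_fun setT (f n)) -> (forall n, measurable (B n)) ->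
  (forall n, (P (B n) <= (n.+1%:R^-1)%:E)%E) ->
  (forall w e, 0 < e -> exists N, forall n, (N <= n)%N -> ~ B n w -> (f n w < e%:E)%E) ->
  cvg_in_probability0 P f.
Proof.
move=> mf mB PB fw; split=> // e e0.
have mE n : measurable [set w | (e%:E <= f n w)%E].
  rewrite -[X in measurable X]setTI.
  by apply: emeasurable_fun_c_infty.
apply/fine_cvgP; split.
  by near=> n; rewrite fin_num_measure.
apply/cvgrPdist_lt => eta eta0.
have eta3 : 0 < eta / 3 by rewrite divr_gt0.
have mEB n : measurable ([set w | (e%:E <= f n w)%E] `\` B n) by exact: measurableD.
have [|N hN] := @eventually_notin _ _ _ P _ mEB _ _ eta3.
  move=> w; have [N hN] := fw w e e0; exists N => n Nn [/= ef nB].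
  by have := hN n Nn nB; rewrite ltNge ef.
have [M hM] := nat_bound (eta / 3)^-1.
exists (maxn N M) => // n /=; rewrite geq_max => /andP[Nn Mn].
rewrite sub0r normrN ger0_norm ?fine_ge0//.
rewrite -lte_fin fineK ?fin_num_measure//.
have h1 := hN n Nn; have h2 : (P (B n) <= (eta / 3)%:E)%E.
  by rewrite (le_trans (PB n))// lee_fin invf_ple ?posrE// hM.
apply: (@le_lt_trans _ _ (eta / 3 + eta / 3)%:E); last by rewrite lte_fin; lra.
apply: le_trans (prob_setU (mEB n) (mB n) h1 h2).
apply: le_measure; [exact: mem_set|by apply: mem_set; exact: measurableU|move=> w /= ef].
by have [Bw|nBw] := pselect (B n w); [right|left].
Unshelve. all: by end_near.
Qed.

Lemma outside_small_sum n (f : 'I_n.+1 -> Omega -> R) e eta :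
  (forall m, outside_small P e eta (f m)) ->
  outside_small P (n.+1%:R * e) (n.+1%:R * eta) (fun w => \sum_m f m w).
Proof.
elim: n f => [|n IH] f hf.
  have [B [mB PB hB]] := hf ord0; exists B; rewrite !mul1r; split=> // w nB.
  by rewrite big_ord1; exact: hB.
have [B [mB PB hB]] := IH (fun m => f (widen_ord (leqnSn _) m)) (fun m => hf _).
have [D [mD PD hD]] := hf ord_max.
exists (B `|` D); split; first exact: measurableU.
  by rewrite -(natr1 n.+1) mulrDl mul1r; exact: prob_setU.
move=> w /not_orP[nB nD]; rewrite big_ord_recr/= -(natr1 n.+1) mulrDl mul1r.
by apply: ltrD; [exact: hB|exact: hD].
Qed.

End off_exceptional_sets.

Section approximation.
Context {R : realType} {H : completeNormedModType R}.
Variables (q : nat -> H).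
Hypothesis dq : dense_seq q.
Context {d : measure_display} {Omega : measurableType d}.
Variables (P : probability Omega R) (T : R) (F : R -> set (set Omega)).
Hypothesis hF : normal_filtration P T F.

(** Arbitrary sets Q, because [elementary] asks for the level sets of operators built from V, that
    is, for preimages of fibres of [noise]. *)
Definition simple_wrt (G : set (set Omega)) (V : Omega -> H) :=
  finite_set (range V) /\ forall Q : set H, G (V @^-1` Q).

(** Rounding to the dense sequence gives countably many values; the indices from N on, which occur
    with probability at most e, are all redirected to index 0. *)
Lemma simple_approximation s (f : Omega -> H) e : 0 <= s <= T -> adapted F s f -> 0 < e ->
  exists2 V, simple_wrt (F s) V & outside_small P e e (fun w => `|f w - V w|).
Proof.
move=> sT af e0.
have [kap [mk hk]] := dense_index dq e0 af.
have Fk Q : F s (kap @^-1` Q) by apply/(filtrationE hF _ sT); exact: mk.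
have mk' Q : measurable (kap @^-1` Q : set Omega).
  by have [h _ _ _] := hF; exact: ((h s sT).2 _ (Fk Q)).
have [||N hN] := @eventually_notin _ _ _ P (fun n => [set w | (n <= kap w)%N]) _ _ e e0.
- by move=> n; exact: (mk' [set i | (n <= i)%N]).
- by move=> w; exists (kap w).+1 => n /= nk; rewrite leqNgt nk.
exists (fun w => q (if (kap w < N)%N then kap w else 0%N)).
  split.
    apply: (@sub_finite_set _ _ (q @` `I_N.+1)); last exact/finite_image/finite_II.
    move=> _ [w _ <-]; exists (if (kap w < N)%N then kap w else 0%N) => //=.
    by case: ifP => // h; rewrite ltnW// ltnS.
  by move=> Q; exact: (Fk [set i | Q (q (if (i < N)%N then i else 0%N))]).
exists [set w | (N <= kap w)%N]; split; first exact: (mk' [set i | (N <= i)%N]).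
  exact: hN.
by move=> w /negP; rewrite -ltnNge => ->.
Qed.

(** Tolerance (j + 1)^(-2) at each of the j + 1 left end points makes both the summed error and the
    total exceptional probability at most 1/(j + 1). *)
Lemma grid_approximation (Y : R -> Omega -> H) t : 0 < t -> t <= T ->
  (forall s, 0 <= s <= T -> adapted F s (Y s)) ->
  exists (V : nat -> nat -> Omega -> H) (B : nat -> set Omega),
   [/\ forall j m, (m < j.+1)%N -> simple_wrt (F (grid t j.+1 m)) (V j m),
     forall j, measurable (B j), forall j, (P (B j) <= (j.+1%:R^-1)%:E)%E &
     forall j w, ~ B j w ->
       \sum_(m < j.+1) `|Y (grid t j.+1 m) w - V j m w| < j.+1%:R^-1].
Proof.
move=> t0 tT aY.
have h jm : exists V, (jm.2 < jm.1.+1)%N -> simple_wrt (F (grid t jm.1.+1 jm.2)) V /\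
    outside_small P (jm.1.+1%:R ^+ 2)^-1 (jm.1.+1%:R ^+ 2)^-1
      (fun w => `|Y (grid t jm.1.+1 jm.2) w - V w|).
  case: jm => j m /=; have [mj|_] := boolP (m < j.+1)%N; last by exists (fun=> 0).
  have mT := grid_boundT t0 tT (ltnW mj).
  have e0 : 0 < (j.+1%:R ^+ 2)^-1 :> R by rewrite invr_gt0 exprn_gt0.
  have [V sV oV] := simple_approximation mT (aY _ mT) e0.
  by exists V.
have [V hV] := choice h.
have h2 j : exists B, [/\ measurable B, (P B <= (j.+1%:R^-1)%:E)%E &
    forall w, ~ B w -> \sum_(m < j.+1) `|Y (grid t j.+1 m) w - V (j, m : nat) w| < j.+1%:R^-1].
  have := @outside_small_sum _ _ _ P j (fun m w => `|Y (grid t j.+1 m) w - V (j, m : nat) w|)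
    (j.+1%:R ^+ 2)^-1 (j.+1%:R ^+ 2)^-1 (fun m => (hV (j, m : nat) (ltn_ord m)).2).
  have -> : j.+1%:R * (j.+1%:R ^+ 2)^-1 = j.+1%:R^-1 :> R.
    by have := pnatr_eq0 R j.+1; move: (j.+1%:R : R) => c /= /negbT cz; field.
  by [].
have [B hB] := choice h2.
exists (fun j m => V (j, m)), B; split=> [j m mj|j|j|j w]; last by have [_ _] := hB j; exact.
- exact: (hV (j, m) mj).1.
- by have [] := hB j.
- by have [] := hB j.
Qed.

End approximation.

(** * Pathwise error of the Riemann-Ito sums *)

Section ito_remainder.
Context {R : realType} {H : completeNormedModType R} (ip : {dot H for @idfun R}).
Hypothesis hip : induces_norm ip.
Variables (q : nat -> H).
Hypothesis dq : dense_seq q.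
Context {d : measure_display} {Omega : measurableType d}.
Variables (P : probability Omega R) (T : R) (F : R -> set (set Omega)).
Hypothesis hF : normal_filtration P T F.
Variables (k : nat) (W : R -> Omega -> 'rV[R]_k).
Hypothesis hW : standard_brownian_motion P T F W.
Hypothesis hWc : forall omega (i : 'I_k),
  {within `[0, T], continuous (fun t => W t omega 0 i : R)}.
Variables (L : 'I_k -> H -> H) (C : R).
Hypotheses (C0 : 0 <= C) (LC : forall i, bounded_by (L i) C)
  (LL : forall i j v, L i (L j v) = L j (L i v)).
Variable (z : Omega -> H).
Hypothesis az : adapted F 0 z.
Variable t : R.
Hypotheses (t0 : 0 < t) (tT : t <= T).
Local Notation Y := (ito_flow W L z).
Local Notation tau := (grid t).

(** Each path of W is bounded on [0, T], so every w lies in [G N] for all large N, and one K serves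
    all grids at once. The null set where W does not start at 0 is removed as well. *)
Lemma bounded_state_event eta : 0 < eta -> exists (K : R) (A : set Omega),
  [/\ 0 <= K, measurable A, (P (~` A) <= eta%:E)%E &
   forall w, A w -> W 0 w = 0 /\
     forall n m, (m <= n.+1)%N -> bounded_state W z K (tau n.+1 m) w].
Proof.
move=> eta0.
pose G (N : nat) := \bigcap_n \bigcap_(m in [set m | (m <= n.+1)%N])
  [set w | bounded_state W z N%:R (tau n.+1 m) w].
have mG N : measurable (G N).
  apply: bigcap_measurableType => n _; apply: bigcap_measurableType => m /= mn.
  have mT := grid_boundT t0 tT mn; have [h _ _ _] := hF.
  apply: (h _ mT).2; apply/(filtrationE hF _ mT).
  exact: (bounded_state_measurable hF hW az).
have [||N hN] := @eventually_notin _ _ _ P (fun N => ~` G N) _ _ _ eta0.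
- by move=> N; exact: measurableC.
- move=> w.
  have hM i : exists M, forall s, 0 <= s <= T -> `|W s w 0 i| <= M.
    by have [M hM] := @within_itv_bounded R R^o (fun s => W s w 0 i) T (@hWc w i); exists M.
  have [M hMw] := choice hM.
  have [N hN] := nat_bound (`|z w| + \sum_i `|M i|).
  exists N.+1 => -[|n]// Nn; apply; move=> p _ m /= mp.
  have mT := grid_boundT t0 tT mp.
  apply/andP; split.
    by rewrite (le_trans _ (hN _ Nn))// lerDl sumr_ge0.
  apply/forallP => i; rewrite (le_trans (hMw i _ mT))// (le_trans _ (hN _ Nn))//.
  rewrite (le_trans (ler_norm _))// (bigD1 i)//= addrCA lerDl addr_ge0// sumr_ge0//.
have [W0 _ _] := hW; have [N0 [mN0 PN0 hN0]] := W0.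
exists N%:R, (G N `\` N0); split=> //.
- by apply: measurableD.
- rewrite setCD -(addr0 eta); apply: prob_setU => //; first exact: measurableC.
    exact: hN.
  by rewrite PN0.
- move=> w [Gw nN0]; split; last by move=> n m mn; exact: (Gw n I m mn).
  by apply: contrapT => Ww; apply: nN0; exact: hN0.
Qed.

(** A bound for the exponent of one grid step: between two bounded states each coordinate of W moves
    by at most 2 K. *)
Let D K : R := C * (k%:R * (2 * K)) + k%:R * C ^+ 2 * T / 2.

(** U_t z - z telescopes along the grid. By the group law each difference is a flow over an
    increment minus the identity; the three bounds are its third-order remainder, the compensated
    quadratic noise, and the replacement of the state by V in the first-order term. *)
Lemma ito_error K n (V : nat -> H) w : 0 <= K -> W 0 w = 0 ->
  (forall m, (m <= n.+1)%N -> bounded_state W z K (tau n.+1 m) w) ->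
  `|Y t w - z w - \sum_(m < n.+1) \sum_(l < k) dW W t n m w l *: L l (V m)| <=
  expR (D K) * flow_bound T k C K * taylor_remainder W C t n w +
  2^-1 * (\sum_i \sum_j
    `|quad_martingale W (tau n.+1) (quad_integrand W L z t K n i j) i j n.+1 w|) +
  k%:R * (2 * K) * C * \sum_(m < n.+1) `|Y (tau n.+1 m) w - V m|.
Proof.
move=> K0 W0 gd.
have T0 : 0 <= T by rewrite ltW// (lt_le_trans t0).
have fb0 : 0 <= flow_bound T k C K by rewrite mulr_ge0// expR_ge0.
have dWK m l : (m < n.+1)%N -> `|dW W t n m w l| <= 2 * K.
  move=> mn; have /andP[_ /forallP/(_ l) h1] := gd _ mn.
  have /andP[_ /forallP/(_ l) h2] := gd _ (ltnW mn).
  by rewrite (le_trans (ler_normB _ _))// mulr_natl mulr2n lerD.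
pose e m : H := Y (tau n.+1 m.+1) w - Y (tau n.+1 m) w -
  \sum_l dW W t n m w l *: L l (Y (tau n.+1 m) w) -
  2^-1 *: \sum_i \sum_j quad_noise W (tau n.+1 m) (tau n.+1 m.+1) i j w *:
    L i (L j (Y (tau n.+1 m) w)).
pose x m := C * \sum_l `|dW W t n m w l|.
pose y := k%:R * C ^+ 2 * (t / n.+1%:R) / 2.
have eb m : (m < n.+1)%N -> `|e m| <= expR (D K) * flow_bound T k C K *
    (x m * y + y ^+ 2 / 2 + (x m + y) ^+ 3).
  move=> mn; have mT := grid_boundT t0 tT (ltnW mn).
  have st0 := step_gt0 t0 n.
  pose dw := W (tau n.+1 m.+1) w - W (tau n.+1 m) w.
  have dwE l : dw 0 l = dW W t n m w l by rewrite /dw !mxE.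
  have Y' : Y (tau n.+1 m.+1) w = flow L (t / n.+1%:R) dw (Y (tau n.+1 m) w).
    rewrite /ito_flow -(flowD C0 LC LL) -(grid_step t n m) /dw.
    by rewrite !subrK.
  have E1 : \sum_l dw 0 l *: L l (Y (tau n.+1 m) w) =
      \sum_l dW W t n m w l *: L l (Y (tau n.+1 m) w).
    by apply: eq_bigr => l _; rewrite dwE.
  have E2 : \sum_i \sum_j (dw 0 i * dw 0 j - (i == j)%:R * (t / n.+1%:R)) *:
      L i (L j (Y (tau n.+1 m) w)) = \sum_i \sum_j
      quad_noise W (tau n.+1 m) (tau n.+1 m.+1) i j w *: L i (L j (Y (tau n.+1 m) w)).
    apply: eq_bigr => i _; apply: eq_bigr => j _; rewrite !dwE.
    by rewrite /quad_noise grid_step.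
  have E3 : \sum_l `|dw 0 l| = \sum_l `|dW W t n m w l|.
    by apply: eq_bigr => l _; rewrite dwE.
  have := flow_taylor C0 LC dw (Y (tau n.+1 m) w) (ltW st0).
  rewrite -Y' E1 E2 E3.
  rewrite -/(x m) -/y => /le_trans; apply.
  have x0 : 0 <= x m by rewrite mulr_ge0// sumr_ge0.
  have y0 : 0 <= y by rewrite /y divr_ge0// !mulr_ge0 ?exprn_ge0// ltW.
  have xyD : x m + y <= D K.
    rewrite /D lerD//.
      rewrite ler_wpM2l// (le_trans (ler_sum _ (fun l _ => dWK m l mn)))//.
      by rewrite sumr_const card_ord -[leLHS]mulr_natl.
    rewrite ler_wpM2r ?invr_ge0// ler_wpM2l ?mulr_ge0 ?exprn_ge0//.
    rewrite (le_trans _ tT)// ler_pdivrMr// ler_peMr ?(ltW t0)//.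
    by rewrite ler1n.
  have hY := bounded_state_flow C0 LC K0 mT (gd _ (ltnW mn)).
  have D1 : 1 <= expR (D K) by rewrite -expR0 ler_expR (le_trans _ xyD)// addr_ge0.
  have h3 : (x m + y) ^+ 3 * expR (x m + y) <= (x m + y) ^+ 3 * expR (D K).
    by rewrite ler_wpM2l ?exprn_ge0 ?addr_ge0// ler_expR.
  have h4 : 0 <= x m * y + y ^+ 2 / 2.
    by apply: addr_ge0; apply: mulr_ge0 => //; exact: exprn_ge0.
  have h5 : x m * y + y ^+ 2 / 2 <= (x m * y + y ^+ 2 / 2) * expR (D K).
    by rewrite ler_peMr.
  rewrite [leRHS]mulrAC; apply: ler_pM => //.
    apply: addr_ge0 => //; apply: mulr_ge0 (expR_ge0 _).
    by apply: exprn_ge0; exact: addr_ge0.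
  by rewrite [leRHS]mulrC mulrDl lerD.
pose q1 m : H := \sum_i \sum_j quad_noise W (tau n.+1 m) (tau n.+1 m.+1) i j w *:
    L i (L j (Y (tau n.+1 m) w)).
pose s m : H := \sum_l dW W t n m w l *: L l (Y (tau n.+1 m) w - V m).
have splitE : Y t w - z w - \sum_(m < n.+1) \sum_(l < k) dW W t n m w l *: L l (V m) =
    \sum_(m < n.+1) e m + 2^-1 *: \sum_(m < n.+1) q1 m + \sum_(m < n.+1) s m.
  have -> : Y t w - z w = \sum_(m < n.+1) (Y (tau n.+1 m.+1) w - Y (tau n.+1 m) w).
    rewrite -(big_mkord xpredT (fun m => Y (tau n.+1 m.+1) w - Y (tau n.+1 m) w)).
    rewrite telescope_sumr// grid_max grid0 /ito_flow W0 flow0//.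
  rewrite -sumrB scaler_sumr -!big_split/=; apply: eq_bigr => m _.
  have -> : s m = \sum_l dW W t n m w l *: L l (Y (tau n.+1 m) w) -
      \sum_l dW W t n m w l *: L l (V m).
    by rewrite -sumrB; apply: eq_bigr => l _; rewrite (linB _ _ (LC l).1) scalerBr.
  by rewrite /e -/(q1 m) subrK addrA subrK.
rewrite splitE (le_trans (ler_normD _ _))// lerD//; last first.
  rewrite mulr_sumr (le_trans (ler_norm_sum _ _ _))//; apply: ler_sum => m _.
  rewrite (le_trans (ler_norm_sum _ _ _))//.
  apply: (@le_trans _ _ (\sum_(l < k) 2 * K * C * `|Y (tau n.+1 m) w - V m|)).
    apply: ler_sum => l _; rewrite normrZ -mulrA ler_pM//; first exact: dWK.
    exact: (LC l).2.
  by rewrite sumr_const card_ord -[leLHS]mulr_natl !mulrA.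
rewrite (le_trans (ler_normD _ _))// lerD//.
  rewrite mulr_sumr (le_trans (ler_norm_sum _ _ _))//; apply: ler_sum => m _.
  exact: eb.
rewrite normrZ ger0_norm// ler_wpM2l//.
(* On the localizing event all indicators in [quad_integrand] are 1, so the truncated sums are the
   actual ones. *)
have -> : \sum_(m < n.+1) q1 m = \sum_i \sum_j
    quad_martingale W (tau n.+1) (quad_integrand W L z t K n i j) i j n.+1 w.
  rewrite exchange_big/=; apply: eq_bigr => i _.
  rewrite exchange_big/=; apply: eq_bigr => j _.
  apply: eq_bigr => m _; rewrite /quad_integrand gd//.
  exact: ltnW.
rewrite (le_trans (ler_norm_sum _ _ _))//; apply: ler_sum => i _.
exact: ler_norm_sum.
Qed.

End ito_remainder.

(** * The Ito formula for the flow *)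

Lemma grid_cell {R : realType} (t s : R) n : 0 < s <= t -> exists m : 'I_n.+1,
  forall i : 'I_n.+1, (grid t n.+1 i < s <= grid t n.+1 i.+1) = (i == m).
Proof.
move=> /andP[s0 st]; have t0 : 0 < t by exact: lt_le_trans st.
have gle a b : (a <= b)%N -> grid t n.+1 a <= grid t n.+1 b.
  by move=> ab; rewrite /grid ler_wpM2r ?invr_ge0// ler_wpM2l ?(ltW t0)// ler_nat.
have ex : exists p, s <= grid t n.+1 p by exists n.+1; rewrite grid_max.
case: (ex_minnP ex) => -[|p] sp pmin; first by move: sp; rewrite grid0 leNgt s0.
have pn : (p < n.+1)%N by apply: pmin; rewrite grid_max.
exists (Ordinal pn) => i; apply/andP/eqP => [[ti si]|->] /=.
  apply/val_inj/eqP => /=; rewrite eqn_leq; apply/andP; split; last exact: pmin si.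
  rewrite -ltnS ltnNge; by apply/negP => /gle h; move: ti; rewrite ltNge (le_trans sp h).
by split=> //; rewrite ltNge; apply/negP => /pmin; rewrite ltnn.
Qed.

Section noise_operator.
Context {R : realType} {H : completeNormedModType R} {k : nat}.
Variables (L : 'I_k -> H -> H) (C : R).
Hypotheses (C0 : 0 <= C) (LC : forall i, bounded_by (L i) C).
Context {E : normedModType R}.
Variable K : H -> E.
Hypotheses (lK : linear K) (nK : forall v, `|K v| = `|v|).

(** The operator B(v), carried by the isometry K into the target E: the estimates take place in H,
    while the integral lives in H_r. *)
Definition noise_fun (v : H) (y : 'rV[R]_k) : E := K (\sum_l y 0 l *: L l v).

Lemma noise_fun_linear v : linear (noise_fun v).
Proof.
move=> a x y; rewrite /noise_fun -lK scaler_sumr -big_split/=; congr K.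
by apply: eq_bigr => l _; rewrite !mxE scalerDl scalerA.
Qed.

Definition noise v : {linear 'rV[R]_k -> E} := HB.pack (noise_fun v)
  (GRing.isLinear.Build R 'rV[R]_k E *:%R (noise_fun v) (noise_fun_linear v)).

Lemma noise_linear y : linear (noise^~ y).
Proof.
move=> a u v; rewrite /= /noise_fun -lK scaler_sumr -big_split/=; congr K.
by apply: eq_bigr => l _; rewrite (LC l).1 scalerDr !scalerA mulrC.
Qed.

Lemma noise_continuous y : continuous (noise^~ y).
Proof.
apply: (lipschitz_continuous (a := \sum_l `|y 0 l| * C) (noise_linear y)) => v.
rewrite /= nK mulr_suml (le_trans (ler_norm_sum _ _ _))//; apply: ler_sum => l _.
by rewrite normrZ -mulrA ler_wpM2l//; exact: (LC l).2.
Qed.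

Lemma noise_delta v l : noise v (delta_mx 0 l) = K (L l v).
Proof.
rewrite /= /noise_fun (bigD1 l)//= mxE !eqxx scale1r big1 ?addr0// => i il.
by rewrite mxE eqxx (negPf il) scale0r.
Qed.

Lemma noise_delta_le v l : `|noise v (delta_mx 0 l)| <= C * `|v|.
Proof. by rewrite noise_delta nK; exact: (LC l).2. Qed.

End noise_operator.

Section ito_formula.
Context {R : realType} {H : completeNormedModType R} (ip : {dot H for @idfun R}).
Hypothesis hip : induces_norm ip.
Variables (q : nat -> H).
Hypothesis dq : dense_seq q.
Context {d : measure_display} {Omega : measurableType d}.
Variables (P : probability Omega R) (T : R) (F : R -> set (set Omega)).
Hypothesis hF : normal_filtration P T F.
Variables (k : nat) (W : R -> Omega -> 'rV[R]_k).
Hypothesis hW : standard_brownian_motion P T F W.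
Hypothesis hWc : forall omega (i : 'I_k),
  {within `[0, T], continuous (fun t => W t omega 0 i : R)}.
Variables (L : 'I_k -> H -> H) (C : R).
Hypotheses (C0 : 0 <= C) (LC : forall i, bounded_by (L i) C)
  (LL : forall i j v, L i (L j v) = L j (L i v)).
Variable (z : Omega -> H).
Hypothesis az : adapted F 0 z.
Variable t : R.
Hypotheses (t0 : 0 < t) (tT : t <= T).
Context {E : normedModType R}.
Variable K : H -> E.
Hypotheses (lK : linear K) (nK : forall v, `|K v| = `|v|).
Local Notation Y := (ito_flow W L z).
Local Notation tau := (grid t).
Local Notation noise := (noise L lK).
Local Notation Phi := (fun s w => noise (Y s w)).

Let Y_continuous w : {within `[0, T], continuous (fun s => Y s w)}.
Proof. exact: (ito_flow_continuous hWc C0 LC LL). Qed.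

Let Y_adapted s : 0 <= s <= T -> adapted F s (Y s).
Proof. exact: (ito_flow_adapted dq hF hW C0 LC az). Qed.

Lemma noise_progressive : progressive F t Phi.
Proof.
move=> u y U /andP[u0 ut] oU.
have uT : u <= T by exact: le_trans ut tT.
have mG := @process_measurable _ _ (g_sigma_algebraType (F u)) H T u Y uT Y_continuous.
have {}mG : open_measurable_fun (fun p : measurableTypeR R * g_sigma_algebraType (F u) =>
    if 0 < p.1 <= u then Y p.1 p.2 else 0).
  apply: mG => s /andP[s0 su]; apply: (adapted_mono hF s0 su uT).
  by apply: Y_adapted; rewrite s0 (le_trans su).
have := omf_comp mG (noise_continuous (lK := lK) LC nK (y := y)) oU => mU.
rewrite (_ : _ `&` _ = (`]0%R, u] `*` setT) `&` ((noise^~ y) \o (fun p =>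
    if 0 < p.1 <= u then Y p.1 p.2 else 0)) @^-1` U).
  by apply: measurableI => //; exact: measurableX.
apply/seteqP; split=> -[s w] [[/= su _] Us]; (split; first by []).
  by move: su; rewrite /= in_itv/= => ->.
by move: su Us; rewrite /= in_itv/= => ->.
Qed.

Let mY : open_measurable_fun (fun p : measurableTypeR R * Omega =>
  if 0 < p.1 <= t then Y p.1 p.2 else 0).
Proof.
apply: (process_measurable (T := T)) => // s /andP[s0 st].
have sT : 0 <= s <= T by rewrite s0 (le_trans st).
by apply: (adapted_omf hF sT); exact: Y_adapted.
Qed.

(** The integrand is linear in the state, so approximating it by elementary processes amounts to
    approximating the state by step functions in H. *)
Let residual n (V : nat -> Omega -> H) s w : H :=
  Y s w - \sum_(m < n) (if tau n m < s <= tau n m.+1 then V m w else 0).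

Let residual_measurable n V :
  (forall m, (m < n)%N -> open_measurable_fun (V m)) ->
  open_measurable_fun (fun p : measurableTypeR R * Omega =>
    if 0 < p.1 <= t then residual n V p.1 p.2 else 0).
Proof.
move=> mV.
have mI (a b : R) : measurable [set p : measurableTypeR R * Omega | a < p.1 <= b].
  rewrite (_ : [set _ | _] = `]a, b] `*` setT); first exact: measurableX.
  by apply/seteqP; split=> [[s w]|[s w] []] /=; rewrite in_itv.
rewrite (_ : (fun _ => _) = fun p => (if 0 < p.1 <= t then Y p.1 p.2 else 0) +
    (-1) *: (if 0 < p.1 <= t then \sum_(m < n)
      (if tau n m < p.1 <= tau n m.+1 then V m p.2 else 0) else 0)); last first.
  by apply/funext => p; case: ifP => _; rewrite scaleN1r// oppr0 addr0.
apply: (omfD dq) => //; apply: (omfZ dq) => //.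
apply: omf_if => //; last exact: omf_cst.
apply: (omf_sum dq) => m; apply: omf_if => //; last exact: omf_cst.
by apply: omf_snd; exact: mV.
Qed.

Let residualE n V s w y :
  Phi s w y - elementary_process n (tau n) (fun m w => noise (V m w)) s w y =
  noise (residual n V s w) y.
Proof.
have ln := noise_linear LC lK y.
rewrite /residual (linB _ _ ln); congr (_ - _).
rewrite /elementary_process (lin_sum _ _ _ ln); apply: eq_bigr => m _.
by case: ifP => // _; rewrite (lin0 ln).
Qed.

Let mPsi n V : (forall m, (m < n)%N -> open_measurable_fun (V m)) -> forall l,
  open_measurable_fun (fun p : measurableTypeR R * Omega => if 0 < p.1 <= t then
    (fun s w y => Phi s w y - elementary_process n (tau n) (fun m w => noise (V m w)) s w y)
      p.1 p.2 (delta_mx 0 l) else 0).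
Proof.
move=> mV l.
have := omf_comp (residual_measurable mV)
  (noise_continuous (lK := lK) LC nK (y := delta_mx 0 l)).
rewrite (_ : _ \o _ = fun p : measurableTypeR R * Omega => if 0 < p.1 <= t then
    (fun s w y => Phi s w y - elementary_process n (tau n) (fun m w => noise (V m w)) s w y)
      p.1 p.2 (delta_mx 0 l) else 0)//.
apply/funext => p; rewrite residualE /comp; case: ifP => // _.
exact: (lin0 (noise_linear LC lK (delta_mx 0 l))).
Qed.

Let residual_sq n V s w M : `|residual n V s w| <= M ->
  HSnorm2 (fun y => Phi s w y -
    elementary_process n (tau n) (fun m w => noise (V m w)) s w y) <= k%:R * (C * M) ^+ 2.
Proof.
move=> rM; apply: (@le_trans _ _ (\sum_(l < k) (C * M) ^+ 2)); last first.
  by rewrite sumr_const card_ord -[leLHS]mulr_natl.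
apply: ler_sum => l _; rewrite residualE.
have h := le_trans (noise_delta_le LC lK nK (residual n V s w) l) (ler_wpM2l C0 rM).
by rewrite lerXn2r ?nnegrE ?(le_trans _ h).
Qed.

Lemma noise_sq_integrable w : (sq_integral t (fun s w => Phi s w) w < +oo)%E.
Proof.
have [M hM] := within_itv_bounded (@Y_continuous w).
(* With an empty grid the residual is the integrand itself, so the same estimates apply. *)
have E0 : (fun s w => Phi s w : 'rV_k -> E) = (fun s w y => Phi s w y -
    elementary_process 0 (tau 0) (fun m w => noise ((fun _ _ => 0) m w)) s w y).
  apply/funext => s; apply/funext => w'; apply/funext => y.
  by rewrite /elementary_process big_ord0 subr0.
apply: (@le_lt_trans _ _ (k%:R * (C * M) ^+ 2 * t)%:E); last by rewrite ltry.
rewrite E0; apply: sq_integral_le; [exact: mPsi|exact: ltW|move=> s /andP[s0 st]].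
apply: residual_sq; rewrite /residual big_ord0 subr0; apply: hM.
by rewrite (ltW s0) (le_trans st).
Qed.

Let simple_omf s (V : Omega -> H) : 0 <= s <= T -> simple_wrt (F s) V -> open_measurable_fun V.
Proof.
by move=> sT [_ FV]; apply: (adapted_omf hF sT) => U _; apply/(filtrationE hF _ sT); exact: FV.
Qed.

(** The rounded left-point values serve for both limits: the integrands converge by uniform
    continuity of the paths, the integrals by [ito_error] after localization. *)
Lemma stochastic_convolution : is_stochastic_integral P F W t Phi
  (fun w => K (Y t w - z w)).
Proof.
have T0 : 0 <= T by rewrite ltW// (lt_le_trans t0).
have tTT : 0 <= t <= T by rewrite ltW.
have oz : open_measurable_fun z by apply: (adapted_omf hF _ az); rewrite lexx.
have oI : open_measurable_fun (fun w => Y t w - z w).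
  rewrite (_ : (fun w => _) = fun w => Y t w + (-1) *: z w); last first.
    by apply/funext => w; rewrite scaleN1r.
  apply: (omfD dq); first exact: (adapted_omf hF tTT (Y_adapted tTT)).
  exact: (omfZ dq).
have cK : continuous K.
  by apply: (lipschitz_continuous (a := 1) lK) => v; rewrite mul1r nK.
split.
- exact: noise_progressive.
- exact/aeW/noise_sq_integrable.
- exact: (omf_borel (omf_comp (g := K) oI cK)).
have [V [B [sV mB PB hB]]] := grid_approximation dq hF t0 tT Y_adapted.
have oV j m : (m < j.+1)%N -> open_measurable_fun (V j m).
  by move=> mj; apply: simple_omf (sV j m mj); exact: (grid_boundT t0 tT (ltnW mj)).
exists S, (fun j => tau j.+1), (fun j m w => noise (V j m w)); split.
- move=> j; split; [exact: grid0|exact: grid_max|by move=> m _; exact/ltW/grid_lt|].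
  move=> m mj; have [fV FV] := sV j m mj; split.
    have -> : range (fun w => noise (V j m w)) = (fun v => noise v) @` range (V j m).
      by rewrite image_comp.
    exact: finite_image.
  by move=> Q; exact: (FV [set v | noise v = Q]).
- apply: (cvg_probability_off (B := B)) => //.
    by move=> j; apply: measurable_sq_integral; apply: mPsi; exact: oV.
  move=> w e e0.
  have C1 : 0 < k%:R * (C * 2) ^+ 2 * t + 1 by rewrite ltr_wpDl// !mulr_ge0 ?sqr_ge0// ltW.
  (* The final bound is quadratic in rho; rho <= 1 makes it at most linear, and the second argument
     then keeps it below e. *)
  pose rho := Num.min 1 (e / (2 * (k%:R * (C * 2) ^+ 2 * t + 1))).
  have rho0 : 0 < rho by rewrite lt_min ltr01 divr_gt0// mulr_gt0.
  have rho1 : rho <= 1 by rewrite ge_min lexx.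
  have rhoe : rho * (2 * (k%:R * (C * 2) ^+ 2 * t + 1)) <= e.
    by rewrite -ler_pdivlMr ?mulr_gt0// ge_min lexx orbT.
  have [dd dd0 hd] := within_itv_uniform (@Y_continuous w) rho0.
  have [N1 hN1] := nat_bound (2 * t / dd); have [N2 hN2] := nat_bound rho^-1.
  exists (maxn N1 N2) => j; rewrite geq_max => /andP[j1 j2] nBw.
  have jd : t / j.+1%:R < dd.
    have := hN1 j j1; rewrite ler_pdivrMr// => h.
    by rewrite ltr_pdivrMr// [ltRHS]mulrC (lt_le_trans _ h)// mulr_natl mulr2n ltrDl.
  have jrho : j.+1%:R^-1 <= rho by rewrite invf_ple ?posrE// hN2.
  apply: (@le_lt_trans _ _ (k%:R * (C * (2 * rho)) ^+ 2 * t)%:E); last first.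
    rewrite lte_fin.
    have -> : k%:R * (C * (2 * rho)) ^+ 2 * t = k%:R * (C * 2) ^+ 2 * t * rho * rho by ring.
    have a0 : 0 <= k%:R * (C * 2) ^+ 2 * t by rewrite !mulr_ge0 ?sqr_ge0// ltW.
    by move: (k%:R * (C * 2) ^+ 2 * t) a0 rhoe C1 => a a0 rhoe C1; nra.
  apply: sq_integral_le; [exact: mPsi (oV j)|exact: ltW|move=> s sit].
  apply: residual_sq; have [m hm] := grid_cell j sit.
  have := hm m; rewrite eqxx => /andP[ms sm1].
  (* Exactly one cell contains s. The distance is at most rho from moving to the left end point plus
     at most 1/(j + 1) <= rho from rounding, whence 2 * rho. *)
  have -> : residual j.+1 (V j) s w = Y s w - V j m w.
    rewrite /residual (bigD1 m)//= hm eqxx big1 ?addr0// => i im.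
    by rewrite hm (negPf im).
  have mT := grid_boundT t0 tT (ltnW (ltn_ord m)).
  have /andP[s0 st] := sit.
  rewrite -(subrKA (Y (tau j.+1 m) w)) (le_trans (ler_normD _ _))// mulr_natl mulr2n lerD//.
    apply: ltW; apply: hd => //; first by rewrite (ltW s0) (le_trans st).
    rewrite ger0_norm ?subr_ge0 ?(ltW ms)// (le_lt_trans _ jd)//.
    by rewrite -(grid_step t j m) lerB.
  rewrite (le_trans _ jrho)// (le_trans _ (ltW (hB j w nBw)))//.
  by rewrite (bigD1 m)//= lerDl sumr_ge0.
pose S1 j w := \sum_(m < j.+1) \sum_(l < k) dW W t j m w l *: L l (V j m w).
have nE j w : `|K (Y t w - z w) - elementary_integral W j.+1 (tau j.+1)
    (fun m w => noise (V j m w)) w| = `|Y t w - z w - S1 j w|.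
  rewrite -nK (linB (Y t w - z w) _ lK) /elementary_integral /S1.
  rewrite (lin_sum _ _ _ lK); congr (`|_ - _|); apply: eq_bigr => m _.
  by congr K; apply: eq_bigr => l _; rewrite !mxE.
apply: (cvg_outer_prob (g := fun j w => `|Y t w - z w - S1 j w|)); last first.
- by move=> j w; rewrite lee_fin nE.
- have ca : cvg_outer P (fun j w => \sum_(m < j.+1) `|Y (tau j.+1 m) w - V j m w|).
    move=> e eta e0 eta0.
    have [N1 hN1] := nat_bound e^-1; have [N2 hN2] := nat_bound eta^-1.
    exists (maxn N1 N2) => j; rewrite geq_max => /andP[j1 j2].
    exists (B j); split=> //.
      by rewrite (le_trans (PB j))// lee_fin invf_ple ?posrE// hN2.
    move=> w nB; rewrite (lt_le_trans (hB j w nB))// invf_ple ?posrE// hN1//.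
  apply: cvg_outer_local => eta eta0.
  have [K0 [A [K00 mA PA hA]]] := bounded_state_event hF hW hWc az t0 tT eta0.
  exists A, (fun j w => expR (C * (k%:R * (2 * K0)) + k%:R * C ^+ 2 * T / 2) *
    flow_bound T k C K0 * taylor_remainder W C t j w +
  2^-1 * (\sum_i \sum_l
    `|quad_martingale W (tau j.+1) (quad_integrand W L z t K0 j i l) i l j.+1 w|) +
  k%:R * (2 * K0) * C * \sum_(m < j.+1) `|Y (tau j.+1 m) w - V j m w|); split=> //.
    apply: cvg_outerD.
      apply: cvg_outerD.
        apply: cvg_outerZ; first by rewrite !mulr_ge0 ?expR_ge0.
        exact: (taylor_remainder_cvg hF hW C0 t0 tT).
      apply: cvg_outerZ => //; apply: cvg_outer_sum => i; apply: cvg_outer_sum => l.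
      exact: (quad_martingale_cvg hip dq hF hW C0 LC az t0 tT).
    by apply: cvg_outerZ ca; rewrite !mulr_ge0.
  move=> j w Aw; have [W0 gd] := hA w Aw.
  exact: (ito_error C0 LC LL t0 tT (fun m => V j m w) K00 W0 (gd j)).
- move=> j; apply/measurable_EFinP.
  rewrite (_ : (fun w => _) = fun w => `|Y t w - z w - S1 j w|); last first.
    by apply/funext => w; exact: nE.
  apply: omf_norm.
  rewrite (_ : (fun w => _) = fun w => (Y t w - z w) + (-1) *: S1 j w); last first.
    by apply/funext => w; rewrite scaleN1r.
  apply: (omfD dq) => //; apply: (omfZ dq) => //.
  apply: (omf_sum dq) => m; apply: (omf_sum dq) => l; apply: (omfZ dq).
    have /andP[m0 _] := grid_boundT t0 tT (ltnW (ltn_ord m)).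
    have /andP[_ m1T] := grid_boundT t0 tT (ltn_ord m).
    exact: (increment_measurable hF hW m0 (grid_lt t0 j m) m1T).
  exact: omf_comp (oV j m (ltn_ord m)) (bounded_by_continuous (LC l)).
Qed.

End ito_formula.

(** * Mild solutions *)

Lemma stochastic_integral0 {R : realType} {d : measure_display} {Omega : measurableType d}
    (P : probability Omega R) (F : R -> set (set Omega)) (k : nat) (W : R -> Omega -> 'rV[R]_k)
    (E : normedModType R) (Phi : R -> Omega -> {linear 'rV[R]_k -> E}) :
  is_stochastic_integral P F W 0 Phi (fun=> 0).
Proof.
have sq0 (Psi : R -> Omega -> 'rV[R]_k -> E) w : sq_integral 0 Psi w = 0%E.
  rewrite /sq_integral (_ : [set` _] = set0) ?integral_set0//.
  by apply/seteqP; split=> // s /=; rewrite in_itv/= => /andP[/lt_le_trans h /h]; rewrite ltxx.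
have cvg0 (f : nat -> Omega -> \bar R) : (forall n w, f n w = 0%E) -> cvg_in_probability0 P f.
  move=> f0; split=> [n|e e0].
    by rewrite (_ : f n = cst 0%E)//; apply/funext => w; rewrite f0.
  rewrite (_ : (fun n => _) = fun=> 0%E); first exact: cvg_cst.
  apply/funext => n; rewrite (_ : [set _ | _] = set0) ?measure0//.
  by apply/seteqP; split=> // w /=; rewrite f0 lee_fin leNgt e0.
split.
- move=> u y U /andP[u0 u0'] oU; rewrite (_ : _ `&` _ = set0)//.
  apply/seteqP; split=> // -[s w] [[/=]]; rewrite in_itv/= => /andP[s0 su].
  by have := lt_le_trans s0 (le_trans su u0'); rewrite ltxx.
- by apply: aeW => w; rewrite sq0.
- exact: omf_borel (@omf_cst _ _ _ _).
(* There are no cells: the value [Phi 0 point] is a default that enters no sum. *)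
exists (fun=> 0%N), (fun _ _ => 0), (fun _ _ _ => Phi 0 point); split.
- by move=> j; split.
- by apply: cvg0 => n w; exact: sq0.
- by apply: cvg0 => n w; rewrite /elementary_integral big_ord0 subr0 normr0.
Qed.

Lemma continuous_linear_family {R : realType} {H : completeNormedModType R} k
    (L : 'I_k -> {linear H -> H}) : (forall i, continuous (L i)) ->
  exists2 C : R, 0 <= C & forall i, bounded_by (L i) C.
Proof.
move=> cL.
have h i : exists M : R, forall v, `|L i v| <= M * `|v|.
  have /linear_bounded_continuous/linear_boundedP[M [_ hM]] := cL i.
  by exists (M + 1) => v; apply: hM; rewrite ltrDl.
have [M hM] := choice h.
exists (\sum_i `|M i|) => [|i]; first exact: sumr_ge0.
split=> [|v]; first exact: linearP.
rewrite (le_trans (hM i v))// ler_wpM2r// (le_trans (ler_norm _))//.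
by rewrite (bigD1 i)//= lerDl sumr_ge0.
Qed.

Section diagonal.
Context {R : realType} {H : completeNormedModType R} (ip : {dot H for @idfun R})
  (BB : set H) (lam : H -> R) (eta : R).
Hypothesis (hip : induces_norm ip) (hBB : orthonormal_basis ip BB).
Local Notation mult := (multiplier ip BB).
Local Notation mdom := (multiplier_dom ip BB).
Local Notation pw r := (fun b => (eta + lam b) `^ r).
Local Notation ex t := (fun b => expR (- (t * lam b))).

Lemma bounded_mult f : bounded_on_basis BB f -> exists2 C, 0 <= C & bounded_by (mult f) C.
Proof.
move=> [C hC]; exists `|C| => //; apply: mult_bounded => // b Bb.
exact: le_trans (hC b Bb) (ler_norm C).
Qed.

Lemma mult_linear f : bounded_on_basis BB f -> linear (mult f).
Proof. by move=> /bounded_mult[C _ []]. Qed.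

Lemma mult_continuous f : bounded_on_basis BB f -> continuous (mult f).
Proof. by move=> /bounded_mult[C _ /bounded_by_continuous]. Qed.

Lemma bounded_dom f v : bounded_on_basis BB f -> mdom f v.
Proof. by move=> [C hC]; exact: bounded_multiplier_dom hC. Qed.

Lemma mult_comm_mult f g v : spectral BB lam f -> bounded_on_basis BB g -> mdom f v ->
  mdom f (mult g v) /\ mult f (mult g v) = mult g (mult f v).
Proof.
move=> sf bg; apply: (mult_comm hip hBB (mult_linear bg) (mult_continuous bg)) sf.
move=> b b' Bb Bb'; rewrite (mult_basis hip hBB g Bb).2 ipZr.
have [-> //|nbb] := eqVneq b b'.
by rewrite hBB.1// [b' == b]eq_sym (negPf nbb) mulr0 eqxx.
Qed.

Lemma bounded_mult_comp f g v : bounded_on_basis BB g ->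
  bounded_on_basis BB (fun b => f b * g b) ->
  mdom f (mult g v) /\ mult f (mult g v) = mult (fun b => f b * g b) v.
Proof. by move=> bg bfg; apply: (mult_comp hip hBB); exact: bounded_dom. Qed.

Lemma domain_dense (DA : set H) (A : H -> H) :
  diagonal_operator ip BB lam DA A -> dense DA.
Proof.
move=> hA; have [hD _] := hA; apply/dense_ballP => v e e0.
have [_ /(_ v) sv] := hBB.
have FF := @summability.totally_filter H.
have /cvgrPdist_lt/(_ e e0) := sv.
move=> /filter_ex[A0 hA0]; eexists; last exact: hA0.
have D0 : DA 0 by rewrite hD; apply: (multiplier_domE hip hBB (w := 0)) => b _; rewrite !ip0r mulr0.
have DD a u v' : DA u -> DA v' -> DA (a *: u + v').
  by rewrite hD => du dv; have [] := mult_linear_dom hip hBB a du dv.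
rewrite /summability.partial_sum; apply: (big_ind DA) => //.
  by move=> u v' Du Dv; rewrite -(scale1r u); exact: DD.
move=> b _; case: ifPn => // /set_mem Bb; rewrite -[X in DA X]addr0; apply: DD => //.
exact: (A_basis hip hBB hA Bb).1.
Qed.

End diagonal.

Section mild_solution.
Context {R : realType} {H : completeNormedModType R} (ip : {dot H for @idfun R})
  (BB : set H) (lam : H -> R) (eta : R).
Hypothesis (hip : induces_norm ip) (hBB : orthonormal_basis ip BB).
Variable c : R.
Hypotheses (c0 : 0 < c) (lamc : forall b, BB b -> c <= eta + lam b).
Variable Hs : interpolation_spaces ip BB lam eta.
Local Notation mult := (multiplier ip BB).
Local Notation mdom := (multiplier_dom ip BB).
Local Notation pw r := (fun b => (eta + lam b) `^ r).
Local Notation ex t := (fun b => expR (- (t * lam b))).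

Variables (k : nat) (L : 'I_k -> H -> H) (C : R).
Hypotheses (C0 : 0 <= C) (LC : forall i, bounded_by (L i) C)
  (LL : forall i j v, L i (L j v) = L j (L i v))
  (L_eig : forall i b b', BB b -> BB b' -> ip b' (L i b) != 0 -> lam b = lam b').

Lemma operator_mult_comm i f v : spectral BB lam f -> mdom f v ->
  mdom f (L i v) /\ mult f (L i v) = L i (mult f v).
Proof.
apply: (mult_comm hip hBB (LC i).1 (bounded_by_continuous (LC i))) => b b'.
exact: L_eig.
Qed.

Lemma flow_mult_comm f s w v : spectral BB lam f -> bounded_on_basis BB f ->
  mult f (flow L s w v) = flow L s w (mult f v).
Proof.
move=> sf bf; apply: (flow_comm C0 LC) (mult_linear hip hBB bf) (mult_continuous hip hBB bf) _.
by move=> i u; exact: (operator_mult_comm i sf (bounded_dom hip hBB u bf)).2.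
Qed.

Lemma noise_mult_comm f (y : 'rV[R]_k) v : spectral BB lam f -> bounded_on_basis BB f ->
  mult f (\sum_l y 0 l *: L l v) = \sum_l y 0 l *: L l (mult f v).
Proof.
move=> sf bf; have lf := mult_linear hip hBB bf.
rewrite (lin_sum _ _ _ lf); apply: eq_bigr => l _; rewrite (linZ _ _ lf).
by rewrite (operator_mult_comm l sf (bounded_dom hip hBB v bf)).2.
Qed.

Section one_space.
Variables (r : R) (J : Hs r -> H) (K : H -> Hs r).
Hypothesis JK : scale_iso J K.

(** [K] lowers the exponent by r. Vectors from different spaces of the scale are thereby compared as
    images of vectors of H in the ambient space. *)
Lemma scale_iso_mult f g v : bounded_on_basis BB g -> bounded_on_basis BB f ->
  (forall b, BB b -> pw (- r) b * g b = f b) ->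
  space_inj Hs r (K (mult g v)) = base_inj Hs (mult f v).
Proof.
move=> bg [M hM] fE.
have [|dg E] := @bounded_mult_comp _ _ ip BB hip hBB (pw (- r)) g v bg.
  by exists M => b Bb; rewrite fE// hM.
by rewrite (scale_iso_space hip hBB c0 lamc JK dg) E (eq_mult ip v fE).
Qed.

Lemma induced_semigroup t : 0 <= t ->
  induced_op (Hs := Hs) (r := r) (semigroup ip BB lam t) = fun x => K (mult (ex t) (J x)).
Proof.
move=> t0; have bt := semigroup_bounded c0 lamc t0.
have [M _ hM] := bounded_mult hip hBB bt.
apply: (induced_opE hip hBB c0 lamc JK hM) => v dv.
by apply: mult_comm_mult => //; exact: spectral_pow.
Qed.

Lemma induced_operator i :
  induced_op (Hs := Hs) (r := r) (L i) = fun x => K (L i (J x)).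
Proof.
apply: (induced_opE hip hBB c0 lamc JK (LC i)) => v dv.
by apply: operator_mult_comm => //; exact: spectral_pow.
Qed.

Lemma induced_flow s w v :
  exp_op (exponent (fun i => induced_op (Hs := Hs) (r := r) (L i)) s w) (K v) =
  K (flow L s w v).
Proof.
have [[lJ lK] [nJ nK] JKx KJx _] := JK; have [cJ cK] := scale_iso_continuous JK.
have E : exponent (fun i => induced_op (Hs := Hs) (r := r) (L i)) s w =
    fun x => K (exponent L s w (J x)).
  apply/funext => x; rewrite /exponent (lin_sum _ _ _ lK); apply: eq_bigr => i _.
  by rewrite !induced_operator KJx (linB _ _ lK) !(linZ _ _ lK).
have e0 := exponent_bound_ge0 C0 s w; have [lE bE] := exponent_bounded C0 LC s w.
apply/esym; rewrite E; apply: (exp_op_comm v e0 e0) => //.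
  split=> [a u u'|u]; first by rewrite lJ lE lK.
  by rewrite nK -(nJ u); exact: bE.
by move=> u; rewrite KJx.
Qed.

End one_space.

(** Every term becomes the image of a vector of H with multiplier (eta + lam)^(- delta) e^(- t lam):
    in H_delta directly, in H_r because - r + (r - delta) = - delta. *)
Lemma mild_identity delta r t (Jd : Hs delta -> H) Kd (Jr : Hs r -> H) Kr
    (x : H) s w : scale_iso Jd Kd -> scale_iso Jr Kr -> 0 < t ->
  space_inj Hs delta (Kd (flow L s w (mult (ex t) x))) =
  space_inj Hs delta (Kd (mult (ex t) x)) +
  space_inj Hs r (Kr (flow L s w (mult (fun b => pw (r - delta) b * ex t b) x) -
    mult (fun b => pw (r - delta) b * ex t b) x)).
Proof.
move=> JKd JKr t0.
have bt := semigroup_bounded c0 lamc (ltW t0).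
have bg := smoothing_bound c0 lamc (r - delta) t0.
have bf := smoothing_bound c0 lamc (- delta) t0.
have st := @spectral_exp _ _ BB lam t.
have sg : spectral BB lam (fun b => pw (r - delta) b * ex t b).
  by move=> b b' Bb Bb' bb'; rewrite bb'.
have h1 v : space_inj Hs delta (Kd (mult (ex t) v)) =
    base_inj Hs (mult (fun b => pw (- delta) b * ex t b) v).
  exact: (scale_iso_mult JKd v bt bf).
have h2 v : space_inj Hs r (Kr (mult (fun b => pw (r - delta) b * ex t b) v)) =
    base_inj Hs (mult (fun b => pw (- delta) b * ex t b) v).
  apply: (scale_iso_mult JKr v bg bf) => b Bb.
  by rewrite mulrA (powD c0 lamc)// addrA addNr add0r.
have [[_ lK] _ _ _ _] := JKr.
rewrite -!flow_mult_comm// h1 h1 (linB _ _ lK) linearB/= !h2.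
by rewrite addrC subrK.
Qed.

(** The witness h is X_s seen in H, which exists since e^(sA) with s > 0 compensates (eta - A)^(-
    delta). Applying e^((t - s)A) restores e^(tA), so s survives only in the flow and the vector on
    the H_r side does not depend on it. *)
Lemma mild_integrandE delta r t s (Jd : Hs delta -> H) Kd (Jr : Hs r -> H) Kr
    (x : H) u w : scale_iso Jd Kd -> scale_iso Jr Kr -> 0 < s -> s <= t ->
  exists h : H, base_inj Hs h = space_inj Hs delta (Kd (flow L u w (mult (ex s) x))) /\
    forall y : 'rV[R]_k,
      space_inj Hs r (Kr (\sum_l y 0 l *: L l
        (flow L u w (mult (fun b => pw (r - delta) b * ex t b) x)))) =
      base_inj Hs (mult (ex (t - s)) (\sum_l y 0 l *: L l h)).
Proof.
move=> JKd JKr s0 st; have t0 := lt_le_trans s0 st.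
have bs := semigroup_bounded c0 lamc (ltW s0).
have bts : bounded_on_basis BB (ex (t - s)).
  by apply: (semigroup_bounded c0 lamc); rewrite subr_ge0.
have bg := smoothing_bound c0 lamc (r - delta) t0.
have bf := smoothing_bound c0 lamc (- delta) t0.
have bh := smoothing_bound c0 lamc (- delta) s0.
have ss := @spectral_exp _ _ BB lam s.
have sg : spectral BB lam (fun b => pw (r - delta) b * ex t b).
  by move=> b b' Bb Bb' bb'; rewrite bb'.
have sh : spectral BB lam (fun b => pw (- delta) b * ex s b).
  by move=> b b' Bb Bb' bb'; rewrite bb'.
exists (mult (fun b => pw (- delta) b * ex s b) (flow L u w x)); split=> [|y].
  by rewrite -flow_mult_comm// (scale_iso_mult JKd _ bs bh).
rewrite -flow_mult_comm// -!noise_mult_comm//.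
rewrite (scale_iso_mult JKr _ bg bf); last first.
  by move=> b Bb; rewrite mulrA (powD c0 lamc)// addrA addNr add0r.
have fE b : BB b -> pw (- delta) b * ex t b = ex (t - s) b * (pw (- delta) b * ex s b).
  move=> _; rewrite mulrCA; congr (_ * _); rewrite -expRD; congr expR; ring.
rewrite (eq_mult ip _ fE); congr (base_inj Hs _).
have bfg : bounded_on_basis BB (fun b => ex (t - s) b * (pw (- delta) b * ex s b)).
  by have [M hM] := bf; exists M => b Bb; rewrite -fE// hM.
by have [_ ->] := bounded_mult_comp hip hBB (\sum_l y 0 l *: L l (flow L u w x)) bh bfg.
Qed.

End mild_solution.

Theorem proposition3p3 (R : realType)
    (H : completeNormedModType R) (ip : {dot H for @idfun R})
    (hip : induces_norm ip) (hsep : separable_space H)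
    (T eta delta : R) (hT : 0 < T)
    (d : measure_display) (Omega : measurableType d) (P : probability Omega R)
    (F : R -> set (set Omega)) (hF : normal_filtration P T F)
    (DA : set H) (A : H -> H) (BB : set H) (lam : H -> R)
    (hBB : orthonormal_basis ip BB) (hA : diagonal_operator ip BB lam DA A)
    (hspec : spectrum DA A `<=` [set x | x < eta])
    (Hs : interpolation_spaces ip BB lam eta)
    (k : nat) (hk : (0 < k)%N)
    (xi : Omega -> Hs delta) (hxi : borel_measurable_wrt (F 0) xi)
    (L : 'I_k -> {linear H -> H}) (hLc : forall i, continuous (L i))
    (B : H -> {linear 'rV[R]_k -> H}) (hB : bounded_HS B)
    (hLD : forall i, L i @` DA `<=` DA)
    (hLL : forall i j u, DA u -> L i (L j u) - L j (L i u) = 0)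
    (hLA : forall i u, DA u -> L i (A u) - A (L i u) = 0)
    (hBL : forall v (y : 'rV[R]_k), B v y = \sum_(l < k) y 0 l *: L l v)
    (W : R -> Omega -> 'rV[R]_k)
    (hW : standard_brownian_motion P T F W)
    (hWc : forall omega (i : 'I_k),
       {within `[0, T], continuous (fun t => W t omega 0 i : R)})
    (X : R -> Omega -> Hs delta)
    (hX : forall t omega, 0 <= t <= T ->
       X t omega =
       exp_op (exponent (fun i => induced_op (Hs := Hs) (r := delta) (L i))
                        t (W t omega))
         (induced_op (semigroup ip BB lam t) (xi omega))) :
  (forall omega, {within `[0, T], continuous (fun t => X t omega)}) /\
  forall r t : R, 0 <= t <= T ->
    exists (Phi : R -> Omega -> {linear 'rV[R]_k -> Hs r}) (I : Omega -> Hs r),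
      [/\ mild_integrand B t X Phi,
          {ae P, forall omega,
             (\int[lebesgue_measure]_(s in `]0%R, t])
                (HSnorm2 (Phi s omega))%:E < +oo)%E},
          is_stochastic_integral P F W t Phi I
        & {ae P, forall omega,
             space_inj Hs delta (X t omega)
             = space_inj Hs delta (induced_op (semigroup ip BB lam t) (xi omega))
               + space_inj Hs r (I omega)}].
Proof.
have T0 : (0 : R) <= 0 <= T by rewrite lexx ltW.
have [q dq] := separable_dense_seq hsep.
have [c c0 lamc] := spectral_gap hip hBB hA hspec.
have [C C0 LC] := continuous_linear_family hLc.
(* The commutation assumed on D(A) extends to H by density and continuity. *)
have LL i j v : L i (L j v) = L j (L i v).
  suff /(congr1 (fun f => f v)) : (fun u => L i (L j u)) = (fun u => L j (L i u)) by [].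
  apply: (dense_eq (domain_dense hip hBB hA)).
  - by move=> x; apply: continuous_comp; exact: hLc.
  - by move=> x; apply: continuous_comp; exact: hLc.
  - by move=> x Dx; apply/subr0_eq; exact: hLL.
have L_eig i := comm_A_eig hip hBB hA (hLD i) (hLA i).
have [Jd [Kd JKd]] := scale_iso_exists hip hBB c0 lamc Hs delta.
have [[lJd lKd] [nJd nKd] JKdx KJdx _] := JKd.
have [cJd cKd] := scale_iso_continuous JKd.
(* This is (eta - A)^delta xi, the initial value read in H; continuity of the isometry carries
   F_0-measurability over. *)
pose x0 := Jd \o xi.
have ax0 : adapted F 0 x0.
  move=> U oU; apply/(filtrationE hF _ T0); apply: (hxi (Jd @^-1` U)).
  by apply: sub_sigma_algebra; apply: open_comp => // x _; exact: cJd.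
have XE s w : 0 <= s <= T ->
    X s w = Kd (flow L s (W s w) (semigroup ip BB lam s (x0 w))).
  move=> sT; rewrite hX// (induced_semigroup hip hBB c0 lamc JKd); last by case/andP: sT.
  exact: (induced_flow hip hBB c0 lamc C0 LC L_eig JKd).
split=> [w|r t /andP[t0 tT]].
  have cf := flow_path_continuous C0 LC LL (T := T) (w := fun s => W s w)
    (fun i => @hWc w i) (semigroup_continuous hip hBB c0 lamc (T := T) (v := x0 w)).
  apply/within_itv_continuousP => s sT e e0.
  have [dd dd0 hd] := (within_itv_continuousP _ T).1 cf s sT e e0.
  exists dd => // u uT su; rewrite !XE// -(linB _ _ lKd) nKd.
  exact: hd.
have [Jr [Kr JKr]] := scale_iso_exists hip hBB c0 lamc Hs r.
have [[lJr lKr] [nJr nKr] _ _ _] := JKr.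
have [W0 _ _] := hW.
(* At t = 0 nothing is smoothed and the vector z below need not exist; the interval is empty, and
   W_0 = 0 holds almost surely. *)
have [t1|t1] := eqVneq t 0.
  exists (fun _ _ => noise L lKr 0), (fun=> 0).
  have sI := stochastic_integral0 P F W (fun _ _ => noise L lKr 0).
  rewrite t1; split=> //.
  - by move=> s w /andP[/lt_le_trans h /h]; rewrite ltxx.
  - by have [] := sI.
  - apply: filterS W0 => w Ww; rewrite XE// Ww flow0 linear0 addr0.
    by rewrite (induced_semigroup hip hBB c0 lamc JKd).
have {t1}t0 : 0 < t by rewrite lt_neqAle eq_sym t1.
pose g b := (eta + lam b) `^ (r - delta) * expR (- (t * lam b)).
(* Since [x0] is (eta - A)^delta xi, this is (eta - A)^r e^(tA) xi; the symbol g is bounded because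
   t > 0. *)
pose z w := multiplier ip BB g (x0 w).
have bg := smoothing_bound c0 lamc (r - delta) t0.
have az : adapted F 0 z by exact: (omf_comp (g := multiplier ip BB g) ax0 (mult_continuous hip hBB bg)).
have sI := stochastic_convolution hip dq hF hW hWc C0 LC LL az t0 tT lKr nKr.
exists (fun s w => noise L lKr (ito_flow W L z s w)), (fun w => Kr (ito_flow W L z t w - z w)).
split=> //.
- move=> s w /andP[s0 st]; rewrite XE; last by rewrite (ltW s0) (le_trans st).
  have [h [hE hy]] := mild_integrandE hip hBB c0 lamc C0 LC L_eig (x0 w) s (W s w) JKd JKr s0 st.
  by exists h; split=> // y; rewrite hBL -hy.
- by have [] := sI.
- apply: aeW => w; rewrite XE ?(ltW t0)// (induced_semigroup hip hBB c0 lamc JKd (ltW t0)).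
  exact: (mild_identity hip hBB c0 lamc C0 LC L_eig (x0 w) t (W t w) JKd JKr t0).
Qed.
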